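(* Let $q\ge4$ be a fixed even integer and $\beta>0$ a constant. Let $\rho_\beta$ and $\rho_\beta'$ be the Gibbs states at inverse temperature $\beta$ of two independent SYK instances $H$ and $H'$. Then, with probability $1-o(1)$ as $n\to\infty$, \[ \max_{I \in \binom{[n]}{q}} \left|\mathrm{Tr}(\psi_I \rho_\beta) - \mathrm{Tr}(\psi_I \rho_\beta')\right| = \Omega\left(n^{-(q-1)/2}\right). \]
   Context: Majorana operators $\psi_1,\dots,\psi_n$ ($n$ even) are Hermitian operators on a Hilbert space of dimension $2^{n/2}$ with $\{\psi_i,\psi_j\}=\delta_{ij}$; for $I=\{i_1<\dots<i_q\}$, $\psi_I=i^{q/2}\psi_{i_1}\cdots\psi_{i_q}$. An SYK instance is $H=\sum_{I\in\binom{[n]}{q}}J_I\psi_I$ with $J_I$ i.i.d. $\mathcal{N}(0,\sigma^2)$, $\sigma^2=(q-1)!/n^{q-1}$, and its Gibbs state is $\rho_\beta=e^{-\beta H}/\mathrm{Tr}\,e^{-\beta H}$. *)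

(* Defs.v *)
From HB Require Import structures.
From mathcomp Require Import all_boot all_order all_algebra.
From mathcomp Require Import all_classical all_reals all_analysis.
From mathcomp Require Import Rstruct Rstruct_topology.
From mathcomp Require Import complex.


Set Implicit Arguments.
Unset Strict Implicit.
Unset Printing Implicit Defensive.

Import Order.TTheory GRing.Theory Num.Theory.
Local Open Scope ring_scope.
Local Open Scope complex_scope.
Local Open Scope classical_set_scope.

Notation RR := Rdefinitions.R.
Notation CC := (RR[i]).
Notation RM := (measurableTypeR RR).

Definition adjmx m n (A : 'M[CC]_(m, n)) : 'M[CC]_(n, m) :=
  \matrix_(i, j) (A j i)^*.

Definition is_majorana (n : nat) (psi : 'I_n -> 'M[CC]_(2 ^ n./2)) : Prop :=
  (forall i, adjmx (psi i) = psi i) /\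
  (forall i j, psi i *m psi j + psi j *m psi i = ((i == j)%:R : CC)%:M).

(** psi_I = i^{|I|/2} psi_{i_1} ... psi_{i_|I|} with i_1 < ... < i_|I|
    (enum of a set of ordinals lists its elements in increasing order). *)
Definition psiI (n : nat) (psi : 'I_n -> 'M[CC]_(2 ^ n./2)) (I : {set 'I_n})
  : 'M[CC]_(2 ^ n./2) :=
  ('i ^+ (#|I| %/ 2)) *: foldr (fun i M => psi i *m M) 1%:M (enum I).

Definition SYK_H (n q : nat) (psi : 'I_n -> 'M[CC]_(2 ^ n./2))
  (Jv : {set 'I_n} -> RR) : 'M[CC]_(2 ^ n./2) :=
  \sum_(I : {set 'I_n} | #|I| == q) (Jv I)%:C *: psiI psi I.

Definition SYK_sigma (n q : nat) : RR :=
  Num.sqrt ((q.-1)`!%:R / (n%:R ^+ q.-1)).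

Definition expm_partial (N : nat) (A : 'M[CC]_N) (k : nat) : 'M[CC]_N :=
  \sum_(j < k) ((j`!%:R : CC)^-1 *: iter j (mulmx A) 1%:M).

Definition expm (N : nat) (A : 'M[CC]_N) : 'M[CC]_N :=
  \matrix_(a, b)
    (limn (fun k => complex.Re (expm_partial A k a b)) +i*
     limn (fun k => complex.Im (expm_partial A k a b))).

Definition gibbs (N : nat) (beta : RR) (H : 'M[CC]_N) : 'M[CC]_N :=
  (\tr (expm ((- beta)%:C *: H)))^-1 *: expm ((- beta)%:C *: H).

Definition max_dev (n q : nat) (psi : 'I_n -> 'M[CC]_(2 ^ n./2))
  (rho rho' : 'M[CC]_(2 ^ n./2)) : RR :=
  \big[Num.max/0]_(I : {set 'I_n} | #|I| == q)
     ComplexField.Normc.normc (\tr (psiI psi I *m rho) - \tr (psiI psi I *m rho')).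

(** Mutual independence of a finite family of real random variables
    (indexed by the i in I with D i): product rule for all measurable
    sets (choosing B i = setT gives every subfamily). *)
Definition mutual_indep d (T : measurableType d) (P : probability T RR)
  (I : finType) (D : pred I) (X : I -> T -> RR) : Prop :=
  forall B : I -> set RM, (forall i, measurable (B i)) ->
    P (\bigcap_(i in [set i | D i]) (X i @^-1` B i))
    = (\prod_(i | D i) P (X i @^-1` B i))%E.

(* Main.v *)
(** Write [a_I(v)] for [Tr (psi_I rho)] at couplings [v].  Condition on [H'] and on the
    absolute values of the couplings of [H], so that only uniformly random signs remain.

    Comparing the two Gibbs states before and after flipping the sign of [v_I], in their
    two eigenbases, [t (a_I - a_I')] with [t = -2 beta v_I] is a symmetrized relative entropy.
    It is nonnegative and, after bounding the entropy below by geometric means and then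
    [exp] by a tangent line, at least a constant times [t^2], up to an error controlled by
    [a_I^2] and by [\sum_K v_K a_K] over the [K] anticommuting with [I].  Only about
    [1/sigma^2] sets [K] anticommute with a given [I], and [\sum_I a_I^2] is at most
    about [M/n], [M = binom(n,q)], because it splits into families of pairwise
    anticommuting operators.  Let [v'] be [v] with the absolute values exceeding
    [sigma/4] shrunk by [tau = sigma/8], and [W = - \sum_I sgn(v_I) a_I] over the
    corresponding [I].  Then [W(v')] has mean at least [c sigma M].

    Since [log Z] is convex, [beta tau W(v) >= log Z(v) - log Z(v') >= beta tau W(v')].
    The middle term has large mean, and Efron-Stein bounds its variance, so [W(v)] is
    large with high probability.  The same sum for [H'] has second moment at most [M],
    since [H'] does not see the signs.  Hence the differences of correlations sum to at
    least [c' sigma M], and their maximum is at least [c' sigma].  Atypical absolute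
    values of the couplings are discarded by Chebyshev's inequality. *)
Require Import Defs.
From HB Require Import structures.
From mathcomp Require Import all_boot all_order all_algebra.
From mathcomp Require Import all_classical all_reals all_analysis.
From mathcomp Require Import Rstruct Rstruct_topology.
From mathcomp Require Import complex.
From mathcomp Require Import measurable_realfun spectral ring lra zify.

Set Implicit Arguments.
Unset Strict Implicit.
Unset Printing Implicit Defensive.

Import Order.TTheory GRing.Theory Num.Theory.
Import numFieldNormedType.Exports.
Local Open Scope ring_scope.
Local Open Scope complex_scope.
Local Open Scope classical_set_scope.

(** * Functions of Hermitian matrices *)

(** Bounding the fluctuations of [W] directly would require knowing how one sign flip moves all the
    other correlations, a second-derivative estimate. The free energy needs none: its gradient is
    bounded, so a flip of [v_I] moves it by at most [2 beta |v_I|]. Hence the passage through a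
    finite difference of [log Z]. With a step of order [sigma], the mean of this difference and its
    variance are both of order [sigma^2 M], so the failure probability is of order [1/(sigma^2 M)],
    which is [O(1/n)]. Such a step is not infinitesimal, so the mean must be bounded below at the
    shrunk couplings; the estimates for a single flip are therefore stated for arbitrary couplings.
    The lower bound is self-referential: its error for [I] consists of the responses [- v_K a_K] of
    the anticommuting [K]. These are bounded above by a multiple of [v_K^2], through a second use of
    the same relative entropy, but their total is small only after summation over [I]. The tangent
    to [exp] makes the lower bound affine in this error, so that it survives the summation, and the
    free parameter [L] is chosen to cancel the summed error exactly. *)

Notation cRe := (@complex.Re RR).
Notation cIm := (@complex.Im RR).

Lemma cReD (x y : CC) : cRe (x + y) = cRe x + cRe y.
Proof. by case: x; case: y. Qed.
Lemma cImD (x y : CC) : cIm (x + y) = cIm x + cIm y.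
Proof. by case: x; case: y. Qed.
Lemma cReN (x : CC) : cRe (- x) = - cRe x.
Proof. by case: x. Qed.
Lemma cReB (x y : CC) : cRe (x - y) = cRe x - cRe y.
Proof. by rewrite cReD cReN. Qed.
Lemma cRe_sum I (r : seq I) (P : pred I) (F : I -> CC) :
  cRe (\sum_(i <- r | P i) F i) = \sum_(i <- r | P i) cRe (F i).
Proof. exact: (big_morph _ cReD). Qed.
Lemma cIm_sum I (r : seq I) (P : pred I) (F : I -> CC) :
  cIm (\sum_(i <- r | P i) F i) = \sum_(i <- r | P i) cIm (F i).
Proof. exact: (big_morph _ cImD). Qed.
Lemma cReZ (a : RR) (x : CC) : cRe (a%:C * x) = a * cRe x.
Proof. by case: x => b c /=; rewrite mul0r subr0. Qed.
Lemma cImZ (a : RR) (x : CC) : cIm (a%:C * x) = a * cIm x.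
Proof. by case: x => b c /=; rewrite mul0r addr0. Qed.

Lemma conjcD (x y : CC) : (x + y)^* = x^* + y^*.
Proof. exact: (@raddfD _ _ (@conjc RR)). Qed.
Lemma conjcM (x y : CC) : (x * y)^* = x^* * y^*.
Proof. exact: (@rmorphM _ _ (@conjc RR)). Qed.

Lemma conjcB (x y : CC) : (x - y)^* = x^* - y^*.
Proof. exact: (@raddfB _ _ (@conjc RR)). Qed.

Definition nsq (z : CC) : RR := cRe z ^+ 2 + cIm z ^+ 2.

Lemma nsq_ge0 z : 0 <= nsq z.
Proof. by rewrite addr_ge0 ?sqr_ge0. Qed.

Lemma mulcJ z : z * z^* = (nsq z)%:C.
Proof.
by case: z => a b; apply/eqP; rewrite eq_complex /nsq /=; apply/andP; split; apply/eqP; ring.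
Qed.

Lemma nsqZ (a : RR) z : nsq (a%:C * z) = a ^+ 2 * nsq z.
Proof. by rewrite /nsq cReZ cImZ; ring. Qed.

Lemma adjmxE m n (A : 'M[CC]_(m, n)) i j : adjmx A i j = conjc (A j i).
Proof. by rewrite mxE. Qed.

Section Adj.
Variables (m n p : nat).
Implicit Types (A : 'M[CC]_(m, n)) (B : 'M[CC]_(n, p)).

Lemma adjmxM A B : adjmx (A *m B) = adjmx B *m adjmx A.
Proof.
apply/matrixP => i j; rewrite !mxE (big_morph _ conjcD (conjc0 RR)).
by apply: eq_bigr => k _; rewrite !mxE conjcM mulrC.
Qed.
Lemma adjmxK A : adjmx (adjmx A) = A.
Proof. by apply/matrixP => i j; rewrite !mxE conjcK. Qed.
Lemma adjmxD A A' : adjmx (A + A') = adjmx A + adjmx A'.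
Proof. by apply/matrixP => i j; rewrite !mxE conjcD. Qed.
Lemma adjmxZ a A : adjmx (a *: A) = conjc a *: adjmx A.
Proof. by apply/matrixP => i j; rewrite adjmxE [in LHS]mxE [in RHS]mxE adjmxE conjcM. Qed.
Lemma adjmx0 : adjmx (0 : 'M[CC]_(m, n)) = 0.
Proof. by apply/matrixP => i j; rewrite !mxE conjc0. Qed.
End Adj.

Lemma adjmx1 n : adjmx (1%:M : 'M[CC]_n) = 1%:M.
Proof. by apply/matrixP => i j; rewrite !mxE eq_sym; case: eqP; rewrite ?conjc0 ?conjc1. Qed.

Lemma adjmx_sum m n I (r : seq I) (P : pred I) (F : I -> 'M[CC]_(m, n)) :
  adjmx (\sum_(i <- r | P i) F i) = \sum_(i <- r | P i) adjmx (F i).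
Proof. exact: (big_morph _ (@adjmxD m n) (@adjmx0 m n)). Qed.

Section Spectral.
Variable N : nat.
Implicit Types (A B C X Y U V : 'M[CC]_N) (f g l : 'I_N -> RR).

Definition rtr A : RR := cRe (\tr A).

Lemma rtrD A B : rtr (A + B) = rtr A + rtr B.
Proof. by rewrite /rtr raddfD /= cReD. Qed.
Lemma rtrB A B : rtr (A - B) = rtr A - rtr B.
Proof. by rewrite /rtr raddfB /= cReB. Qed.
Lemma rtrZ (a : RR) A : rtr (a%:C *: A) = a * rtr A.
Proof. by rewrite /rtr mxtraceZ cReZ. Qed.
Lemma rtr_sum I (r : seq I) (P : pred I) (F : I -> 'M[CC]_N) :
  rtr (\sum_(i <- r | P i) F i) = \sum_(i <- r | P i) rtr (F i).
Proof. by apply: (big_morph _ rtrD); rewrite /rtr mxtrace0. Qed.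
Lemma rtrC A B : rtr (A *m B) = rtr (B *m A).
Proof. by rewrite /rtr mxtrace_mulC. Qed.

Definition rdiag f : 'M[CC]_N := diag_mx (\row_i (f i)%:C).
(** The argument [f] is indexed by the eigenbasis and not by the eigenvalue, so a Hermitian matrix
    and its exponential are [hfun] of one and the same [U]. *)
Definition hfun U f : 'M[CC]_N := adjmx U *m rdiag f *m U.

Lemma rdiagM f g : rdiag f *m rdiag g = rdiag (fun i => f i * g i).
Proof.
rewrite /rdiag mulmx_diag; congr diag_mx; apply/rowP => i.
by rewrite !mxE -rmorphM.
Qed.

Lemma unitaryC U : U *m adjmx U = 1%:M -> adjmx U *m U = 1%:M.
Proof. exact: mulmx1C. Qed.

Lemma hfun1 U : U *m adjmx U = 1%:M -> hfun U (fun=> 1) = 1%:M.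
Proof.
move=> /unitaryC uU; rewrite /hfun (_ : rdiag _ = 1%:M) ?mulmx1 //.
by apply/matrixP => i j; rewrite !mxE.
Qed.

Lemma hfunM U f g : U *m adjmx U = 1%:M ->
  hfun U f *m hfun U g = hfun U (fun i => f i * g i).
Proof.
move=> uU; rewrite /hfun -!mulmxA (mulmxA U) uU mul1mx.
by rewrite -rdiagM !mulmxA.
Qed.

Lemma adjmx_conjC (X : 'M[CC]_N) : map_mx (@Num.conj CC) (X^T) = adjmx X.
Proof. by apply/matrixP => i j; rewrite adjmxE mxE mxE. Qed.

Lemma hermitian_eig A : adjmx A = A ->
  exists U l, U *m adjmx U = 1%:M /\ A = hfun U l.
Proof.
move=> hA.
have HA : A \is hermsymmx.
  by apply/is_hermitianmxP; rewrite expr0 scale1r adjmx_conjC.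
have [U [d [uU [eA rA]]]] : exists U (d : 'rV[CC]_N), U *m adjmx U = 1%:M /\
    (A = adjmx U *m diag_mx d *m U /\ d \is a realmx).
  exists (spectralmx A), (spectral_diag A).
  have uU := spectral_unitarymx A; rewrite -adjmx_conjC; split; first exact/unitarymxP.
  rewrite -invmx_unitary //; split; last exact: hermitian_spectral_diag_real.
  by apply/orthomx_spectralP; exact: hermitian_normalmx.
exists U, (fun i => cRe (d 0 i)); split => //.
rewrite eA /hfun; congr (_ *m _ *m _).
rewrite /rdiag; congr diag_mx; apply/rowP => i; rewrite !mxE RRe_real //.
exact: (mxOverP rA).
Qed.

Lemma hfun_iter U l j : U *m adjmx U = 1%:M ->
  iter j (mulmx (hfun U l)) 1%:M = hfun U (fun i => l i ^+ j).
Proof.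
move=> uU; elim: j => [|j IHj] /=; first by rewrite -(hfun1 uU).
rewrite IHj hfunM //; congr hfun.
by apply/funext => i; rewrite exprS.
Qed.

Lemma hfun_entry U f a b :
  hfun U f a b = \sum_k (f k)%:C * ((U k a)^* * U k b).
Proof.
rewrite /hfun /rdiag mul_mx_diag mxE; apply: eq_bigr => k _.
by rewrite !mxE; ring.
Qed.

Lemma expm_partial_hfun U l k : U *m adjmx U = 1%:M ->
  expm_partial (hfun U l) k = hfun U (fun i => series (exp_coeff (l i)) k).
Proof.
move=> uU; apply/matrixP => a b; rewrite hfun_entry /expm_partial summxE.
rewrite (eq_bigr (fun j : 'I_k => \sum_i (j`!%:R)^-1 * ((l i ^+ j)%:C * ((U i a)^* * U i b)))); last first.
  by move=> j _; rewrite hfun_iter // mxE hfun_entry mulr_sumr.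
rewrite exchange_big /=; apply: eq_bigr => i _.
rewrite /series /= big_mkord rmorph_sum /= mulr_suml; apply: eq_bigr => j _.
rewrite mulrA; congr (_ * _).
by rewrite /exp_coeff /= rmorphM fmorphV rmorph_nat mulrC.
Qed.

(** The real and imaginary parts of an entry of [expm_partial] are such combinations, with
    coefficients fixed by the eigenbasis. This yields both the value of the limits in [expm] and
    their existence. *)
Lemma cvg_exp_comb l (c : 'I_N -> RR) :
  \sum_i series (exp_coeff (l i)) k * c i @[k --> \oo] --> \sum_i expR (l i) * c i.
Proof.
apply: cvg_big => [|i _]; first exact: add_continuous.
by apply: cvgMl; exact: is_cvg_series_exp_coeff.
Qed.

Lemma expm_hfun U l : U *m adjmx U = 1%:M -> expm (hfun U l) = hfun U (fun i => expR (l i)).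
Proof.
move=> uU; apply/matrixP => a b; rewrite mxE hfun_entry.
have cv (c : 'I_N -> RR) := cvg_lim (@Rhausdorff _) (@cvg_exp_comb l c).
apply/eqP; rewrite eq_complex /= cRe_sum cIm_sum; apply/andP; split; apply/eqP.
- under eq_bigr do rewrite cReZ.
  rewrite -cv; apply: (congr1 (fun u : nat -> RR => limn u)); apply/funext => k.
  by rewrite expm_partial_hfun // hfun_entry cRe_sum; under eq_bigr do rewrite cReZ.
- under eq_bigr do rewrite cImZ.
  rewrite -cv; apply: (congr1 (fun u : nat -> RR => limn u)); apply/funext => k.
  by rewrite expm_partial_hfun // hfun_entry cIm_sum; under eq_bigr do rewrite cImZ.
Qed.

Lemma cvg_expm_partial A (a b : 'I_N) : adjmx A = A ->
  cvgn (fun k => cRe (expm_partial A k a b)) /\ cvgn (fun k => cIm (expm_partial A k a b)).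
Proof.
move=> /hermitian_eig [U [l [uU ->]]].
have cv (c : 'I_N -> RR) := cvgP _ (@cvg_exp_comb l c).
split.
- under eq_fun do (rewrite expm_partial_hfun // hfun_entry cRe_sum; under eq_bigr do rewrite cReZ).
  exact: cv.
- under eq_fun do (rewrite expm_partial_hfun // hfun_entry cIm_sum; under eq_bigr do rewrite cImZ).
  exact: cv.
Qed.

(** Squared matrix elements of [X] between two eigenbases. For [X = 1] they form a doubly stochastic
    matrix, which turns traces of two non-commuting states into classical double sums. *)
Definition ov U V X (k j : 'I_N) : RR := nsq ((U *m X *m adjmx V) k j).

Lemma ov_ge0 U V X k j : 0 <= ov U V X k j.
Proof. exact: nsq_ge0. Qed.

Lemma tr_hfun2 U V X Y f g :
  \tr (hfun U f *m X *m hfun V g *m Y) =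
  \sum_k \sum_l (f k)%:C * (g l)%:C * ((U *m X *m adjmx V) k l * (V *m Y *m adjmx U) l k).
Proof.
rewrite /hfun.
have -> : \tr (adjmx U *m rdiag f *m U *m X *m (adjmx V *m rdiag g *m V) *m Y)
   = \tr ((rdiag f *m (U *m X *m adjmx V)) *m (rdiag g *m (V *m Y *m adjmx U))).
  have -> : adjmx U *m rdiag f *m U *m X *m (adjmx V *m rdiag g *m V) *m Y =
      adjmx U *m (rdiag f *m U *m X *m (adjmx V *m rdiag g *m V) *m Y).
    by rewrite !mulmxA.
  by rewrite mxtrace_mulC !mulmxA.
rewrite /rdiag !mul_diag_mx /mxtrace; apply: eq_bigr => k _.
by rewrite !mxE; apply: eq_bigr => l _; rewrite !mxE; ring.
Qed.

Lemma rtr_ov U V X f g :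
  rtr (hfun U f *m X *m hfun V g *m adjmx X) = \sum_k \sum_l f k * g l * ov U V X k l.
Proof.
rewrite /rtr tr_hfun2 cRe_sum; apply: eq_bigr => k _; rewrite cRe_sum; apply: eq_bigr => l _.
have -> : (V *m adjmx X *m adjmx U) l k = ((U *m X *m adjmx V) k l)^*.
  have -> : V *m adjmx X *m adjmx U = adjmx (U *m X *m adjmx V).
    by rewrite !adjmxM adjmxK mulmxA.
  by rewrite mxE.
by rewrite mulcJ -!rmorphM.
Qed.

End Spectral.

(** * Gibbs states *)

Section Gibbs.
Variable N : nat.
Hypothesis N_gt0 : (0 < N)%N.
Implicit Types (A B C X Y U V psi : 'M[CC]_N) (f g l m : 'I_N -> RR).

Definition rho A : 'M[CC]_N := (\tr (expm A))^-1 *: expm A.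
Definition logZ A : RR := ln (rtr (expm A)).
Definition ev A X : RR := rtr (X *m rho A).

Lemma evD A X Y : ev A (X + Y) = ev A X + ev A Y.
Proof. by rewrite /ev mulmxDl rtrD. Qed.
Lemma evB A X Y : ev A (X - Y) = ev A X - ev A Y.
Proof. by rewrite /ev mulmxBl rtrB. Qed.
Lemma evZ A (a : RR) X : ev A (a%:C *: X) = a * ev A X.
Proof. by rewrite /ev -scalemxAl rtrZ. Qed.
Lemma ev_sum A I (r : seq I) (P : pred I) (F : I -> 'M[CC]_N) :
  ev A (\sum_(i <- r | P i) F i) = \sum_(i <- r | P i) ev A (F i).
Proof. by rewrite /ev mulmx_suml rtr_sum. Qed.

Lemma tr_hfun U f : U *m adjmx U = 1%:M -> \tr (hfun U f) = (\sum_k f k)%:C.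
Proof.
move=> uU; rewrite /hfun mxtrace_mulC mulmxA uU mul1mx /rdiag mxtrace_diag.
by rewrite rmorph_sum; apply: eq_bigr => k _; rewrite mxE.
Qed.

Lemma scale_hfun U f (a : RR) : a%:C *: hfun U f = hfun U (fun k => a * f k).
Proof.
apply/matrixP => i j; rewrite mxE !hfun_entry mulr_sumr; apply: eq_bigr => k _.
by rewrite rmorphM mulrA.
Qed.

(** Shifting the spectrum by [logZ A] makes [l] the logarithm of a probability vector, the spectrum
    of the Gibbs state. *)
Lemma gibbs_eig A : adjmx A = A -> exists U l, [/\ U *m adjmx U = 1%:M,
  A = hfun U (fun k => l k + logZ A), rho A = hfun U (fun k => expR (l k))
  & \sum_k expR (l k) = 1].
Proof.
move=> /hermitian_eig [U [l [uU eA]]].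
have trE : \tr (expm A) = (\sum_k expR (l k))%:C by rewrite eA expm_hfun // tr_hfun.
have Zgt0 : 0 < \sum_k expR (l k).
  rewrite (bigD1 (Ordinal N_gt0)) //= ltr_pwDl ?expR_gt0 //.
  by apply: sumr_ge0 => i _; exact: expR_ge0.
have lZ : logZ A = ln (\sum_k expR (l k)) by rewrite /logZ /rtr trE.
have pE k : expR (l k - logZ A) = (\sum_k expR (l k))^-1 * expR (l k).
  by rewrite expRB lZ lnK ?posrE // mulrC.
exists U, (fun k => l k - logZ A); split => //.
- by rewrite {1}eA; congr hfun; apply/funext => k; rewrite subrK.
- rewrite /rho trE {1}eA expm_hfun // -fmorphV scale_hfun.
  by congr hfun; apply/funext => k; rewrite pE.
- by under eq_bigr do rewrite pE; rewrite -mulr_sumr mulVf // gt_eqF.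
Qed.

Lemma ov_row U V X k (a : RR) : V *m adjmx V = 1%:M -> U *m adjmx U = 1%:M ->
  X *m adjmx X = (a%:C)%:M -> \sum_j ov U V X k j = a.
Proof.
move=> /unitaryC uV uU XX; rewrite /ov.
set W := U *m X *m adjmx V.
have WW : W *m adjmx W = (a%:C)%:M.
  rewrite /W !adjmxM adjmxK.
  rewrite -mulmxA (mulmxA (adjmx V)) uV mul1mx -!mulmxA (mulmxA X) XX.
  by rewrite mul_scalar_mx -scalemxAr uU scalemx1.
clearbody W; apply: (@complexI RR); rewrite rmorph_sum /=.
have /(congr1 (fun M : 'M[CC]_N => M k k)) := WW; rewrite !mxE eqxx mulr1n => <-.
apply: eq_bigr => j _; by rewrite mxE mulcJ.
Qed.

Lemma ov_adj U V X k j : ov U V X k j = ov V U (adjmx X) j k.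
Proof.
rewrite /ov; have -> : V *m adjmx X *m adjmx U = adjmx (U *m X *m adjmx V).
  by rewrite !adjmxM adjmxK mulmxA.
by rewrite [adjmx _ _ _]mxE /nsq; case: (_ k j) => x y /=; rewrite sqrrN.
Qed.

Lemma ov_col U V X j (a : RR) : V *m adjmx V = 1%:M -> U *m adjmx U = 1%:M ->
  adjmx X *m X = (a%:C)%:M -> \sum_k ov U V X k j = a.
Proof.
move=> uV uU XX; under eq_bigr do rewrite ov_adj.
by apply: ov_row => //; rewrite adjmxK.
Qed.

Lemma ov_suml U V X f (a : RR) : V *m adjmx V = 1%:M -> U *m adjmx U = 1%:M ->
  X *m adjmx X = (a%:C)%:M -> \sum_k \sum_j f k * ov U V X k j = a * \sum_k f k.
Proof.
move=> uV uU XX; rewrite mulr_sumr; apply: eq_bigr => k _.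
by rewrite -mulr_sumr (ov_row _ uV uU XX) mulrC.
Qed.

Lemma ov_sumr U V X f (a : RR) : V *m adjmx V = 1%:M -> U *m adjmx U = 1%:M ->
  adjmx X *m X = (a%:C)%:M -> \sum_k \sum_j f j * ov U V X k j = a * \sum_k f k.
Proof.
move=> uV uU XX; rewrite exchange_big mulr_sumr; apply: eq_bigr => j _ /=.
by rewrite -mulr_sumr (ov_col _ uV uU XX) mulrC.
Qed.

Lemma ev_sqr_ge0 A X : adjmx A = A -> 0 <= ev A (X *m adjmx X).
Proof.
move=> /gibbs_eig [U [l [uU _ rA _]]].
have -> : ev A (X *m adjmx X) = rtr (hfun U (fun k => expR (l k)) *m X *m hfun U (fun=> 1) *m adjmx X).
  by rewrite /ev rtrC rA hfun1 // mulmx1 mulmxA.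
rewrite rtr_ov; apply: sumr_ge0 => k _; apply: sumr_ge0 => j _.
by rewrite mulr1 mulr_ge0 ?expR_ge0 ?ov_ge0.
Qed.

Lemma ev_scalar A (a : RR) : adjmx A = A -> ev A (a%:C)%:M = a.
Proof.
move=> /gibbs_eig [U [l [uU _ rA s1]]].
by rewrite /ev rA mul_scalar_mx rtrZ /rtr tr_hfun //= s1 mulr1.
Qed.

(** The variance of [B] in the state is the expectation of the square of [B - ev A B], hence
    nonnegative. *)
Lemma ev_le_sqr A B : adjmx A = A -> adjmx B = B -> ev A B ^+ 2 <= ev A (B *m B).
Proof.
move=> hA hB; set b := ev A B.
have := ev_sqr_ge0 (B - (b%:C)%:M) hA.
have -> : adjmx (B - (b%:C)%:M) = B - (b%:C)%:M.
  apply/matrixP => i j; rewrite -{2}hB !mxE /= conjcB; congr (_ - _).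
  by rewrite eq_sym; case: eqP => _; rewrite ?mulr1n ?mulr0n; exact: conjc_real.
rewrite mulmxBl !mulmxBr mul_mx_scalar mul_scalar_mx -scalar_mxM -rmorphM.
rewrite !evB !evZ ev_scalar // -/b; nra.
Qed.

Lemma ev_bound A psi (a : RR) : adjmx A = A -> adjmx psi = psi -> psi *m psi = (a%:C)%:M ->
  ev A psi ^+ 2 <= a.
Proof. by move=> hA hp pp; rewrite -(ev_scalar a hA) -pp ev_le_sqr. Qed.

(** Test the state on [B = \sum_i ev A (psi i) psi i]. Its expectation is the sum [s] to be bounded,
    and anticommutation makes [B^2] the scalar [a s], so [s^2 <= a s]. *)
Lemma ev_anticomm A (I : finType) (P : pred I) (psi : I -> 'M[CC]_N) (a : RR) :
  adjmx A = A -> 0 <= a -> (forall i, P i -> adjmx (psi i) = psi i) ->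
  (forall i j, P i -> P j -> psi i *m psi j + psi j *m psi i =
      ((if i == j then a *+ 2 else 0)%:C)%:M) ->
  \sum_(i | P i) ev A (psi i) ^+ 2 <= a.
Proof.
move=> hA a0 hp anti; set s := \sum_(i | P i) _.
pose B := \sum_(i | P i) (ev A (psi i))%:C *: psi i.
have hB : adjmx B = B.
  rewrite /B adjmx_sum; apply: eq_bigr => i Pi.
  by rewrite adjmxZ conjc_real hp.
have evBs : ev A B = s.
  by rewrite /B ev_sum; apply: eq_bigr => i _; rewrite evZ expr2.
(* Doubling pairs the term [(i, j)] with [(j, i)], so that the anticommutator appears and only the
   diagonal survives. *)
have BB : B *m B + B *m B = ((a * s *+ 2)%:C)%:M.
  have BBE : B *m B = \sum_(i | P i) \sum_(j | P j)
      ((ev A (psi i) * ev A (psi j))%:C *: (psi i *m psi j)).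
    rewrite /B mulmx_suml; apply: eq_bigr => i _; rewrite mulmx_sumr.
    by apply: eq_bigr => j _; rewrite -scalemxAl -scalemxAr scalerA rmorphM.
  rewrite {2}BBE exchange_big BBE -big_split /=.
  have -> : ((a * s *+ 2)%:C)%:M = \sum_(i | P i) ((((ev A (psi i)) ^+ 2 * (a *+ 2))%:C)%:M : 'M[CC]_N).
    by rewrite -!raddf_sum /= -mulr_suml -/s; congr (_ _)%:M; ring.
  apply: eq_bigr => i Pi; rewrite -big_split /=.
  rewrite (eq_bigr (fun j => (ev A (psi i) * ev A (psi j))%:C *:
      ((if i == j then a *+ 2 else 0)%:C)%:M)); last first.
    by move=> j Pj; rewrite [ev A (psi j) * _]mulrC -scalerDr anti.
  rewrite (bigD1 i) //= [X in _ + X]big1 ?addr0; last first.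
    by move=> j /andP[_ ji]; rewrite eq_sym (negPf ji) scale_scalar_mx mulr0 raddf0.
  by rewrite eqxx scale_scalar_mx -rmorphM expr2.
have := ev_le_sqr hA hB; rewrite evBs.
have : ev A (B *m B) *+ 2 = a * s *+ 2 by rewrite mulr2n -evD BB ev_scalar.
have s0 : 0 <= s by apply: sumr_ge0 => i _; exact: sqr_ge0.
nra.
Qed.

End Gibbs.

(** * Two Gibbs states related by a sign flip *)

Section Scalar.
Implicit Types x y r L t d : RR.

Lemma expR_mul_subr_le x y : expR x * (y - x) <= expR y - expR x.
Proof.
have -> : expR y = expR x * expR (y - x) by rewrite expRB mulrCA divff ?mulr1 // gt_eqF ?expR_gt0.
by have := expR_ge1Dx (y - x); have := expR_gt0 x; nra.
Qed.

Lemma expR_sub_mul_ge0 x y : 0 <= (expR x - expR y) * (x - y).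
Proof.
have := expR_mul_subr_le x y; have := expR_mul_subr_le y x.
have := expR_gt0 x; have := expR_gt0 y => y0 x0 h1 h2.
case: (leP x y) => xy.
  have : expR x <= expR y by rewrite ler_expR.
  by move=> ?; nra.
have : expR y <= expR x by rewrite ler_expR ltW.
by move=> ?; nra.
Qed.

Lemma expR_geomean x y : expR ((x + y) / 2) ^+ 2 = expR x * expR y.
Proof. by rewrite -expRM_natr -exp.expRD; congr expR; field. Qed.

Lemma expR_geomean_le x y : expR ((x + y) / 2) <= (expR x + expR y) / 2.
Proof.
have := expR_geomean x y; have p0 := expR_gt0 x; have q0 := expR_gt0 y.
set p := expR x in p0 *; set q := expR y in q0 *; set g := expR _ => gpq.
rewrite -(@ler_pXn2r _ 2) ?nnegrE ?expR_ge0 //; last by lra.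
by rewrite gpq; have := sqr_ge0 (p - q); lra.
Qed.

(* From [e^t >= 1 + t] and [e^-t <= 1 / (1 + t)]; the sharp constant is [1]. *)
Lemma expR_sub_mul_ge_geomean x y :
  expR ((x + y) / 2) * (x - y) ^+ 2 / 2 <= (expR x - expR y) * (x - y).
Proof.
wlog xy : x y / y <= x.
  move=> H; case: (leP y x) => [/H //|/ltW /H].
  by rewrite (addrC y) -[x - y]opprB -[expR x - _]opprB sqrrN mulrNN.
set t := (x - y) / 2; have t0 : 0 <= t by rewrite /t; lra.
have -> : expR x = expR ((x + y) / 2) * expR t.
  by rewrite -exp.expRD; congr expR; rewrite /t; field.
have -> : expR y = expR ((x + y) / 2) * (expR t)^-1.
  by rewrite -expRB; congr expR; rewrite /t; field.
have -> : x - y = 2 * t by rewrite /t; field.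
set g := expR _; have g0 : 0 < g by exact: expR_gt0.
have E1 : 1 + t <= expR t by exact: expR_ge1Dx.
have Ei : (expR t)^-1 <= 1 by rewrite invf_le1 ?expR_gt0 //; lra.
have ti : t <= expR t - (expR t)^-1 by lra.
rewrite (_ : (g * expR t - g / expR t) * (2 * t) = g * (2 * t) * (expR t - (expR t)^-1)); last by ring.
rewrite (_ : g * (2 * t) ^+ 2 / 2 = g * (2 * t) * t); last by field.
by apply: ler_wpM2l => //; apply: mulr_ge0; lra.
Qed.

Lemma expR_tangent L x : expR (- L) * (1 + x + L) <= expR x.
Proof.
have -> : expR x = expR (- L) * expR (x + L) by rewrite -exp.expRD; congr expR; ring.
by rewrite ler_pM2l ?expR_gt0 // -addrA; exact: expR_ge1Dx.
Qed.

(* [(p - q)^2 <= (p + q) (p - q) (log p - log q)] for [p = e^x], [q = e^y]. *)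
Lemma expR_sub_sqr_le x y :
  (expR x - expR y) ^+ 2 <= (expR x + expR y) * ((expR x - expR y) * (x - y)).
Proof.
have := expR_mul_subr_le x y; have := expR_mul_subr_le y x.
have x0 := expR_gt0 x; have y0 := expR_gt0 y => h1 h2.
set p := expR x in h1 h2 x0 *; set q := expR y in h1 h2 y0 *.
case: (leP x y) => xy.
  have : p <= q by rewrite ler_expR.
  move=> pq; have : (q - p) <= q * (y - x) by lra.
  by move=> ?; nra.
have : q <= p by rewrite ler_expR ltW.
move=> pq; have : (p - q) <= p * (x - y) by lra.
by move=> ?; nra.
Qed.

(** Cauchy-Schwarz in Young form with a free weight [r]. In its application [p] is [p_k + q_j] and
    [s] is the density [(p_k - q_j) (log p_k - log q_j)]. *)
Lemma reJ_le (z w : CC) (p q r s : RR) : 0 < r -> 0 < p -> (q ^+ 2 <= p * s) ->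
  2 * (q * cRe (z * conjc w)) <= r * (s * nsq w) + p * nsq z / r.
Proof.
case: z => a b; case: w => c d /= r0 p0 qps; rewrite /nsq /= mulrN opprK.
have -> : 2 * (q * (a * c + b * d)) = 2 * (q * c * a) + 2 * (q * d * b) by ring.
have key u v : 2 * (q * u * v) <= r * (s * u ^+ 2) + p * v ^+ 2 / r.
  have -> : r * (s * u ^+ 2) + p * v ^+ 2 / r =
     2 * (q * u * v) + (p * v - r * q * u) ^+ 2 / (p * r) + (r * u ^+ 2 / p) * (p * s - q ^+ 2).
    by field; rewrite !gt_eqF.
  rewrite -addrA lerDl; apply: addr_ge0.
    by apply: divr_ge0; [exact: sqr_ge0 | rewrite mulr_ge0 ?ltW].
  apply: mulr_ge0; last by rewrite subr_ge0.
  by apply: divr_ge0; [apply: mulr_ge0; [exact: ltW | exact: sqr_ge0] | exact: ltW].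
have := key c a; have := key d b; lra.
Qed.

Lemma ler_half_young x y r : 2 * x <= x + 2 * y * r -> x <= 2 * y * r.
Proof. by lra. Qed.

Lemma sqr_le_of_between d t x y : d <= t * x -> t * y <= d ->
  d ^+ 2 <= t ^+ 2 * (x ^+ 2 + y ^+ 2).
Proof.
move=> H1 H2; have := sqr_ge0 (t * x); have := sqr_ge0 (t * y).
by case: (leP 0 d) => d0; nra.
Qed.

(** By [(x + d)^2 <= 2 x^2 + 2 d^2]; this separates the gap of log-probabilities [x] from the
    difference [d] of log partition functions. *)
Lemma half_sqr_le t d x y u v : t ^+ 2 * v = (x + d) ^+ 2 * u -> 0 <= u ->
  t ^+ 2 / 2 * v - d ^+ 2 * u <= x ^+ 2 * u.
Proof.
move=> E u0; have := mulr_ge0 (sqr_ge0 (x - d)) u0.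
rewrite (_ : t ^+ 2 / 2 * v = (t ^+ 2 * v) / 2); last by field.
by rewrite E; lra.
Qed.

Lemma geomean_combine t d x g u v : t ^+ 2 / 2 * v - d ^+ 2 * u <= x ^+ 2 * u -> 0 <= g ->
  t ^+ 2 / 4 * (g * v) - d ^+ 2 / 2 * (g * u) <= g * x ^+ 2 / 2 * u.
Proof. by move=> H g0; have := ler_wpM2l g0 H; lra. Qed.

Lemma half_shift x y : (x + y) / 2 = x + (y - x) / 2.
Proof. by field. Qed.

Lemma tangent_rearrange e p L x y a c v :
  e * ((1 + L) * (p * v) + 2^-1 * (p * (y + c) * v - (x + a) * p * v + (a - c) * (p * v))) =
  p * (e * (1 + (y - x) / 2 + L)) * v.
Proof. by field. Qed.

Lemma flip_combine t d T S E x y : t ^+ 2 / 4 * T - d ^+ 2 / 2 <= S -> E <= T ->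
  d ^+ 2 <= t ^+ 2 * (x ^+ 2 + y ^+ 2) ->
  t ^+ 2 / 4 * (E - 2 * (x ^+ 2 + y ^+ 2)) <= S.
Proof.
move=> H1 H2 H3; have := ler_wpM2l (sqr_ge0 t) H2; lra.
Qed.
End Scalar.

Section TwoStates.
Variable N : nat.
Hypothesis N_gt0 : (0 < N)%N.
Implicit Types (A B C X Y U V psi : 'M[CC]_N) (f g l m : 'I_N -> RR).
Implicit Types (h : 'I_N -> 'I_N -> RR).

Definition dsum h : RR := \sum_k \sum_j h k j.

Lemma dsumD h h' : dsum (fun k j => h k j + h' k j) = dsum h + dsum h'.
Proof. by rewrite /dsum -big_split; apply: eq_bigr => k _; rewrite -big_split. Qed.
Lemma dsumB h h' : dsum (fun k j => h k j - h' k j) = dsum h - dsum h'.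
Proof. by rewrite /dsum -sumrB; apply: eq_bigr => k _; rewrite -sumrB. Qed.
Lemma dsumZ (a : RR) h : dsum (fun k j => a * h k j) = a * dsum h.
Proof. by rewrite /dsum mulr_sumr; apply: eq_bigr => k _; rewrite mulr_sumr. Qed.
Lemma ler_dsum h h' : (forall k j, h k j <= h' k j) -> dsum h <= dsum h'.
Proof. by move=> H; apply: ler_sum => k _; apply: ler_sum => j _. Qed.
Lemma eq_dsum h h' : (forall k j, h k j = h' k j) -> dsum h = dsum h'.
Proof. by move=> H; apply: eq_bigr => k _; apply: eq_bigr => j _. Qed.

Lemma gibbs_eig2 A C : adjmx A = A -> adjmx C = C ->
  exists U V l m a c, [/\ U *m adjmx U = 1%:M /\ V *m adjmx V = 1%:M,
    A = hfun U (fun k => l k + a) /\ C = hfun V (fun k => m k + c),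
    rho A = hfun U (fun k => expR (l k)) /\ rho C = hfun V (fun k => expR (m k)),
    \sum_k expR (l k) = 1 /\ \sum_k expR (m k) = 1
    & logZ A = a /\ logZ C = c].
Proof.
move=> /(gibbs_eig N_gt0) [U [l [uU eA rA sA]]] /(gibbs_eig N_gt0) [V [m [uV eC rC sC]]].
by exists U, V, l, m, (logZ A), (logZ C).
Qed.

Lemma rdiag_mulE f (W : 'M[CC]_N) k j : (rdiag f *m W) k j = (f k)%:C * W k j.
Proof. by rewrite /rdiag mul_diag_mx !mxE. Qed.

Lemma mul_rdiagE f (W : 'M[CC]_N) k j : (W *m rdiag f) k j = W k j * (f j)%:C.
Proof. by rewrite /rdiag mul_mx_diag !mxE. Qed.

Lemma rtr_dsum U V X f g :
  rtr (hfun U f *m X *m hfun V g *m adjmx X) = dsum (fun k j => f k * g j * ov U V X k j).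
Proof. exact: rtr_ov. Qed.

Lemma rtr_dsum1 U V f g :
  rtr (hfun U f *m hfun V g) = dsum (fun k j => f k * g j * ov U V 1%:M k j).
Proof. by rewrite -rtr_dsum adjmx1 !mulmx1. Qed.

Section Bases.
Variables (U V : 'M[CC]_N) (l m : 'I_N -> RR).
Hypotheses (uU : U *m adjmx U = 1%:M) (uV : V *m adjmx V = 1%:M).
Hypotheses (sl : \sum_k expR (l k) = 1) (sm : \sum_k expR (m k) = 1).
Local Notation p k := (expR (l k)).
Local Notation q k := (expR (m k)).
Local Notation u k j := (ov U V 1%:M k j).

Let un : (1%:M : 'M[CC]_N) *m adjmx 1%:M = (1%:C)%:M.
Proof. by rewrite adjmx1 mulmx1. Qed.
Let un' : adjmx (1%:M : 'M[CC]_N) *m 1%:M = (1%:C)%:M.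
Proof. by rewrite adjmx1 mulmx1. Qed.

Lemma dsum_ovl f : dsum (fun k j => f k * u k j) = \sum_k f k.
Proof. by rewrite /dsum (ov_suml _ uV uU un) mul1r. Qed.
Lemma dsum_ovr f : dsum (fun k j => f j * u k j) = \sum_k f k.
Proof. by rewrite /dsum (ov_sumr _ uV uU un') mul1r. Qed.

(** Both [p k * u k j] and [q j * u k j] are probability weights on pairs, and the sum is minus
    their relative entropy. *)
Lemma dsum_relent_le0 : dsum (fun k j => p k * (m j - l k) * u k j) <= 0.
Proof.
apply: (@le_trans _ _ (dsum (fun k j => q j * u k j - p k * u k j))).
  apply: ler_dsum => k j; rewrite -mulrBl; apply: (ler_wpM2r (ov_ge0 U V 1%:M k j)).
  exact: expR_mul_subr_le.
by rewrite dsumB dsum_ovl dsum_ovr sl sm subrr.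
Qed.

Lemma rtr_left f : rtr (hfun U f) = dsum (fun k j => f k * u k j).
Proof. by rewrite dsum_ovl /rtr tr_hfun. Qed.
Lemma rtr_right f : rtr (hfun V f) = dsum (fun k j => f j * u k j).
Proof. by rewrite dsum_ovr /rtr tr_hfun. Qed.

Lemma dsum_geomean_le1 : dsum (fun k j => expR ((l k + m j) / 2) * u k j) <= 1.
Proof.
apply: (@le_trans _ _ (dsum (fun k j => 2^-1 * (p k * u k j + q j * u k j)))).
  apply: ler_dsum => k j; rewrite -mulrDl mulrA; apply: (ler_wpM2r (ov_ge0 U V 1%:M k j)).
  by rewrite [_^-1 * _]mulrC; exact: expR_geomean_le.
by rewrite dsumZ dsumD dsum_ovl dsum_ovr sl sm; lra.
Qed.

End Bases.

(** The gap between the two sides is the relative entropy of [rho A] with respect to [rho C]. This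
    is the tangent-plane form of the convexity of [logZ]. *)
Lemma peierls_bogoliubov A C : adjmx A = A -> adjmx C = C ->
  ev A (C - A) <= logZ C - logZ A.
Proof.
move=> hA hC; have [U [V [l [m [a [c [[uU uV] [eA eC] [rA _] [sA sC] [zA zC]]]]]]]] := gibbs_eig2 hA hC.
have H := dsum_relent_le0 uU uV sA sC.
rewrite evB zA zC /ev rA.
have -> : rtr (A *m hfun U (fun k => expR (l k))) =
    dsum (fun k j => (l k + a) * expR (l k) * ov U V 1%:M k j).
  by rewrite {1}eA hfunM // (rtr_left uU uV).
have -> : rtr (C *m hfun U (fun k => expR (l k))) =
    dsum (fun k j => expR (l k) * (m j + c) * ov U V 1%:M k j).
  by rewrite rtrC {1}eC rtr_dsum1.
rewrite -dsumB.
rewrite (@eq_dsum _ (fun k j => expR (l k) * (m j - l k) * ov U V 1%:M k j +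
   (c - a) * (expR (l k) * ov U V 1%:M k j))); last first.
  by move=> k j; move: (expR _) (ov _ _ _ _ _) => x y; ring.
by rewrite dsumD (dsumZ (c - a)) (dsum_ovl uU uV) sA mulr1 gerDr.
Qed.

(** The sum of the two relative entropies, in which the log partition functions cancel. The
    eigendata are arguments because later bounds must be expanded in the same two bases. *)
Lemma sym_relent A C : adjmx A = A -> adjmx C = C -> forall U V l m a c,
  U *m adjmx U = 1%:M -> V *m adjmx V = 1%:M ->
  A = hfun U (fun k => l k + a) -> C = hfun V (fun k => m k + c) ->
  rho A = hfun U (fun k => expR (l k)) -> rho C = hfun V (fun k => expR (m k)) ->
  \sum_k expR (l k) = 1 -> \sum_k expR (m k) = 1 ->
  ev A (A - C) - ev C (A - C) =
  dsum (fun k j => (expR (l k) - expR (m j)) * (l k - m j) * ov U V 1%:M k j).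
Proof.
move=> hA hC U V l m a c uU uV eA eC rA rC sA sC.
rewrite !evB /ev rA rC.
have -> : rtr (A *m hfun U (fun k => expR (l k))) =
    dsum (fun k j => (l k + a) * expR (l k) * ov U V 1%:M k j).
  by rewrite {1}eA hfunM // (rtr_left uU uV).
have -> : rtr (C *m hfun V (fun k => expR (m k))) =
    dsum (fun k j => (m j + c) * expR (m j) * ov U V 1%:M k j).
  by rewrite {1}eC hfunM // (rtr_right uU uV).
have -> : rtr (C *m hfun U (fun k => expR (l k))) =
    dsum (fun k j => expR (l k) * (m j + c) * ov U V 1%:M k j).
  by rewrite rtrC {1}eC rtr_dsum1.
have -> : rtr (A *m hfun V (fun k => expR (m k))) =
    dsum (fun k j => (l k + a) * expR (m j) * ov U V 1%:M k j).
  by rewrite {1}eA rtr_dsum1.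
rewrite -!dsumB.
rewrite (@eq_dsum _ (fun k j => (expR (l k) - expR (m j)) * (l k - m j) * ov U V 1%:M k j +
   (a - c) * (expR (l k) * ov U V 1%:M k j - expR (m j) * ov U V 1%:M k j))); last first.
  by move=> k j; move: (expR (l k)) (expR (m j)) (ov _ _ _ _ _) => x y z; ring.
by rewrite dsumD (dsumZ (a - c)) dsumB (dsum_ovl uU uV) (dsum_ovr uU uV) sA sC subrr mulr0 addr0.
Qed.

Section Observable.
Variables (A C psi : 'M[CC]_N) (t k2 : RR).
Hypotheses (hA : adjmx A = A) (hC : adjmx C = C) (hpsi : adjmx psi = psi).
Hypotheses (psi2 : psi *m psi = (k2%:C)%:M) (AC : A - C = t%:C *: psi).

Lemma rtr_left_obs U V f : U *m adjmx U = 1%:M -> V *m adjmx V = 1%:M ->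
  rtr (psi *m hfun U f) =
  dsum (fun k j => f k * cRe ((U *m psi *m adjmx V) k j * conjc ((U *m 1%:M *m adjmx V) k j))).
Proof.
move=> uU uV.
have -> : rtr (psi *m hfun U f) = rtr (hfun U f *m psi *m hfun V (fun=> 1) *m 1%:M).
  by rewrite hfun1 // !mulmx1 rtrC.
rewrite /rtr tr_hfun2 cRe_sum; apply: eq_bigr => k _; rewrite cRe_sum; apply: eq_bigr => j _.
have -> : V *m 1%:M *m adjmx U = adjmx (U *m 1%:M *m adjmx V).
  by rewrite !adjmxM adjmxK adjmx1 mulmxA.
by rewrite adjmxE -rmorphM mulr1 cReZ.
Qed.

Lemma rtr_right_obs U V f : U *m adjmx U = 1%:M -> V *m adjmx V = 1%:M ->
  rtr (psi *m hfun V f) =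
  dsum (fun k j => f j * cRe ((U *m psi *m adjmx V) k j * conjc ((U *m 1%:M *m adjmx V) k j))).
Proof.
move=> uU uV.
have -> : rtr (psi *m hfun V f) = rtr (hfun U (fun=> 1) *m psi *m hfun V f *m 1%:M).
  by rewrite hfun1 // mulmx1 mul1mx.
rewrite /rtr tr_hfun2 cRe_sum; apply: eq_bigr => k _; rewrite cRe_sum; apply: eq_bigr => j _.
have -> : V *m 1%:M *m adjmx U = adjmx (U *m 1%:M *m adjmx V).
  by rewrite !adjmxM adjmxK adjmx1 mulmxA.
by rewrite adjmxE -rmorphM mul1r cReZ.
Qed.

Let psiJ : psi *m adjmx psi = (k2%:C)%:M. Proof. by rewrite hpsi. Qed.
Let Jpsi : adjmx psi *m psi = (k2%:C)%:M. Proof. by rewrite hpsi. Qed.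

Lemma ev_flip_relent : ev A (A - C) - ev C (A - C) = t * (ev A psi - ev C psi).
Proof. by rewrite AC !evZ mulrBr. Qed.

Lemma ev_flip_mono : 0 <= t * (ev A psi - ev C psi).
Proof.
have [U [V [l [m [a [c [[uU uV] [eA eC] [rA rC] [sA sC] _]]]]]]] := gibbs_eig2 hA hC.
rewrite -ev_flip_relent (sym_relent hA hC uU uV eA eC rA rC sA sC).
apply: sumr_ge0 => k _; apply: sumr_ge0 => j _.
by apply: mulr_ge0; [exact: expR_sub_mul_ge0 | exact: ov_ge0].
Qed.

(** In the two eigenbases, the difference of expectations is the sum of [p_k - q_j] times the real
    part of a product of matrix elements of [psi] and of [1]. Young's inequality on each term leaves
    the symmetrized entropy and the total mass [2 * k2] of the [psi] overlaps. *)
Lemma ev_flip_young (r : RR) : 0 < r ->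
  2 * `|ev A psi - ev C psi| <= r * (t * (ev A psi - ev C psi)) + 2 * k2 / r.
Proof.
have [U [V [l [m [a [c [[uU uV] [eA eC] [rA rC] [sA sC] _]]]]]]] := gibbs_eig2 hA hC.
move=> r0; rewrite -ev_flip_relent (sym_relent hA hC uU uV eA eC rA rC sA sC).
rewrite /ev rA rC (rtr_left_obs _ uU uV) (rtr_right_obs _ uU uV) -dsumB.
have ineq (h : 'I_N -> 'I_N -> RR) :
    (forall k j, h k j ^+ 2 <= (expR (l k) + expR (m j)) * ((expR (l k) - expR (m j)) * (l k - m j))) ->
    2 * dsum (fun k j => h k j * cRe ((U *m psi *m adjmx V) k j * conjc ((U *m 1%:M *m adjmx V) k j)))
    <= r * dsum (fun k j => (expR (l k) - expR (m j)) * (l k - m j) * ov U V 1%:M k j) + 2 * k2 / r.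
  move=> hh.
  have -> : 2 * k2 / r = dsum (fun k j => r^-1 * (expR (l k) * ov U V psi k j + expR (m j) * ov U V psi k j)).
    rewrite (dsumZ r^-1) dsumD /dsum (ov_suml _ uV uU psiJ) (ov_sumr _ uV uU Jpsi) sA sC.
    by rewrite mulr1 -mulr2n mulr_natl mulrC.
  rewrite -!dsumZ -dsumD; apply: ler_dsum => k j.
  have := reJ_le ((U *m psi *m adjmx V) k j) ((U *m 1%:M *m adjmx V) k j) r0
     (addr_gt0 (expR_gt0 (l k)) (expR_gt0 (m j))) (hh k j).
  by rewrite -mulrDl [r^-1 * _]mulrC.
have -> (x : RR) : `|x| = Num.max x (- x).
  by case: (leP 0 x) => x0; [rewrite ger0_norm // max_l | rewrite ltr0_norm // max_r]; lra.
rewrite maxr_pMr // ge_max; apply/andP; split.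
  rewrite (@eq_dsum _ (fun k j => (expR (l k) - expR (m j)) *
     cRe ((U *m psi *m adjmx V) k j * conjc ((U *m 1%:M *m adjmx V) k j)))); last first.
    by move=> k j; rewrite mulrBl.
  by apply: ineq => k j; exact: expR_sub_sqr_le.
rewrite -[- dsum _]mulN1r -(dsumZ (-1)).
rewrite (@eq_dsum _ (fun k j => (expR (m j) - expR (l k)) *
     cRe ((U *m psi *m adjmx V) k j * conjc ((U *m 1%:M *m adjmx V) k j)))); last first.
  by move=> k j; rewrite mulN1r mulrBl opprB.
by apply: ineq => k j; rewrite -sqrrN opprB; exact: expR_sub_sqr_le.
Qed.

Lemma ev_flip_le : `|ev A psi - ev C psi| <= 2 * k2 * `|t|.
Proof.
have [t0|t0] := eqVneq t 0.
  have -> : A = C by apply/eqP; rewrite -subr_eq0 AC t0 scale0r.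
  by rewrite subrr normr0 t0 normr0 mulr0.
have t1 : 0 < `|t| by rewrite normr_gt0.
(* With [r = 1 / |t|] the entropy term becomes the absolute difference itself, and half of the left
   side absorbs it. *)
have := ev_flip_young (r := `|t|^-1); rewrite invr_gt0 => /(_ t1).
have := ev_flip_mono; move: (ev A psi - ev C psi) => d td.
rewrite -(ger0_norm td) normrM mulrA mulVf ?gt_eqF // mul1r invrK.
exact: ler_half_young.
Qed.

(** [peierls_bogoliubov] in both directions puts the difference between [t * ev C psi] and
    [t * ev A psi]. *)
Lemma logZ_flip_sqr_le : (logZ A - logZ C) ^+ 2 <= t ^+ 2 * (ev A psi ^+ 2 + ev C psi ^+ 2).
Proof.
have H1 : logZ A - logZ C <= t * ev A psi.
  have := peierls_bogoliubov hA hC; rewrite -opprB AC -scaleN1r scalerA.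
  have -> : (-1 : CC) * t%:C = (- t)%:C by rewrite rmorphN mulN1r.
  by rewrite evZ mulNr lerNl opprB.
have H2 : t * ev C psi <= logZ A - logZ C.
  by have := peierls_bogoliubov hC hA; rewrite AC evZ.
exact: sqr_le_of_between.
Qed.

(* The off-diagonal matrix elements of [A - C - d], [d = logZ A - logZ C],
   between the two eigenbases carry the factor [log p_k - log q_j]. *)
Lemma ov_flip_ge U V l m a c k j : U *m adjmx U = 1%:M -> V *m adjmx V = 1%:M ->
  A = hfun U (fun k => l k + a) -> C = hfun V (fun k => m k + c) ->
  t ^+ 2 / 2 * ov U V psi k j - (a - c) ^+ 2 * ov U V 1%:M k j
    <= (l k - m j) ^+ 2 * ov U V 1%:M k j.
Proof.
move=> uU uV eA eC.
have E : t%:C * (U *m psi *m adjmx V) k j =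
    (l k - m j + (a - c))%:C * (U *m 1%:M *m adjmx V) k j.
  have -> : t%:C * (U *m psi *m adjmx V) k j = (U *m (A - C) *m adjmx V) k j.
    by rewrite AC -scalemxAr -scalemxAl [RHS]mxE.
  have -> : U *m (A - C) *m adjmx V = rdiag (fun k => l k + a) *m (U *m 1%:M *m adjmx V)
      - (U *m 1%:M *m adjmx V) *m rdiag (fun k => m k + c).
    rewrite mulmxBr mulmxBl eA eC /hfun !mulmxA uU mul1mx mulmx1; congr (_ - _).
    by rewrite mulmx1 -!mulmxA uV mulmx1.
  move: (U *m 1%:M *m adjmx V) => W; rewrite [LHS]mxE rdiag_mulE [X in _ + X]mxE mul_rdiagE.
  rewrite [W k j * _]mulrC -mulrBl -rmorphB; congr (_%:C * _).
  by rewrite opprD addrACA.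
have := congr1 nsq E; rewrite !nsqZ -/(ov U V psi k j) -/(ov U V 1%:M k j) => {}E.
exact: half_sqr_le E (ov_ge0 _ _ _ _ _).
Qed.

(* Any [L] may be used: it is the slope of the tangent to [exp] replacing
   Jensen's inequality for [Tr (rho_A^(1/2) psi rho_C^(1/2) psi)]. *)
Lemma ev_flip_ge (L : RR) :
  t ^+ 2 / 4 * (expR (- L) * (k2 * (1 + L)
     + (ev A (psi *m C *m psi) - k2 * ev A A + k2 * (logZ A - logZ C)) / 2)
     - 2 * (ev A psi ^+ 2 + ev C psi ^+ 2)) <= t * (ev A psi - ev C psi).
Proof.
have := logZ_flip_sqr_le.
have [U [V [l [m [a [c [[uU uV] [eA eC] [rA rC] [sA sC] [zA zC]]]]]]]] := gibbs_eig2 hA hC.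
rewrite zA zC -ev_flip_relent (sym_relent hA hC uU uV eA eC rA rC sA sC) => dle.
pose T2 := dsum (fun k j => expR ((l k + m j) / 2) * ov U V psi k j).
(* Each entropy term is at least a geometric mean times [(l k - m j)^2 / 2], and that square, times
   the overlap of [1], is bounded below by the overlap of [psi]. The geometric means have total mass
   at most 1, so [(a - c)^2] keeps only its coefficient. *)
have S1 : t ^+ 2 / 4 * T2 - (a - c) ^+ 2 / 2 <=
    dsum (fun k j => (expR (l k) - expR (m j)) * (l k - m j) * ov U V 1%:M k j).
  apply: (@le_trans _ _ (t ^+ 2 / 4 * T2 - (a - c) ^+ 2 / 2 *
      dsum (fun k j => expR ((l k + m j) / 2) * ov U V 1%:M k j))).
    rewrite lerD2l lerN2 ler_piMr ?divr_ge0 ?sqr_ge0 //.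
    exact: (dsum_geomean_le1 uU uV sA sC).
  rewrite -(dsumZ (t ^+ 2 / 4)) -(dsumZ ((a - c) ^+ 2 / 2)) -dsumB.
  apply: ler_dsum => k j.
  have H1 := ov_flip_ge k j uU uV eA eC.
  have H2 := ler_wpM2r (ov_ge0 U V 1%:M k j) (expR_sub_mul_ge_geomean (l k) (m j)).
  apply: le_trans H2; have g0 := expR_ge0 ((l k + m j) / 2).
  exact: geomean_combine.
(* The geometric mean is [p_k exp((m_j - l_k) / 2)]. Under the weights [p_k |psi_kj|^2], of mass
   [k2], the tangent at [- L] makes the exponent linear, hence an expectation in the state of [A]
   alone. *)
have T2ge : expR (- L) * (k2 * (1 + L)
     + (ev A (psi *m C *m psi) - k2 * ev A A + k2 * (a - c)) / 2) <= T2.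
  have e1 : ev A (psi *m C *m psi) = dsum (fun k j => expR (l k) * (m j + c) * ov U V psi k j).
    rewrite /ev rtrC rA -rtr_dsum -eC hpsi !mulmxA //.
  have e2 : k2 * ev A A = dsum (fun k j => (l k + a) * expR (l k) * ov U V psi k j).
    rewrite /dsum (ov_suml _ uV uU psiJ); congr (_ * _).
    by rewrite /ev rA {1}eA hfunM // /rtr tr_hfun.
  have e3 : k2 = dsum (fun k j => expR (l k) * ov U V psi k j).
    by rewrite /dsum (ov_suml _ uV uU psiJ) sA mulr1.
  have -> : expR (- L) * (k2 * (1 + L)
     + (ev A (psi *m C *m psi) - k2 * ev A A + k2 * (a - c)) / 2) =
     dsum (fun k j => expR (l k) * (expR (- L) * (1 + (m j - l k) / 2 + L)) * ov U V psi k j).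
    rewrite e1 e2 {1 2}e3 -dsumB [_ * (1 + L)]mulrC [_ * (a - c)]mulrC -(dsumZ (1 + L)) -(dsumZ (a - c)) -dsumD.
    rewrite [_ / 2]mulrC -(dsumZ 2^-1) -dsumD -(dsumZ (expR (- L))).
    apply: eq_dsum => k j; exact: tangent_rearrange.
  apply: ler_dsum => k j; apply: (ler_wpM2r (ov_ge0 U V psi k j)).
  have -> : expR ((l k + m j) / 2) = expR (l k) * expR ((m j - l k) / 2).
    by rewrite -exp.expRD; congr expR; exact: half_shift.
  by rewrite ler_pM2l ?expR_gt0 //; exact: expR_tangent.
exact: flip_combine S1 T2ge dle.
Qed.

End Observable.

End TwoStates.

(** * Majorana monomials *)

(** For [q = 2m] the sum is [2m^2]. So the phase [i^(q/2)] compensates the sign of reversing a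
    product of [q] Majorana operators, which makes [psiI] Hermitian with positive square. *)
Lemma odd_half_bin2 q : ~~ odd q -> odd (q %/ 2 + 'C(q, 2)) = false.
Proof.
move=> /even_halfK <-; move: q./2 => m; rewrite divn2 doubleK bin2 -doubleMl doubleK.
case: m => // m; rewrite -mulnS prednK ?double_gt0 //.
by rewrite oddM odd_double andbF.
Qed.

Section Majorana.
Variables (n : nat) (psi : 'I_n -> 'M[CC]_(2 ^ n./2)).
Hypothesis mpsi : is_majorana psi.
Implicit Types (i j : 'I_n) (l : seq 'I_n) (I K : {set 'I_n}).

Local Notation sgn k := ((-1 : CC) ^+ k).

Definition word l : 'M[CC]_(2 ^ n./2) := foldr (fun i M => psi i *m M) 1%:M l.

Lemma psi_anti i j : i != j -> psi i *m psi j = - (psi j *m psi i).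
Proof.
by move=> ij; apply/eqP; rewrite -addr_eq0 mpsi.2 (negPf ij) raddf0.
Qed.

Lemma psi_sqr i : psi i *m psi i = (2^-1 : CC)%:M.
Proof.
have H : 2%:R *: (psi i *m psi i) = 1%:M by rewrite scaler_nat mulr2n mpsi.2 eqxx.
have n2 : (2%:R : CC) != 0 by rewrite pnatr_eq0.
by apply: (scalerI n2); rewrite H scale_scalar_mx divff.
Qed.

(** Every letter contributes a sign except [i] itself, which commutes; adding 1 to the exponent
    undoes that one sign. *)
Lemma psi_word i l : uniq l -> psi i *m word l = sgn (size l + (i \in l)) *: (word l *m psi i).
Proof.
elim: l => [|j l IH] /=; first by rewrite mulmx1 mul1mx scale1r.
move=> /andP[jl ul]; have {}IH := IH ul.
have [ij|ij] := eqVneq i j.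
  rewrite -ij in jl *; rewrite (negPf jl) addn0 in IH.
  rewrite -/(word l) -mulmxA IH -scalemxAr !mulmxA; congr (_ *: _).
  by rewrite inE eqxx /= addSn !exprS addn1 exprS !mulN1r opprK.
rewrite inE (negPf ij) /= -/(word l) mulmxA psi_anti // mulNmx -[_ *m _ *m word l]mulmxA IH.
by rewrite -scalemxAr -scaleNr mulmxA addSn exprS mulN1r.
Qed.

Lemma word_comm l1 l2 : uniq l2 ->
  word l1 *m word l2 = sgn (size l1 * size l2 + count (mem l2) l1) *: (word l2 *m word l1).
Proof.
move=> u2; elim: l1 => [|i l IH] /=; first by rewrite mulmx1 mul1mx scale1r.
rewrite -/(word l) -mulmxA IH -scalemxAr (mulmxA (psi i) (word l2)) psi_word // -scalemxAl scalerA.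
rewrite -[_ *m _ *m word l]mulmxA.
congr (_ *: _); rewrite -exprD; congr (_ ^+ _).
by rewrite mulSn addnACA (addnC (size l * size l2)) (addnC (count _ _)).
Qed.

Lemma word_sqr l : uniq l ->
  word l *m word l = (sgn 'C(size l, 2) * 2^-1 ^+ size l)%:M.
Proof.
elim: l => [|i l IH] /=; first by rewrite mulmx1 mul1r.
move=> /andP[il ul]; rewrite -/(word l).
have H : word l *m psi i = sgn (size l) *: (psi i *m word l).
  have := psi_word i ul; rewrite (negPf il) addn0 => ->.
  by rewrite scalerA -exprMn mulrNN mulr1 expr1n scale1r.
have -> : psi i *m word l *m (psi i *m word l) = sgn (size l) *: (psi i *m psi i *m (word l *m word l)).
  by rewrite -!mulmxA (mulmxA (word l)) H -scalemxAl -scalemxAr !mulmxA.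
rewrite psi_sqr IH // mul_scalar_mx !scale_scalar_mx; congr (_%:M).
by rewrite binS bin1 addnC !exprD exprS; ring.
Qed.

Lemma word_adj l : uniq l -> adjmx (word l) = sgn 'C(size l, 2) *: word l.
Proof.
elim: l => [|i l IH] /=; first by rewrite adjmx1 scale1r.
move=> /andP[il ul]; rewrite -/(word l) adjmxM IH // mpsi.1 -scalemxAl.
have := psi_word i ul; rewrite (negPf il) addn0 => ->.
by rewrite scalerA binS bin1 exprD -mulrA -exprMn mulrNN mulr1 expr1n mulr1.
Qed.

Lemma psiIE I : psiI psi I = ('i%C ^+ (#|I| %/ 2)) *: word (enum I).
Proof. by []. Qed.

Lemma psiI_sqr I : ~~ odd #|I| -> psiI psi I *m psiI psi I = ((2^-1 ^+ #|I|)%:C)%:M.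
Proof.
move=> oI; rewrite psiIE -scalemxAl -scalemxAr scalerA word_sqr ?enum_uniq // -cardE.
rewrite scale_scalar_mx; congr (_%:M).
rewrite mulrA rmorphXn fmorphV rmorph_nat -[RHS]mul1r; congr (_ * _).
rewrite -exprMn -expr2 sqr_i -exprD -signr_odd.
by rewrite odd_half_bin2.
Qed.

Lemma psiI_adj I : ~~ odd #|I| -> adjmx (psiI psi I) = psiI psi I.
Proof.
move=> oI; rewrite psiIE adjmxZ word_adj ?enum_uniq // -cardE scalerA; congr (_ *: _).
have -> : conjc ('i%C ^+ (#|I| %/ 2)) = (-1) ^+ (#|I| %/ 2) * 'i%C ^+ (#|I| %/ 2) :> CC.
  rewrite (rmorphXn (@conjc RR)) -exprMn; congr (_ ^+ _).
  by apply/eqP; rewrite eq_complex /=; apply/andP; split; apply/eqP; ring.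
rewrite mulrAC -exprD -signr_odd.
by rewrite odd_half_bin2 // mul1r.
Qed.

Lemma psiI_comm I K : ~~ odd #|I| ->
  psiI psi I *m psiI psi K = sgn #|I :&: K| *: (psiI psi K *m psiI psi I).
Proof.
move=> oI.
have sE : sgn (size (enum I) * size (enum K) + count (mem (enum K)) (enum I)) = sgn #|I :&: K|.
  rewrite -!cardE -signr_odd oddD oddM (negPf oI) /= signr_odd; congr (_ ^+ _).
  rewrite [RHS]cardE {2 3}/enum_mem size_filter count_filter.
  by apply: eq_count => x /=; rewrite mem_enum finset.in_setI andbC.
rewrite !psiIE -!scalemxAl -!scalemxAr word_comm ?enum_uniq // sE !scalerA.
by congr (_ *: _); ring.
Qed.

Lemma psiI_anti I K : ~~ odd #|I| -> odd #|I :&: K| ->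
  psiI psi I *m psiI psi K = - (psiI psi K *m psiI psi I).
Proof. by move=> oI oIK; rewrite psiI_comm // -signr_odd oIK expr1 scaleN1r. Qed.

Lemma psiI_conj I K : ~~ odd #|I| ->
  psiI psi I *m psiI psi K *m psiI psi I =
  ((-1) ^+ odd #|I :&: K| * 2^-1 ^+ #|I|)%:C *: psiI psi K.
Proof.
move=> oI; rewrite psiI_comm // -scalemxAl -mulmxA psiI_sqr // mul_mx_scalar scalerA.
by rewrite rmorphM rmorph_sign signr_odd.
Qed.

End Majorana.

(** * Correlations in the SYK model *)

(** Double counting of pairs of a set and one of its elements, through removal of that element. *)
Lemma sum_set_pairs (n q : nat) (f : {set 'I_n} -> RR) :
  \sum_(I : {set 'I_n} | #|I| == q.+1) q.+1%:R * f I =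
  \sum_(K : {set 'I_n} | #|K| == q) \sum_(j | j \notin K) f (j |: K).
Proof.
transitivity (\sum_(p : {set 'I_n} * 'I_n | (#|p.1| == q.+1) && (p.2 \in p.1)) f p.1).
  rewrite -(pair_big_dep (fun I : {set 'I_n} => #|I| == q.+1)
    (fun (I : {set 'I_n}) (i : 'I_n) => i \in I) (fun I i => f I)) /=.
  by apply: eq_bigr => I /eqP cI; rewrite sumr_const cI mulr_natl.
rewrite (pair_big_dep (fun I : {set 'I_n} => #|I| == q)
    (fun (I : {set 'I_n}) (i : 'I_n) => i \notin I) (fun I i => f (i |: I))) /=.
rewrite (reindex_onto (fun p : {set 'I_n} * 'I_n => (p.2 |: p.1, p.2))
  (fun p => (p.1 :\ p.2, p.2))) /=; last by move=> [I i] /= /andP[_ iI]; rewrite finset.setD1K.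
apply: eq_bigl => -[K j] /=; rewrite finset.setU11 andbT xpair_eqE eqxx andbT.
have [jK|jK] := boolP (j \in K).
  rewrite andbF; apply/negP => /andP[_ /eqP E].
  by move: jK; rewrite -E !inE eqxx.
by rewrite finset.cardsU1 jK add1n eqSS finset.setU1K // eqxx andbT.
Qed.

(** The own term [w * a] and the free energy difference [d] combine to at least [beta w (a - a')],
    which [ev_flip_le] bounds below by [- 4 beta^2 k w^2]. Only [S], the anticommuting part,
    remains. *)
Lemma flip_arith (beta L S d a a' w k e : RR) : 0 < beta ->
  (- 2 * beta * w) ^+ 2 / 4 * (e * (k * (1 + L) + (k * (2 * beta * (w * a) + 2 * beta * S) + k * d) / 2)
    - 2 * (a ^+ 2 + a' ^+ 2)) <= - 2 * beta * w * (a - a') ->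
  - 2 * beta * (w * a') <= d -> `|a - a'| <= 4 * beta * k * `|w| -> w * (a - a') <= 0 ->
  0 < k -> 0 < e ->
  beta ^+ 2 * w ^+ 2 * (k * e * (1 + L + beta * S - 4 * beta ^+ 2 * k * w ^+ 2)
     - 2 * (a ^+ 2 + a' ^+ 2)) <= - 2 * beta * w * (a - a').
Proof.
move=> b0 H F1 up mono k0 e0; apply: le_trans H.
rewrite (_ : (- 2 * beta * w) ^+ 2 / 4 = beta ^+ 2 * w ^+ 2); last by field.
apply: ler_wpM2l; first by rewrite mulr_ge0 ?sqr_ge0.
rewrite lerD2r [k * e]mulrC -[e * k * _]mulrA; apply: ler_wpM2l; first exact: ltW.
rewrite (_ : k * (1 + L) + _ = k * (1 + L + (2 * beta * (w * a) + 2 * beta * S + d) / 2)); last by field.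
apply: ler_wpM2l; first exact: ltW.
have : `|w * (a - a')| <= 4 * beta * k * w ^+ 2.
  rewrite normrM -[w ^+ 2]real_normK ?num_real // expr2 mulrA [_ * `|a - a'|]mulrC.
  by apply: ler_wpM2r.
rewrite ler_norml => /andP[lo _].
have := ler_wpM2l (ltW b0) lo; lra.
Qed.

Lemma mulmx_conjZ N (P X : 'M[CC]_N) c : P *m (c *: X) *m P = c *: (P *m X *m P).
Proof. by rewrite -scalemxAr -scalemxAl. Qed.

Section SYK.
Variables (n q : nat) (psi : 'I_n -> 'M[CC]_(2 ^ n./2)) (beta : RR).
Hypotheses (q_gt0 : (0 < q)%N) (qeven : ~~ odd q) (beta_gt0 : 0 < beta) (mpsi : is_majorana psi).
Implicit Types (v : {set 'I_n} -> RR) (I K : {set 'I_n}).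

(** The factor [- beta] is absorbed so that [rho (genH v)] is convertible to the [gibbs] state of
    the statement. *)
Definition genH v : 'M[CC]_(2 ^ n./2) := (- beta)%:C *: SYK_H q psi v.
Definition freeF v : RR := logZ (genH v).
Definition corr I v : RR := ev (genH v) (psiI psi I).
(** The square of a monomial of degree [q]: the normalization of the anticommutator gives each
    Majorana operator the square 1/2. *)
Definition kap : RR := 2^-1 ^+ q.
Let N_gt0 : (0 < 2 ^ n./2)%N. Proof. by rewrite expn_gt0. Qed.

Lemma kap_gt0 : 0 < kap. Proof. by rewrite exprn_gt0. Qed.

Lemma psi_sqr_kap I : #|I| == q -> psiI psi I *m psiI psi I = (kap%:C)%:M.
Proof. by move=> /eqP cI; rewrite psiI_sqr // cI. Qed.
Lemma psi_adj_q I : #|I| == q -> adjmx (psiI psi I) = psiI psi I.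
Proof. by move=> /eqP cI; rewrite psiI_adj // cI. Qed.

Lemma genH_adj v : adjmx (genH v) = genH v.
Proof.
rewrite /genH adjmxZ conjc_real /SYK_H adjmx_sum; congr (_ *: _).
by apply: eq_bigr => I cI; rewrite adjmxZ conjc_real psi_adj_q.
Qed.

Lemma genHB v v' : genH v - genH v' =
  \sum_(I : {set 'I_n} | #|I| == q) (- beta * (v I - v' I))%:C *: psiI psi I.
Proof.
rewrite /genH -scalerBr /SYK_H -sumrB scaler_sumr; apply: eq_bigr => I _.
by rewrite -scalerBl scalerA -rmorphB -rmorphM.
Qed.

(** The gradient of the free energy is [- beta] times the correlations. All later uses of convexity
    go through this inequality. *)
Lemma freeF_ge v v' :
  freeF v - beta * (\sum_(I : {set 'I_n} | #|I| == q) (v' I - v I) * corr I v) <= freeF v'.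
Proof.
have := peierls_bogoliubov N_gt0 (genH_adj v) (genH_adj v').
rewrite genHB ev_sum.
rewrite (eq_bigr (fun I => - beta * ((v' I - v I) * corr I v))); last first.
  by move=> I _; rewrite evZ mulrA.
by rewrite -mulr_sumr mulNr -/(freeF v) -/(freeF v') lerBrDr addrC.
Qed.

Lemma corr_bound I v : #|I| == q -> corr I v ^+ 2 <= kap.
Proof.
move=> cI; exact: (ev_bound N_gt0 (genH_adj v) (psi_adj_q cI) (psi_sqr_kap cI)).
Qed.

Section Flip.
Variables (I : {set 'I_n}) (v v' : {set 'I_n} -> RR).
Hypotheses (cI : #|I| == q) (v'I : v' I = - v I) (v'E : forall K, K != I -> v' K = v K).
Let t := - 2 * beta * v I.

Let AC : genH v - genH v' = t%:C *: psiI psi I.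
Proof.
rewrite genHB (bigD1 I) //= big1 ?addr0; last first.
  by move=> K /andP[_ KI]; rewrite v'E // subrr mulr0 scale0r.
by rewrite v'I /t; congr (_%:C *: _); ring.
Qed.

Lemma corr_flip_mono : v I * (corr I v - corr I v') <= 0.
Proof.
have := ev_flip_mono N_gt0 (genH_adj v) (genH_adj v') AC.
rewrite -/(corr I v) -/(corr I v') /t.
move: (corr I v - corr I v') (v I) => x y.
rewrite (_ : - 2 * beta * y * x = beta * (- 2 * (y * x))); last by ring.
by rewrite (pmulr_rge0 _ beta_gt0) => ?; lra.
Qed.

Lemma corr_flip_le : `|corr I v - corr I v'| <= 4 * beta * kap * `|v I|.
Proof.
have := ev_flip_le N_gt0 (genH_adj v) (genH_adj v') (psi_adj_q cI) (psi_sqr_kap cI) AC.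
rewrite -/(corr I v) -/(corr I v').
have -> : `|t| = 2 * beta * `|v I|.
  by rewrite /t !normrM normrN (gtr0_norm beta_gt0) (ger0_norm (ler0n RR 2)).
by rewrite (_ : 4 * beta * kap * `|v I| = 2 * kap * (2 * beta * `|v I|)) //; ring.
Qed.

(** Conjugation by [psiI psi I] multiplies the term of [K] by [kap] and the commutation sign.
    Commuting terms cancel, anticommuting ones double, and the term of [I] doubles because its
    coupling was flipped. *)
Lemma ev_conj_flip :
  ev (genH v) (psiI psi I *m genH v' *m psiI psi I) - kap * ev (genH v) (genH v) =
  kap * (2 * beta * (v I * corr I v) +
   2 * beta * \sum_(K : {set 'I_n} | (#|K| == q) && odd #|I :&: K|) v K * corr K v).
Proof.
have oI : ~~ odd #|I| by rewrite (eqP cI).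
have -> : psiI psi I *m genH v' *m psiI psi I =
   \sum_(K : {set 'I_n} | #|K| == q) (- beta * kap * (-1) ^+ odd #|I :&: K| * v' K)%:C *: psiI psi K.
  rewrite /genH mulmx_conjZ /SYK_H mulmx_sumr mulmx_suml scaler_sumr.
  apply: eq_bigr => K _; rewrite mulmx_conjZ psiI_conj //.
  move: (psiI psi K) => P; rewrite !scalerA -!rmorphM.
  by rewrite /kap (eqP cI); congr (_%:C *: _); ring.
rewrite ev_sum {3}/genH evZ /SYK_H ev_sum !mulr_sumr -sumrB.
rewrite (eq_bigr (fun K => kap * (2 * beta * (if K == I then v I * corr I v else 0)) +
   kap * (2 * beta * (if odd #|I :&: K| then v K * corr K v else 0)))); last first.
  move=> K cK; rewrite !evZ -/(corr K v); have [->|KI] := eqVneq K I.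
    by rewrite finset.setIid (negPf oI) v'I; ring.
  by rewrite v'E //; case: odd; ring.
rewrite big_split /= -!mulr_sumr -mulrDr; congr (_ * (_ + _)).
  congr (_ * _); rewrite (bigD1 I) //= eqxx big1 ?addr0 // => K /andP[_ /negPf ->] //.
by rewrite -big_mkcondr.
Qed.

Lemma corr_flip_ge (L : RR) :
  beta ^+ 2 * v I ^+ 2 * (kap * expR (- L) * (1 + L
     + beta * (\sum_(K : {set 'I_n} | (#|K| == q) && odd #|I :&: K|) v K * corr K v)
     - 4 * beta ^+ 2 * kap * v I ^+ 2)
     - 2 * (corr I v ^+ 2 + corr I v' ^+ 2)) <= - 2 * beta * v I * (corr I v - corr I v').
Proof.
have := ev_flip_ge N_gt0 (genH_adj v) (genH_adj v') (psi_adj_q cI) (psi_sqr_kap cI) AC L.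
rewrite ev_conj_flip -/(freeF v) -/(freeF v') -/(corr I v) -/(corr I v').
set S := \sum_(K | _) _ => H.
have F1 : - 2 * beta * (v I * corr I v') <= freeF v - freeF v'.
  have := freeF_ge v' v; rewrite (bigD1 I) //= v'I opprK big1 ?addr0; last first.
    by move=> K /andP[_ KI]; rewrite v'E // subrr mul0r.
  by rewrite lerBrDl; congr (_ <= _); ring.
have up := corr_flip_le; have mono := corr_flip_mono.
have k0 := kap_gt0; have e0 := expR_gt0 (- L).
move: H F1 up mono k0 e0; rewrite /t.
move: (freeF v - freeF v') (corr I v) (corr I v') (v I) kap (expR (- L)).
by move=> d a a' w k e ? ? ? ? ? ?; apply: (@flip_arith _ _ _ d).
Qed.
End Flip.

(** Fix [K] of size [q - 1]. The sets [j |: K] meet pairwise exactly in [K], whose size is odd, so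
    their monomials anticommute and [ev_anticomm] bounds the family by [kap]. Each [I] arises from
    [q] such [K]. *)
Lemma sum_corr_sqr v :
  q%:R * (\sum_(I : {set 'I_n} | #|I| == q) corr I v ^+ 2) <= 'C(n, q.-1)%:R * kap.
Proof.
rewrite mulr_sumr.
have E := sum_set_pairs q.-1 (fun I => corr I v ^+ 2); rewrite prednK // in E; rewrite E.
have -> : 'C(n, q.-1)%:R * kap = \sum_(K : {set 'I_n} | #|K| == q.-1) kap.
  by rewrite sumr_const -[RHS]mulr_natl; congr (_%:R * _); rewrite -cardsE card_draws card_ord.
apply: ler_sum => K cK; rewrite /corr.
have cj j : j \notin K -> #|j |: K| == q by move=> jK; rewrite finset.cardsU1 jK (eqP cK) add1n prednK.
apply: (ev_anticomm N_gt0 (genH_adj v) (ltW kap_gt0)) => [j jK|j j' jK j'K].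
  exact/psi_adj_q/cj.
have [<-|jj'] := eqVneq j j'.
  by rewrite psi_sqr_kap ?cj // -raddfD -rmorphD -mulr2n.
rewrite psiI_anti //; first by rewrite addNr raddf0.
  by rewrite (eqP (cj _ jK)).
have -> : (j |: K) :&: (j' |: K) = K.
  apply/finset.setP => x; rewrite !inE; case: (x \in K); rewrite ?orbT // !orbF.
  by apply/negP => /andP[/eqP -> /eqP] /eqP; rewrite (negPf jj').
by rewrite (eqP cK); move: qeven; rewrite -{1}(prednK q_gt0) /= negbK.
Qed.

End SYK.

(** * Functions on the sign cube *)

Section Cube.
Variables (R : realFieldType) (T : finType).
Implicit Types (s : {ffun T -> bool}) (I J : T) (f g : {ffun T -> bool} -> R).

Definition sgnc s I : R := (-1) ^+ s I.
Definition tog I s : {ffun T -> bool} := [ffun J => s J (+) (J == I)].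
Definition act s (x : T -> R) : T -> R := fun I => sgnc s I * x I.
Definition avg f : R := #|{ffun T -> bool}|%:R^-1 * \sum_s f s.

Lemma togK I : involutive (tog I).
Proof. by move=> s; apply/ffunP => J; rewrite !ffunE addbK. Qed.
Lemma togC I J s : tog I (tog J s) = tog J (tog I s).
Proof. by apply/ffunP => L; rewrite !ffunE addbAC. Qed.
Lemma sgnc_tog I s : sgnc (tog I s) I = - sgnc s I.
Proof. by rewrite /sgnc ffunE eqxx addbT signrN. Qed.
Lemma sgnc_tog_neq I J s : J != I -> sgnc (tog I s) J = sgnc s J.
Proof. by move=> /negPf JI; rewrite /sgnc ffunE JI addbF. Qed.
Lemma sgnc_sqr s I : sgnc s I ^+ 2 = 1.
Proof. exact: sqrr_sign. Qed.
Lemma normr_sgnc s I : `|sgnc s I| = 1.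
Proof. exact: normr_sign. Qed.

Lemma card_cube_gt0 : 0 < #|{ffun T -> bool}|%:R :> R.
Proof. by rewrite ltr0n card_ffun card_bool expn_gt0. Qed.

Lemma avg_tog I f : avg (fun s => f (tog I s)) = avg f.
Proof.
rewrite /avg; congr (_ * _); rewrite [RHS](reindex (tog I)) //.
by apply: onW_bij; exact: inv_bij (togK I).
Qed.
Lemma avgD f g : avg (fun s => f s + g s) = avg f + avg g.
Proof. by rewrite /avg big_split mulrDr. Qed.
Lemma avgZ (a : R) f : avg (fun s => a * f s) = a * avg f.
Proof. by rewrite /avg -mulr_sumr mulrCA. Qed.
Lemma avgB f g : avg (fun s => f s - g s) = avg f - avg g.
Proof. by rewrite avgD; congr (_ + _); rewrite -mulN1r -avgZ; congr avg; apply/funext => s; rewrite mulN1r. Qed.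
Lemma avgc (a : R) : avg (fun=> a) = a.
Proof. by rewrite /avg sumr_const -[a *+ _]mulr_natl mulKf // gt_eqF ?card_cube_gt0. Qed.
Lemma ler_avg f g : (forall s, f s <= g s) -> avg f <= avg g.
Proof.
by move=> fg; rewrite /avg ler_pM2l ?invr_gt0 ?card_cube_gt0 //; apply: ler_sum.
Qed.
Lemma eq_avg f g : (forall s, f s = g s) -> avg f = avg g.
Proof. by move=> fg; congr avg; apply/funext. Qed.
Lemma avg_sum (K : Type) (r : seq K) (P : pred K) (F : K -> {ffun T -> bool} -> R) :
  avg (fun s => \sum_(i <- r | P i) F i s) = \sum_(i <- r | P i) avg (F i).
Proof. by rewrite /avg exchange_big mulr_sumr. Qed.

(** Discrete integration by parts: correlating with a sign only sees how [g] responds to that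
    sign. *)
Lemma avg_sgnc I g : avg (fun s => sgnc s I * g s) = avg (fun s => sgnc s I * (g s - g (tog I s)) / 2).
Proof.
have -> : avg (fun s => sgnc s I * (g s - g (tog I s)) / 2) =
    2^-1 * avg (fun s => sgnc s I * g s) + 2^-1 * avg (fun s => sgnc (tog I s) I * g (tog I s)).
  rewrite -!avgZ -avgD; apply: eq_avg => s; rewrite sgnc_tog; ring.
by rewrite (avg_tog I (fun s => sgnc s I * g s)); field.
Qed.

(** The conditional expectation that forgets the coordinate [I]. *)
Definition halfavg I f : {ffun T -> bool} -> R := fun s => (f s + f (tog I s)) / 2.

Lemma avg_halfavg I f : avg (halfavg I f) = avg f.
Proof.
rewrite /halfavg (eq_avg (g := fun s => 2^-1 * f s + 2^-1 * f (tog I s))); last by move=> s; field.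
by rewrite avgD !avgZ avg_tog; field.
Qed.

Lemma halfavg_sqr I f : avg (fun s => f s ^+ 2) - avg (fun s => halfavg I f s ^+ 2) =
  avg (fun s => (f s - f (tog I s)) ^+ 2) / 4.
Proof.
have E : avg (fun s => f (tog I s) ^+ 2) = avg (fun s => f s ^+ 2) := avg_tog I (fun s => f s ^+ 2).
rewrite (eq_avg (f := fun s => halfavg I f s ^+ 2) (g := fun s => 2^-1 * f s ^+ 2 +
   2^-1 * f (tog I s) ^+ 2 - 4^-1 * (f s - f (tog I s)) ^+ 2)); last first.
  by move=> s; rewrite /halfavg; field.
by rewrite avgB avgD !avgZ E; field.
Qed.

Lemma halfavg_diff I J f (d : R) : (forall s, `|f s - f (tog J s)| <= d) ->
  forall s, `|halfavg I f s - halfavg I f (tog J s)| <= d.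
Proof.
move=> H s; rewrite /halfavg (togC I J) -mulrBl normrM (ger0_norm (x := 2^-1)) ?invr_ge0 //.
rewrite ler_pdivrMr // opprD addrACA; apply: le_trans (ler_normD _ _) _.
by rewrite mulr_natr mulr2n lerD.
Qed.

Definition foldavg (l : seq T) f := foldr halfavg f l.

(** The induction carries all four facts at once: averaging out a further coordinate must neither
    increase the differences nor destroy the invariance already gained, and it loses exactly a
    quarter of a mean squared difference. *)
Lemma foldavg_spec (l : seq T) f (d : T -> R) :
  (forall s I, `|f s - f (tog I s)| <= d I) ->
  [/\ avg (foldavg l f) = avg f,
      forall s I, `|foldavg l f s - foldavg l f (tog I s)| <= d I,
      forall s I, I \in l -> foldavg l f (tog I s) = foldavg l f s &
      avg (fun s => f s ^+ 2) - avg (fun s => foldavg l f s ^+ 2) <= \sum_(I <- l) d I ^+ 2 / 4].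
Proof.
move=> fd; elim: l => [|J l [IH1 IH2 IH3 IH4]]; first by split; rewrite // big_nil subrr.
split => /=.
- by rewrite avg_halfavg.
- by move=> s I; exact: halfavg_diff.
- move=> s I; rewrite inE => /orP[/eqP ->|Il].
    by rewrite /halfavg togK addrC.
  by rewrite /halfavg (togC J I) !(IH3 _ I Il).
- rewrite big_cons; have := halfavg_sqr J (foldavg l f).
  have : avg (fun s => (foldavg l f s - foldavg l f (tog J s)) ^+ 2) <= d J ^+ 2.
    rewrite -[leRHS]avgc; apply: ler_avg => s.
    by rewrite -real_normK ?num_real // ler_pXn2r ?nnegrE ?(le_trans _ (IH2 s J)).
  move: IH4; rewrite -!/(foldavg _ _); lra.
Qed.

Lemma tog_invariant_const f : (forall s I, f (tog I s) = f s) ->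
  forall s, f s = f [ffun=> false].
Proof.
move=> H s; have [k] := ubnP #|[pred I | s I]|; elim: k s => // k IH s.
have [I /= sI|s0] := pickP [pred I | s I]; last first.
  by move=> _; congr f; apply/ffunP => I; rewrite ffunE; exact: s0.
rewrite ltnS => sk; rewrite -(H s I); apply: IH; apply: leq_trans sk.
apply: proper_card; apply/properP; split.
  by apply/fintype.subsetP => J; rewrite !inE ffunE; case: eqP => [->|_]; rewrite ?addbF // sI.
by exists I; rewrite !inE /= ?ffunE ?eqxx ?addbT ?sI.
Qed.

(* Bounded differences: iterating [halfavg] over all coordinates yields the mean. *)
Lemma cube_var f (d : T -> R) : (forall s I, `|f s - f (tog I s)| <= d I) ->
  avg (fun s => (f s - avg f) ^+ 2) <= (\sum_I d I ^+ 2) / 4.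
Proof.
move=> fd; have [E1 _ E3 E4] := foldavg_spec (enum T) fd.
set g := foldavg _ f in E1 E3 E4.
have gc s : g s = g [ffun=> false].
  by apply: tog_invariant_const => {}s I; apply: E3; rewrite mem_enum.
have gE : g [ffun=> false] = avg f by rewrite -E1 -[LHS]avgc; apply: eq_avg => s; rewrite -(gc s).
have -> : avg (fun s => (f s - avg f) ^+ 2) = avg (fun s => f s ^+ 2) - avg f ^+ 2.
  rewrite (eq_avg (g := fun s => f s ^+ 2 - (2 * avg f) * f s + avg f ^+ 2)); last by move=> s; ring.
  by rewrite avgD avgB avgZ avgc; ring.
have -> : avg f ^+ 2 = avg (fun s => g s ^+ 2).
  by rewrite -[LHS]avgc; apply: eq_avg => s; rewrite gc gE.
by apply: le_trans E4 _; rewrite big_enum mulr_suml.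
Qed.

Definition pr (A : pred {ffun T -> bool}) : R := avg (fun s => (A s)%:R).

Lemma pr_le (A B : pred {ffun T -> bool}) : (forall s, A s -> B s) -> pr A <= pr B.
Proof.
by move=> AB; apply: ler_avg => s; rewrite ler_nat; case: (A s) (AB s) => // ->.
Qed.

Lemma pr_or (A B : pred {ffun T -> bool}) : pr (fun s => A s || B s) <= pr A + pr B.
Proof.
by rewrite -avgD; apply: ler_avg => s; rewrite -natrD ler_nat; case: (A s); case: (B s).
Qed.

Lemma cube_chebyshev f (m r : R) : 0 < r ->
  pr (fun s => r <= `|f s - m|) <= avg (fun s => (f s - m) ^+ 2) / r ^+ 2.
Proof.
move=> r0; rewrite ler_pdivlMr ?exprn_gt0 // mulrC -avgZ; apply: ler_avg => s.
case: (leP r `|f s - m|) => rs; rewrite ?mulr0 ?sqr_ge0 // mulr1.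
by rewrite -[leRHS]real_normK ?num_real // ler_pXn2r ?nnegrE // ltW.
Qed.

End Cube.

(** * Random signs *)

Lemma ler_sum_pred (T : finType) (P Q : pred T) (f : T -> RR) :
  (forall i, P i -> Q i) -> (forall i, Q i -> 0 <= f i) ->
  \sum_(i | P i) f i <= \sum_(i | Q i) f i.
Proof.
move=> PQ f0; rewrite [leRHS](bigID P) /= (eq_bigl P); last first.
  by move=> i; case: (boolP (P i)) => [/PQ ->|]; rewrite ?andbF.
by rewrite lerDl; apply: sumr_ge0 => i /andP[/f0].
Qed.

(** * Sign averages for an abstract convex free energy with gradient [- beta * a] *)

Section SignCube.
Variables (T : finType) (D : pred T) (anti : T -> T -> bool).
Variables (F : (T -> RR) -> RR) (a : T -> (T -> RR) -> RR).
Variables (beta kap delta q0 sig : RR).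
Implicit Types (I K : T) (v : T -> RR).
Local Notation M := ((#|D|)%:R : RR).
Local Notation flips I v v' := (v' I = - v I /\ forall K, K != I -> v' K = v K).

Hypotheses (beta_gt0 : 0 < beta) (kap_gt0 : 0 < kap) (kap_le1 : kap <= 1)
  (sig_gt0 : 0 < sig) (sig_le1 : sig <= 1) (q0_ge0 : 0 <= q0).
Hypothesis F_ge : forall v v',
  F v - beta * (\sum_(I | D I) (v' I - v I) * a I v) <= F v'.
Hypothesis a_bound : forall I v, D I -> a I v ^+ 2 <= kap.
Hypothesis a_mono : forall I v v', D I -> flips I v v' -> v I * (a I v - a I v') <= 0.
Hypothesis a_le : forall I v v', D I -> flips I v v' ->
  `|a I v - a I v'| <= 4 * beta * kap * `|v I|.
Hypothesis a_ge : forall I v v' L, D I -> flips I v v' ->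
  beta ^+ 2 * v I ^+ 2 * (kap * expR (- L) * (1 + L
     + beta * (\sum_(K | D K && anti I K) v K * a K v) - 4 * beta ^+ 2 * kap * v I ^+ 2)
     - 2 * (a I v ^+ 2 + a I v' ^+ 2)) <= - 2 * beta * v I * (a I v - a I v').
Hypothesis a_sqr_sum : forall v, \sum_(I | D I) a I v ^+ 2 <= delta * M * kap.
Hypothesis anti_count : forall K, D K ->
  #|[pred I | D I && anti I K]|%:R * sig ^+ 2 <= q0.

Lemma act_tog (x : T -> RR) I s : flips I (act s x) (act (tog I s) x).
Proof.
by split=> [|K KI]; rewrite /act ?sgnc_tog ?mulNr // sgnc_tog_neq.
Qed.

(** The mean of [- v_I a_I] under random signs. [respE] rewrites it through single flips, which is
    how the flip estimates enter. *)
Definition resp I (y : T -> RR) : RR := - avg (fun s => act s y I * a I (act s y)).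

Lemma respE I y : resp I y =
  avg (fun s => - (act s y I * (a I (act s y) - a I (act (tog I s) y))) / 2).
Proof.
rewrite /resp (eq_avg (g := fun s => sgnc RR s I * (y I * a I (act s y)))); last first.
  by move=> s; rewrite mulrA.
rewrite avg_sgnc -mulN1r -avgZ; apply: eq_avg => s.
by rewrite {1 3}/act; ring.
Qed.

Lemma resp_ge0 I y : D I -> 0 <= resp I y.
Proof.
move=> DI; rewrite respE -[leLHS](avgc T 0); apply: ler_avg => s.
have := a_mono DI (act_tog y I s); lra.
Qed.

Lemma resp_le I y : D I -> resp I y <= 2 * beta * kap * y I ^+ 2.
Proof.
move=> DI; rewrite respE -[leRHS](avgc T); apply: ler_avg => s.
have H := a_le DI (act_tog y I s).
have E : `|act s y I| = `|y I| by rewrite /act normrM normr_sgnc mul1r.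
rewrite E in H.
have H2 : `|act s y I * (a I (act s y) - a I (act (tog I s) y))| <= 4 * beta * kap * y I ^+ 2.
  rewrite normrM E -[y I ^+ 2]real_normK ?num_real // expr2 mulrA [_ * `|y I| * _]mulrC.
  by apply: ler_wpM2l.
by move: H2; rewrite ler_norml => /andP[]; lra.
Qed.

Lemma resp_ge I y (L : RR) : D I ->
  beta / 4 * y I ^+ 2 * (kap * expR (- L) * (1 + L
     - beta * (\sum_(K | D K && anti I K) resp K y) - 4 * beta ^+ 2 * kap * y I ^+ 2)
     - 4 * avg (fun s => a I (act s y) ^+ 2)) <= resp I y.
Proof.
move=> DI; rewrite [leRHS]respE.
have E2 s : act s y I ^+ 2 = y I ^+ 2 by rewrite /act exprMn sgnc_sqr mul1r.
apply: (@le_trans _ _ (avg (fun s => beta / 4 * y I ^+ 2 * (kap * expR (- L) * (1 + L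
     + beta * (\sum_(K | D K && anti I K) act s y K * a K (act s y)) - 4 * beta ^+ 2 * kap * y I ^+ 2)
     - 2 * (a I (act s y) ^+ 2 + a I (act (tog I s) y) ^+ 2))))); last first.
  apply: ler_avg => s; have := a_ge L DI (act_tog y I s); rewrite E2.
  set X := (X in _ * X <= _ -> _); set d := a I _ - _ => H.
  rewrite -(ler_pM2l (x := 4 * beta)) ?mulr_gt0 //.
  rewrite (_ : 4 * beta * (beta / 4 * y I ^+ 2 * X) = beta ^+ 2 * y I ^+ 2 * X); last by field.
  rewrite (_ : 4 * beta * (- (act s y I * d) / 2) = - 2 * beta * act s y I * d) //.
  by field.
rewrite avgZ; apply: ler_wpM2l; first by rewrite mulr_ge0 ?sqr_ge0 ?divr_ge0 ?ltW.
(* The flipped and the unflipped square have the same mean, hence the coefficient 4 in place of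
   2. *)
have T2 : avg (fun s => a I (act (tog I s) y) ^+ 2) = avg (fun s => a I (act s y) ^+ 2) :=
  avg_tog I (fun s => a I (act s y) ^+ 2).
rewrite avgB avgZ (avgZ 2) (avgD (fun s => a I (act s y) ^+ 2)) T2.
rewrite (eq_avg (f := fun s => 1 + L + _ - _) (g := fun s => (1 + L - 4 * beta ^+ 2 * kap * y I ^+ 2)
    + beta * (\sum_(K | D K && anti I K) act s y K * a K (act s y)))); last first.
  by move=> s; ring.
rewrite avgD avgc avgZ avg_sum.
have -> : \sum_(K | D K && anti I K) resp K y =
    - \sum_(K | D K && anti I K) avg (fun s => act s y K * a K (act s y)).
  by rewrite -sumrN.
rewrite le_eqVlt; apply/orP; left; apply/eqP; ring.
Qed.

(** * Lower bound and concentration for the sign-weighted sum of correlations *)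

Section Weights.
Variables (G : pred T) (x theta : T -> RR) (eta C0 : RR).
Hypotheses (GD : forall I, G I -> D I) (eta_gt0 : 0 < eta) (C0_ge0 : 0 <= C0).
Hypotheses (theta_sqr : forall I, G I -> theta I ^+ 2 = 1)
  (thetaE : forall I, G I -> theta I * `|x I| = x I).
Hypotheses (G_x : forall I, G I -> eta * sig <= `|x I|)
  (G_card : M / 2 <= (#|G|)%:R) (D_gt0 : 0 < M)
  (x_sqr_sum : \sum_(I | D I) x I ^+ 2 <= C0 * sig ^+ 2 * M).

Let tau : RR := eta * sig / 2.
Let y I : RR := if G I then x I - tau * theta I else x I.
(** The value of [L]. Multiplied by [M / 2], the lower bound on [#|G|], it equals the summed
    interaction error [2 beta^2 kap q0 C0 M] plus the summed self error [4 beta^2 kap C0 M]. *)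
Definition slope : RR := 4 * beta ^+ 2 * kap * C0 * (q0 + 2).
(** The factor [beta * tau / 4] of [hresp_ge], with [tau = eta * sig / 2], times
    [kap * expR (- slope) / 4] from [sum_bracket], divided by [sig]. *)
Definition rate : RR := beta * eta * kap * expR (- slope) / 32.
Let mu : RR := rate * sig * M.
Hypothesis delta_small : delta <= expR (- slope) / 16.

Let tau_gt0 : 0 < tau.
Proof. by rewrite divr_gt0 ?mulr_gt0. Qed.

Let slope_ge0 : 0 <= slope.
Proof. by rewrite !mulr_ge0 ?sqr_ge0 ?addr_ge0 // ltW. Qed.

Lemma rate_gt0 : 0 < rate.
Proof. by rewrite divr_gt0 // !mulr_gt0 ?expR_gt0. Qed.

Let mu_gt0 : 0 < mu.
Proof. by apply: mulr_gt0 => //; apply: mulr_gt0 => //; exact: rate_gt0. Qed.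

Let y_on I : G I -> y I = theta I * `|y I| /\ tau <= `|y I| <= `|x I|.
Proof.
move=> GI; have H := G_x GI; have t0 : 0 < tau := tau_gt0.
have tE : eta * sig = 2 * tau by rewrite /tau; field.
have xt : 0 <= `|x I| - tau by lra.
have yE : y I = theta I * (`|x I| - tau) by rewrite /y GI -{1}(thetaE GI); ring.
have nt : `|theta I| = 1.
  by apply/eqP; rewrite -(eqrXn2 (n := 2)) // expr1n real_normK ?num_real // theta_sqr.
have ynorm : `|y I| = `|x I| - tau by rewrite yE normrM nt mul1r ger0_norm.
by rewrite ynorm; split => //; apply/andP; split; lra.
Qed.

Let y_sqr I : y I ^+ 2 <= x I ^+ 2.
Proof.
rewrite -[leLHS]real_normK ?num_real // -[leRHS]real_normK ?num_real //.
rewrite ler_pXn2r ?nnegrE //; have [GI|nG] := boolP (G I).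
  by have [_ /andP[]] := y_on GI.
by rewrite /y (negPf nG).
Qed.

Let y_sqr_sum : \sum_(I | D I) y I ^+ 2 <= C0 * sig ^+ 2 * M.
Proof. by apply: le_trans x_sqr_sum; apply: ler_sum => I _; exact: y_sqr. Qed.

Let hresp I : RR := avg (fun s => - (sgnc RR s I * theta I * a I (act s y))).

Let hrespE I : G I -> resp I y = `|y I| * hresp I.
Proof.
move=> GI; rewrite /resp -mulN1r -avgZ -avgZ; apply: eq_avg => s.
by rewrite {1}/act {1}(y_on GI).1; ring.
Qed.

Let bracket I : RR := kap * expR (- slope) * (1 + slope
     - beta * (\sum_(K | D K && anti I K) resp K y) - 4 * beta ^+ 2 * kap * y I ^+ 2)
     - 4 * avg (fun s => a I (act s y) ^+ 2).

(** One factor [|y I|] of [resp_ge] cancels and the other is at least [tau]. The bound holds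
    whatever the sign of [bracket I], so [bracket] has to be controlled only in sum. *)
Let hresp_ge I : G I -> beta * tau / 4 * bracket I <= hresp I.
Proof.
move=> GI; have [_ /andP[ty _]] := y_on GI.
have y0 : 0 < `|y I| by exact: lt_le_trans ty.
have := resp_ge y slope (GD GI); rewrite -/(bracket I) hrespE // => H.
have h0 : 0 <= hresp I by rewrite -(pmulr_rge0 _ y0) -hrespE // resp_ge0 // GD.
have H2 : beta / 4 * `|y I| * bracket I <= hresp I.
  rewrite -(ler_pM2l y0); apply: le_trans H.
  by rewrite -[y I ^+ 2]real_normK ?num_real // le_eqVlt; apply/orP; left; apply/eqP; field.
(* A negative bracket cannot be multiplied by [tau <= |y I|]; there the nonnegativity of the
   response is enough. *)
case: (leP 0 (bracket I)) => b0.
  apply: le_trans H2; apply: ler_wpM2r => //.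
  by rewrite mulrAC; apply: ler_wpM2l => //; rewrite divr_ge0 // ltW.
apply: le_trans h0; rewrite pmulr_rle0 ?ltW //.
by rewrite divr_gt0 // mulr_gt0.
Qed.

(** After exchanging the sums, each [K] is counted at most [q0 / sig^2] times, while [resp_le]
    bounds its response by a multiple of [y K ^+ 2], of total at most [C0 sig^2 M]. *)
Let sum_anti : \sum_(I | G I) \sum_(K | D K && anti I K) resp K y <= 2 * beta * kap * q0 * C0 * M.
Proof.
apply: (@le_trans _ _ (\sum_(I | D I) \sum_(K | D K && anti I K) resp K y)).
  apply: ler_sum_pred => //.
  by move=> I _; apply: sumr_ge0 => K /andP[DK _]; exact: resp_ge0.
rewrite (exchange_big_dep D) /=; last by move=> I K _ /andP[].
rewrite -(ler_pM2r (exprn_gt0 2 sig_gt0)) mulr_suml.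
apply: (@le_trans _ _ (\sum_(K | D K) 2 * beta * kap * y K ^+ 2 * q0)).
  apply: ler_sum => K DK.
  rewrite (eq_bigl (fun I => I \in [pred I | D I && anti I K])); last by move=> I; rewrite inE DK.
  rewrite sumr_const -[_ *+ _]mulr_natr -(mulrA (resp K y)); apply: ler_pM.
  - exact: resp_ge0.
  - by rewrite mulr_ge0 ?sqr_ge0.
  - exact: resp_le.
  - exact: anti_count.
rewrite -mulr_suml -mulr_sumr.
have -> : 2 * beta * kap * q0 * C0 * M * sig ^+ 2 = 2 * beta * kap * (C0 * sig ^+ 2 * M) * q0 by ring.
by apply: ler_wpM2r => //; apply: ler_wpM2l => //; rewrite !mulr_ge0 // ltW.
Qed.

Let sum_subset (f : T -> RR) : (forall I, D I -> 0 <= f I) ->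
  \sum_(I | G I) f I <= \sum_(I | D I) f I.
Proof. by move=> f0; apply: ler_sum_pred. Qed.

Let sum_bracket : kap * expR (- slope) * M / 4 <= \sum_(I | G I) bracket I.
Proof.
set e := expR (- slope); have e0 : 0 < e by exact: expR_gt0.
rewrite /bracket sumrB -[X in X - _]mulr_sumr -[X in _ - X]mulr_sumr.
set s3 := \sum_(I | G I) avg _.
rewrite sumrB sumrB sumr_const -!mulr_sumr -/e.
have S1 := sum_anti.
have S2 : \sum_(I | G I) y I ^+ 2 <= C0 * M.
  apply: le_trans (sum_subset _) _; first by move=> I _; exact: sqr_ge0.
  apply: le_trans y_sqr_sum _; apply: ler_wpM2r; first exact: ltW.
  by rewrite ler_piMr // exprn_ile1 // ltW.
have S3 : s3 <= delta * M * kap.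
  apply: le_trans (sum_subset _) _.
    by move=> I _; rewrite -[leLHS](avgc T); apply: ler_avg => s; exact: sqr_ge0.
  by rewrite -avg_sum -[leRHS](avgc T); apply: ler_avg => s; exact: a_sqr_sum.
(* Four times this is [kap e M / 4], half of the main term [kap e M / 2]. *)
have S4 : delta * M * kap <= e / 16 * M * kap.
  by rewrite !ler_pM2r.
move: S1 S2 S3; set s1 := \sum_(I | G I) _; set s2 := \sum_(I | G I) _.
move=> S1 S2 S3.
have S5 : M / 2 * (1 + slope) <= (1 + slope) *+ #|G|.
  by rewrite -[(1 + slope) *+ _]mulr_natl; apply: ler_wpM2r => //; rewrite addr_ge0.
have S6 : M / 2 <= (1 + slope) *+ #|G| - beta * s1 - 4 * beta ^+ 2 * kap * s2.
  have T1 := ler_wpM2l (ltW beta_gt0) S1.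
  have k4 : 0 <= 4 * beta ^+ 2 * kap by rewrite !mulr_ge0 ?sqr_ge0 // ltW.
  have T2 := ler_wpM2l k4 S2.
  move: S5 T1 T2; rewrite /slope; lra.
have T6 := ler_wpM2l (mulr_ge0 (ltW kap_gt0) (ltW e0)) S6.
lra.
Qed.

Let sum_hresp : mu <= \sum_(I | G I) hresp I.
Proof.
apply: (@le_trans _ _ (\sum_(I | G I) beta * tau / 4 * bracket I)); last first.
  by apply: ler_sum => I; exact: hresp_ge.
rewrite -mulr_sumr.
have c0 : 0 <= beta * tau / 4 by rewrite divr_ge0 // mulr_ge0 // ltW.
apply: le_trans (ler_wpM2l c0 sum_bracket).
by rewrite /mu /rate /tau le_eqVlt; apply/orP; left; apply/eqP; field.
Qed.

Definition weighted s : RR := - \sum_(I | G I) sgnc RR s I * theta I * a I (act s x).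

Let Rdiff s : RR := F (act s x) - F (act s y).

Let sum_shift (f : T -> RR) s : \sum_(I | D I) (act s y I - act s x I) * f I =
  - tau * \sum_(I | G I) sgnc RR s I * theta I * f I.
Proof.
rewrite (bigID G) /= [X in _ + X]big1 ?addr0; last first.
  by move=> I /andP[_ /negPf nG]; rewrite /act /y nG subrr mul0r.
rewrite (eq_bigl G); last by move=> I; case: (boolP (G I)) => [/GD ->|]; rewrite ?andbF.
by rewrite mulr_sumr; apply: eq_bigr => I GI; rewrite /act /y GI; ring.
Qed.

Let Rdiff_le s : Rdiff s <= beta * tau * weighted s.
Proof.
have := F_ge (act s x) (act s y); rewrite sum_shift /Rdiff /weighted.
move: (F _) (F _) (\sum_(I | G I) _) => f1 f2 w; lra.
Qed.

Let Rdiff_ge s : beta * tau * (\sum_(I | G I) - (sgnc RR s I * theta I * a I (act s y))) <= Rdiff s.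
Proof.
have := F_ge (act s y) (act s x).
rewrite (eq_bigr (fun I => - ((act s y I - act s x I) * a I (act s y)))); last first.
  by move=> I _; ring.
rewrite sumrN sum_shift /Rdiff sumrN.
move: (F _) (F _) (\sum_(I | G I) _) => f1 f2 w; lra.
Qed.

Let avg_Rdiff : beta * tau * mu <= avg Rdiff.
Proof.
apply: (@le_trans _ _ (beta * tau * \sum_(I | G I) hresp I)).
  by apply: ler_wpM2l; [rewrite mulr_ge0 // ltW | exact: sum_hresp].
by rewrite -avg_sum -avgZ; apply: ler_avg => s; exact: Rdiff_ge.
Qed.

(** The gradient bound [|a I v| <= 1], from [kap <= 1], is used at both ends of the flip through
    [F_ge]. *)
Let F_diff (z : T -> RR) s I :
  `|F (act s z) - F (act (tog I s) z)| <= if D I then 2 * beta * `|z I| else 0.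
Proof.
have [E1 E2] := act_tog z I s.
have key v v' : (forall K, K != I -> v' K = v K) -> v' I = - v I -> `|v I| = `|z I| ->
    F v - (if D I then 2 * beta * `|z I| else 0) <= F v'.
  move=> H1 H2 H3; apply: le_trans (F_ge v v'); rewrite lerD2l lerN2.
  have [DI|DI] := boolP (D I); last first.
    rewrite big1 ?mulr0 // => K DK; rewrite H1 ?subrr ?mul0r //.
    by apply/eqP => KI; move: DI; rewrite -KI DK.
  rewrite (bigD1 I) //= big1 ?addr0; last by move=> K /andP[_ KI]; rewrite H1 // subrr mul0r.
  rewrite H2 (_ : 2 * beta * `|z I| = beta * (2 * `|z I|)); last by ring.
  apply: ler_wpM2l; first exact: ltW.
  have a1 : `|a I v| <= 1.
    rewrite -(ler_pXn2r (n := 2)) ?nnegrE // expr1n real_normK ?num_real //.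
    exact: le_trans (a_bound v DI) kap_le1.
  apply: le_trans (ler_norm _) _; rewrite normrM.
  rewrite (_ : - v I - v I = - 2 * v I); last by ring.
  rewrite normrM normrN (ger0_norm (ler0n RR 2)) H3 -[leRHS]mulr1.
  by apply: ler_wpM2l => //; rewrite mulr_ge0.
have N1 : `|act s z I| = `|z I| by rewrite /act normrM normr_sgnc mul1r.
have K1 := key (act s z) (act (tog I s) z) E2 E1 N1.
have K2 : F (act (tog I s) z) - (if D I then 2 * beta * `|z I| else 0) <= F (act s z).
  apply: key => [K KI||]; first by rewrite E2.
    by rewrite E1 opprK.
  by rewrite E1 normrN.
by rewrite ler_norml; move: K1 K2; move: (F _) (F _) (if _ then _ else _) => f1 f2 c K1 K2; apply/andP; split; lra.
Qed.

Let Rdiff_var : avg (fun s => (Rdiff s - avg Rdiff) ^+ 2) <= 4 * beta ^+ 2 * C0 * sig ^+ 2 * M.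
Proof.
apply: le_trans (cube_var (d := fun I => if D I then 4 * beta * `|x I| else 0) _) _.
  move=> s I; rewrite /Rdiff.
  have := F_diff x s I; have := F_diff y s I.
  have yx : `|y I| <= `|x I|.
    by rewrite -(ler_pXn2r (n := 2)) ?nnegrE // !real_normK ?num_real.
  rewrite (_ : F (act s x) - F (act s y) - (F (act (tog I s) x) - F (act (tog I s) y)) =
    (F (act s x) - F (act (tog I s) x)) - (F (act s y) - F (act (tog I s) y))); last by ring.
  move=> H1 H2; apply: le_trans (ler_normB _ _) _; apply: le_trans (lerD H2 H1) _.
  case: (D I); last by rewrite addr0.
  have := ler_wpM2l (ltW beta_gt0) yx; lra.
rewrite (eq_bigr (fun I => if D I then 16 * beta ^+ 2 * x I ^+ 2 else 0)); last first.
  move=> I _; case: (D I); last by rewrite expr0n.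
  by rewrite !exprMn real_normK ?num_real //; ring.
rewrite -big_mkcond -mulr_sumr.
have b2 : 0 <= 4 * beta ^+ 2 by rewrite mulr_ge0 ?sqr_ge0.
have := ler_wpM2l b2 x_sqr_sum; lra.
Qed.

(** If the weighted sum is at most [mu / 2], then by convexity [Rdiff] falls short of its mean by at
    least [beta * tau * mu / 2]. *)
Let weighted_pr : pr RR (fun s => weighted s <= mu / 2) <=
  4 * beta ^+ 2 * C0 * sig ^+ 2 * M / (beta * tau * mu / 2) ^+ 2.
Proof.
have mu0 : 0 < mu := mu_gt0.
have r0 : 0 < beta * tau * mu / 2 by rewrite divr_gt0 // (mulr_gt0 _ mu0) // mulr_gt0.
apply: le_trans (le_trans (cube_chebyshev Rdiff (avg Rdiff) r0) _); last first.
  by apply: ler_wpM2r; rewrite ?invr_ge0 ?sqr_ge0 ?Rdiff_var.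
apply: pr_le => s Ws; rewrite distrC; apply: le_trans (ler_norm _).
have bt : 0 <= beta * tau by rewrite mulr_ge0 // ltW.
have := ler_wpM2l bt Ws; have := Rdiff_le s; have := avg_Rdiff.
move: (avg Rdiff) (Rdiff s) => c d; lra.
Qed.

(** Here [b] stands for the correlations of the other instance, which are constant in [s]; the sum
    is then a centered sum of independent signs. *)
Let cross_pr (b : T -> RR) : (forall I, D I -> b I ^+ 2 <= 1) ->
  pr RR (fun s => mu / 4 <= `|\sum_(I | G I) sgnc RR s I * theta I * b I|) <=
  M / (mu / 4) ^+ 2.
Proof.
move=> b1; have mu0 : 0 < mu := mu_gt0.
set V := fun s : {ffun T -> bool} => \sum_(I | G I) sgnc RR s I * theta I * b I.
have V0 : avg V = 0.
  rewrite /V avg_sum big1 // => I _.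
  rewrite (eq_avg (g := fun s => sgnc RR s I * (theta I * b I))); last by move=> s; rewrite mulrA.
  by rewrite avg_sgnc -[RHS](avgc T); apply: eq_avg => s; rewrite subrr mulr0 mul0r.
rewrite (_ : pr RR _ = pr RR (fun s => mu / 4 <= `|V s - 0|)); last first.
  by congr pr; apply/funext => s; rewrite subr0.
apply: le_trans (cube_chebyshev V 0 _) _; first by rewrite divr_gt0.
apply: ler_wpM2r; first by rewrite invr_ge0 sqr_ge0.
have -> : avg (fun s => (V s - 0) ^+ 2) = avg (fun s => (V s - avg V) ^+ 2) by rewrite V0.
apply: le_trans (cube_var (d := fun I => if D I then 2 else 0) _) _.
  move=> s I; rewrite /V -sumrB.
  have [GI|nG] := boolP (G I).
    rewrite (GD GI) (bigD1 I) //= big1 ?addr0; last first.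
      by move=> K /andP[_ KI]; rewrite sgnc_tog_neq // subrr.
    rewrite sgnc_tog (_ : _ - _ = 2 * (sgnc RR s I * (theta I * b I))); last by ring.
    rewrite normrM (ger0_norm (ler0n RR 2)) -[leRHS]mulr1; apply: ler_wpM2l => //.
    rewrite normrM normr_sgnc mul1r -(ler_pXn2r (n := 2)) ?nnegrE // expr1n real_normK ?num_real //.
    by rewrite exprMn theta_sqr // mul1r b1 // GD.
  rewrite big1 ?normr0; first by case: (D I).
  move=> K GK; rewrite sgnc_tog_neq ?subrr //.
  by apply/eqP => KI; move: nG; rewrite -KI GK.
rewrite (eq_bigr (fun I => if D I then 4 else 0)); last first.
  by move=> I _; case: (D I); rewrite ?expr0n // expr2 -natrM.
rewrite -big_mkcond sumr_const -mulr_natl; lra.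
Qed.

(** Outside the two exceptional events the weighted sum exceeds [mu / 2] and the cross sum is below
    [mu / 4] in absolute value, so the differences, tested against signs, sum to more than
    [mu / 4]. *)
Lemma flip_deviation (b : T -> RR) : (forall I, D I -> b I ^+ 2 <= 1) ->
  pr RR (fun s => \sum_(I | D I) `|a I (act s x) - b I| < mu / 4) <=
  (64 * C0 / eta ^+ 2 + 16) / rate ^+ 2 / (sig ^+ 2 * M).
Proof.
move=> b1; apply: (@le_trans _ _ (4 * beta ^+ 2 * C0 * sig ^+ 2 * M / (beta * tau * mu / 2) ^+ 2
    + M / (mu / 4) ^+ 2)); last first.
  have r0 := rate_gt0; rewrite /mu /tau le_eqVlt; apply/orP; left; apply/eqP.
  by field; rewrite !gt_eqF.
apply: le_trans (lerD weighted_pr (cross_pr b1)).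
apply: le_trans (pr_or _ _ _); apply: pr_le => s H.
rewrite -implyNb -ltNge; apply/implyP => W; rewrite leNgt; apply/negP => V.
move: H; rewrite ltNge => /negP; apply.
apply: (@le_trans _ _ (\sum_(I | G I) `|a I (act s x) - b I|)); last first.
  by apply: ler_sum_pred.
apply: (@le_trans _ _ (\sum_(I | G I) - (sgnc RR s I * theta I * (a I (act s x) - b I)))); last first.
  apply: ler_sum => I GI; apply: le_trans (ler_norm _) _.
  rewrite normrN normrM -[leRHS]mul1r; apply: ler_wpM2r => //.
  rewrite normrM normr_sgnc mul1r -(ler_pXn2r (n := 2)) ?nnegrE // expr1n real_normK ?num_real //.
  by rewrite theta_sqr.
rewrite (eq_bigr (fun I => - (sgnc RR s I * theta I * a I (act s x)) + sgnc RR s I * theta I * b I)); last first.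
  by move=> I _; ring.
rewrite big_split /= sumrN -/(weighted s).
move: V W; rewrite ltr_norml => /andP[]; move: (weighted s) (\sum_(I | G I) _) => w v; lra.
Qed.

End Weights.
End SignCube.

(** * Measurability *)

Section ComplexMeasurable.
Context {d : measure_display} {T : measurableType d}.
Implicit Types (f g : T -> CC) (h : T -> RR).

Definition cmeas f := measurable_fun [set: T] (fun w => cRe (f w) : RM) /\
  measurable_fun [set: T] (fun w => cIm (f w) : RM).

Lemma cmeas_cst (c : CC) : cmeas (fun=> c).
Proof. by split; exact: measurable_cst. Qed.

Lemma cmeas_real h : measurable_fun [set: T] (h : T -> RM) -> cmeas (fun w => (h w)%:C).
Proof. by move=> mh; split => //; exact: measurable_cst. Qed.

Lemma cmeasD f g : cmeas f -> cmeas g -> cmeas (fun w => f w + g w).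
Proof.
move=> [f1 f2] [g1 g2]; split.
- by under eq_fun do rewrite cReD; exact: measurable_funD.
- by under eq_fun do rewrite cImD; exact: measurable_funD.
Qed.

Lemma cmeasM f g : cmeas f -> cmeas g -> cmeas (fun w => f w * g w).
Proof.
move=> [f1 f2] [g1 g2]; split.
- rewrite (_ : (fun w => _) = (fun w => cRe (f w) * cRe (g w) - cIm (f w) * cIm (g w))).
    by apply: measurable_funB; exact: measurable_funM.
  by apply/funext => w; case: (f w) => a b; case: (g w).
- rewrite (_ : (fun w => _) = (fun w => cRe (f w) * cIm (g w) + cIm (f w) * cRe (g w))).
    by apply: measurable_funD; exact: measurable_funM.
  by apply/funext => w; case: (f w) => a b; case: (g w).
Qed.

Lemma cmeasB f g : cmeas f -> cmeas g -> cmeas (fun w => f w - g w).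
Proof.
move=> mf mg; rewrite (_ : (fun w => _) = (fun w => f w + (-1) * g w)).
  by apply: cmeasD => //; apply: cmeasM => //; exact: cmeas_cst.
by apply/funext => w; rewrite mulN1r.
Qed.

Lemma cmeas_sum (I : Type) (r : seq I) (P : pred I) (F : I -> T -> CC) :
  (forall i, P i -> cmeas (F i)) -> cmeas (fun w => \sum_(i <- r | P i) F i w).
Proof.
move=> mF; elim: r => [|i r IH].
  by under eq_fun do rewrite big_nil; exact: cmeas_cst.
under eq_fun do rewrite big_cons; case: (boolP (P i)) => // Pi.
by apply: cmeasD => //; exact: mF.
Qed.

Lemma measurable_nsq f : cmeas f -> measurable_fun [set: T] (fun w => nsq (f w) : RM).
Proof. by move=> [f1 f2]; apply: measurable_funD; exact: measurable_funX. Qed.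

Lemma measurable_normc f : cmeas f ->
  measurable_fun [set: T] (fun w => ComplexField.Normc.normc (f w) : RM).
Proof.
move=> mf; rewrite (_ : (fun w => _) = (fun w => powR (nsq (f w)) 2^-1)).
  exact: (measurableT_comp (measurable_powR 2^-1) (measurable_nsq mf)).
by apply/funext => w; rewrite powR12_sqrt ?nsq_ge0 //; case: (f w).
Qed.

Lemma cmeasV f : cmeas f -> cmeas (fun w => (f w)^-1).
Proof.
move=> mf; have mi : measurable_fun [set: T] (fun w => powR (nsq (f w)) (-1) : RM).
  exact: (measurableT_comp (measurable_powR (-1)) (measurable_nsq mf)).
have E w : (f w)^-1 = (cRe (f w) * powR (nsq (f w)) (-1)) -i* (cIm (f w) * powR (nsq (f w)) (-1)).
  by rewrite powR_inv1 ?nsq_ge0 //; case: (f w).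
case: mf => f1 f2; split; under eq_fun do rewrite E /=.
- exact: measurable_funM.
- by apply: measurable_funN; exact: measurable_funM.
Qed.

Lemma measurable_bigmaxr (I : Type) (r : seq I) (P : pred I) (F : I -> T -> RR) :
  (forall i, P i -> measurable_fun [set: T] (F i : T -> RM)) ->
  measurable_fun [set: T] (fun w => \big[Num.max/0]_(i <- r | P i) F i w : RM).
Proof.
move=> mF; elim: r => [|i r IH].
  by under eq_fun do rewrite big_nil; exact: measurable_cst.
under eq_fun do rewrite big_cons; case: (boolP (P i)) => // Pi.
by apply: measurable_maxr => //; exact: mF.
Qed.

Section Matrices.
Variable N : nat.
Implicit Types (A B : T -> 'M[CC]_N).

Definition mxmeas A := forall a b, cmeas (fun w => A w a b).

Lemma mxmeas_cst (X : 'M[CC]_N) : mxmeas (fun=> X).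
Proof. by move=> a b; exact: cmeas_cst. Qed.

Lemma mxmeasM A B : mxmeas A -> mxmeas B -> mxmeas (fun w => A w *m B w).
Proof.
move=> mA mB a b; under eq_fun do rewrite mxE.
by apply: cmeas_sum => i _; apply: cmeasM.
Qed.

Lemma mxmeasZ f A : cmeas f -> mxmeas A -> mxmeas (fun w => f w *: A w).
Proof. by move=> mf mA a b; under eq_fun do rewrite mxE; exact: cmeasM. Qed.

Lemma mxmeas_sum (I : Type) (r : seq I) (P : pred I) (F : I -> T -> 'M[CC]_N) :
  (forall i, P i -> mxmeas (F i)) -> mxmeas (fun w => \sum_(i <- r | P i) F i w).
Proof.
move=> mF a b; under eq_fun do rewrite summxE.
by apply: cmeas_sum => i Pi; exact: mF.
Qed.

Lemma cmeas_tr A : mxmeas A -> cmeas (fun w => \tr (A w)).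
Proof. by move=> mA; apply: cmeas_sum => i _. Qed.

(** A pointwise limit of polynomials in [A]; Hermiticity supplies the convergence through
    [cvg_expm_partial]. *)
Lemma mxmeas_expm A : (forall w, adjmx (A w) = A w) -> mxmeas A -> mxmeas (fun w => expm (A w)).
Proof.
move=> hA mA.
have mp k : mxmeas (fun w => expm_partial (A w) k).
  apply: mxmeas_sum => i _; apply: mxmeasZ; first exact: cmeas_cst.
  elim: (nat_of_ord i) => [|j IH] /=; first exact: mxmeas_cst.
  exact: mxmeasM.
move=> a b; split.
- under eq_fun do rewrite mxE /=.
  apply: (@measurable_fun_cvg _ _ _ _ (fun k w => cRe (expm_partial (A w) k a b))).
    by move=> k; case: (mp k a b).
  by move=> w _; have [] := cvg_expm_partial a b (hA w).
- under eq_fun do rewrite mxE /=.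
  apply: (@measurable_fun_cvg _ _ _ _ (fun k w => cIm (expm_partial (A w) k a b))).
    by move=> k; case: (mp k a b).
  by move=> w _; have [] := cvg_expm_partial a b (hA w).
Qed.
End Matrices.

Lemma measurable_max_dev n q (psi : 'I_n -> 'M[CC]_(2 ^ n./2)) (beta : RR)
    (v v' : T -> {set 'I_n} -> RR) : ~~ odd q -> is_majorana psi ->
  (forall I : {set 'I_n}, #|I| == q -> measurable_fun [set: T] (fun w => v w I : RM)) ->
  (forall I : {set 'I_n}, #|I| == q -> measurable_fun [set: T] (fun w => v' w I : RM)) ->
  measurable_fun [set: T] (fun w => max_dev q psi (gibbs beta (SYK_H q psi (v w)))
     (gibbs beta (SYK_H q psi (v' w))) : RM).
Proof.
move=> oq mpsi mv mv'.
have key u : (forall I : {set 'I_n}, #|I| == q -> measurable_fun [set: T] (fun w => u w I : RM)) ->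
    mxmeas (fun w => gibbs beta (SYK_H q psi (u w))).
  move=> mu; have mH : mxmeas (fun w => genH q psi beta (u w)).
    apply: mxmeasZ; first exact: cmeas_cst.
    apply: mxmeas_sum => I cI; apply: mxmeasZ; last exact: mxmeas_cst.
    by apply: cmeas_real; exact: mu.
  have mE := mxmeas_expm (fun w => genH_adj beta oq mpsi (u w)) mH.
  by apply: mxmeasZ => //; apply: cmeasV; exact: cmeas_tr.
apply: measurable_bigmaxr => I cI; apply: measurable_normc.
apply: cmeasB; apply: cmeas_tr; apply: mxmeasM; try exact: mxmeas_cst.
- exact: key.
- exact: key.
Qed.

End ComplexMeasurable.

(** * Gaussian couplings *)

Section NormalIntegral.
Local Open Scope ereal_scope.
Variable (R : realType).
Variable sigma : R.
Local Notation mu := (@lebesgue_measure R).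
Local Notation nu := (normal_prob 0 sigma).
Local Notation pdf := (normal_pdf 0 sigma).

Let mpdf : measurable_fun [set: measurableTypeR R] (fun x => (pdf x)%:E).
Proof. by apply/measurable_EFinP; exact: measurable_normal_pdf. Qed.

Let pdf_ge0 x : 0 <= (pdf x)%:E.
Proof. by rewrite lee_fin normal_pdf_ge0. Qed.

Let indic (E : set (measurableTypeR R)) : measurable E ->
  \int[nu]_x (\1_E x)%:E = \int[mu]_x ((\1_E x)%:E * (pdf x)%:E).
Proof.
move=> mE; rewrite integral_indic // setIT.
transitivity (\int[mu]_(x in E) (pdf x)%:E) => //; rewrite integral_mkcond.
apply: eq_integral => x _; rewrite patchE indicE; case: ifP => _.
  by rewrite mul1e.
by rewrite mul0e.
Qed.

Import HBNNSimple.

Let nnsfun (h : {nnsfun (measurableTypeR R) >-> R}) :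
  \int[nu]_x (h x)%:E = \int[mu]_x ((h x)%:E * (pdf x)%:E).
Proof.
under [LHS]eq_integral do rewrite fimfunE -fsumEFin//.
rewrite [LHS]ge0_integral_fsum//; last 2 first.
  - by move=> r; exact/measurable_EFinP/measurableT_comp.
  - by move=> n x _; rewrite EFinM nnfun_muleindic_ge0.
under [RHS]eq_integral.
  move=> x xD; rewrite fimfunE -fsumEFin// muleC ge0_mule_fsumr; last first.
    by move=> r; rewrite EFinM nnfun_muleindic_ge0.
  over.
rewrite [RHS]ge0_integral_fsum//; last 2 first.
  - move=> r; apply: emeasurable_funM => //.
    by apply/measurable_EFinP; apply/measurableT_comp => //.
  - by move=> n x _; rewrite EFinM mule_ge0// nnfun_muleindic_ge0.
apply: eq_fsbigr => r _.
have [r0|r0] := leP 0%R r; last first.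
  have E x : \1_(h @^-1` [set r]) x = 0%R :> R.
    rewrite indicE; apply/eqP; rewrite pnatr_eq0 eqb0; apply/negP; rewrite inE /= => hx.
    by have : (0 <= h x)%R by []; rewrite hx leNgt r0.
  rewrite integral0_eq; last by move=> x _; rewrite E mulr0.
  by rewrite integral0_eq // => x _; rewrite E mulr0 mule0.
under eq_integral do rewrite EFinM.
rewrite ge0_integralZl //; last by apply/measurable_EFinP; exact: measurable_indic.
rewrite indic // -ge0_integralZl //.
- by apply: eq_integral => x _; rewrite EFinM [in RHS]muleCA; congr (_ * _); rewrite muleC.
- by apply: emeasurable_funM => //; apply/measurable_EFinP; exact: measurable_indic.
- by move=> x _; rewrite mule_ge0 // lee_fin.
Qed.

(** Integration against a density: indicators, then simple functions, then monotone limits. *)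
Lemma ge0_integral_normal_prob (f : measurableTypeR R -> \bar R) :
  measurable_fun [set: measurableTypeR R] f -> (forall x, 0 <= f x) ->
  \int[nu]_x f x = \int[mu]_x (f x * (pdf x)%:E).
Proof.
move=> mf f0; pose f_ := nnsfun_approx measurableT mf.
transitivity (limn (fun n => \int[nu]_x (f_ n x)%:E)).
  rewrite -monotone_convergence//=.
  - apply: eq_integral => x _; apply/esym/cvg_lim => //=.
    exact: cvg_nnsfun_approx.
  - by move=> n; apply/measurable_EFinP.
  - by move=> n x _; rewrite lee_fin.
  - by move=> x _ a b ab; rewrite lee_fin//; exact/lefP/nd_nnsfun_approx.
under eq_fun do rewrite nnsfun.
rewrite -monotone_convergence//=.
- apply: eq_integral => x _; apply/cvg_lim => //=.
  apply: cvgeZr => //; exact: cvg_nnsfun_approx.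
- by move=> n; apply: emeasurable_funM => //; apply/measurable_EFinP.
- by move=> n x _; rewrite mule_ge0 // lee_fin.
- move=> x _ a b ab; apply: lee_wpmul2r => //.
  by rewrite lee_fin; exact/lefP/nd_nnsfun_approx.
Qed.

End NormalIntegral.

(** * Second-moment tail bounds *)

Section Moments.
Context {d : measure_display} {T : measurableType d}.
Variable P : probability T RR.

Lemma integral_real (f : T -> RR) (c : RR) : measurable_fun [set: T] (f : T -> RM) ->
  (forall w, 0 <= f w) -> (\int[P]_w (f w)%:E <= c%:E)%E ->
  exists e : RR, [/\ 0 <= e, e <= c & (\int[P]_w (f w)%:E = e%:E)%E].
Proof.
move=> mf f0 fc; have i0 : (0 <= \int[P]_w (f w)%:E)%E.
  by apply: integral_ge0 => w _; rewrite lee_fin.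
have fin : (\int[P]_w (f w)%:E)%E \is a fin_num.
  by rewrite ge0_fin_numE //; apply: le_lt_trans fc _; rewrite ltry.
exists (fine (\int[P]_w (f w)%:E)%E); rewrite fineK //; split => //.
  exact: fine_ge0.
by rewrite -lee_fin fineK.
Qed.

Lemma measurable_normr_comp (f : T -> RR) : measurable_fun [set: T] (f : T -> RM) ->
  measurable_fun [set: T] ((fun w => `|f w|) : T -> RM).
Proof. by move=> mf; exact: (measurableT_comp (@normr_measurable _ setT) mf). Qed.

Lemma measurable_ler_set (f g : T -> RR) : measurable_fun [set: T] (f : T -> RM) ->
  measurable_fun [set: T] (g : T -> RM) -> measurable [set w | (f w <= g w)%R].
Proof.
move=> mf mg; rewrite -[X in measurable X]setTI.
exact: (measurable_fun_ler mf mg measurableT (Y := [set true])).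
Qed.

Lemma markov_sqr (f : T -> RR) (r c : RR) : measurable_fun [set: T] (f : T -> RM) ->
  0 < r -> (\int[P]_w ((f w) ^+ 2)%:E <= c%:E)%E ->
  (P [set w | (r <= `|f w|)%R] <= (c / r ^+ 2)%:E)%E.
Proof.
move=> mf r0 fc; set A := [set w | _].
have mA : measurable A.
  by apply: measurable_ler_set; [exact: measurable_cst | exact: measurable_normr_comp].
have r2 : 0 < r ^+ 2 by rewrite exprn_gt0.
have H : ((r ^+ 2)%:E * P A <= c%:E)%E.
  apply: le_trans fc.
  have -> : (P A = \int[P]_w (\1_A w)%:E)%E by rewrite integral_indic // setIT.
  rewrite -ge0_integralZl //; try by [rewrite lee_fin ltW | move=> w _; rewrite lee_fin
    | apply/measurable_EFinP; exact: measurable_indic].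
  apply: ge0_le_integral => //.
  - by move=> w _; rewrite -EFinM lee_fin mulr_ge0 ?sqr_ge0.
  - by apply/measurable_EFinP; apply: measurable_funM => //; exact: measurable_indic.
  - by apply/measurable_EFinP; exact: measurable_funX.
  - move=> w _; rewrite -EFinM lee_fin indicE; have [Aw|nA] := boolP (w \in A).
      rewrite mulr1 -[leRHS]real_normK ?num_real // ler_pXn2r ?nnegrE ?(ltW r0) //.
      exact: (set_mem Aw).
    by rewrite mulr0 sqr_ge0.
by rewrite EFinM lee_pdivlMr // muleC.
Qed.

Lemma measurable_sum_cond (I : Type) (r : seq I) (D : pred I) (F : I -> T -> RR) :
  (forall i, D i -> measurable_fun [set: T] (F i : T -> RM)) ->
  measurable_fun [set: T] ((fun w => \sum_(i <- r | D i) F i w) : T -> RM).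
Proof.
move=> mF; elim: r => [|i r IH].
  by under eq_fun do rewrite big_nil; exact: measurable_cst.
under eq_fun do rewrite big_cons; case: (boolP (D i)) => // Di.
by apply: measurable_funD => //; exact: mF.
Qed.

Lemma integral_sum_cond (I : Type) (r : seq I) (D : pred I) (F : I -> T -> RR) :
  (forall i, D i -> measurable_fun [set: T] (F i : T -> RM)) ->
  (forall i w, 0 <= F i w) ->
  (\int[P]_w (\sum_(i <- r | D i) F i w)%:E = \sum_(i <- r | D i) \int[P]_w (F i w)%:E)%E.
Proof.
move=> mF F0; elim: r => [|i r IH].
  by rewrite big_nil integral0_eq // => w _; rewrite big_nil.
rewrite big_cons; case: (boolP (D i)) => Di; last first.
  by rewrite -IH; apply: eq_integral => w _; rewrite big_cons (negPf Di).
rewrite -IH -ge0_integralD //.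
- by apply: eq_integral => w _; rewrite big_cons Di.
- by move=> w _; rewrite lee_fin.
- by apply/measurable_EFinP; exact: mF.
- by move=> w _; rewrite lee_fin sumr_ge0.
- by apply/measurable_EFinP; exact: measurable_sum_cond.
Qed.

(** Only upper bounds on the moments are assumed: the variance is taken about the true means [e i],
    and [m1] enters only when [m] is compared with [m1 * M]. *)
Lemma pairwise_chebyshev (I : finType) (D : pred I) (Y : I -> T -> RR) (m1 m2 t : RR) :
  0 < t ->
  (forall i, D i -> measurable_fun [set: T] (Y i : T -> RM)) ->
  (forall i w, 0 <= Y i w) ->
  (forall i, D i -> (\int[P]_w (Y i w)%:E <= m1%:E)%E) ->
  (forall i, D i -> (\int[P]_w ((Y i w) ^+ 2)%:E <= m2%:E)%E) ->
  (forall i j, D i -> D j -> i != j ->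
     (\int[P]_w (Y i w * Y j w)%:E = \int[P]_w (Y i w)%:E * \int[P]_w (Y j w)%:E)%E) ->
  (0 < #|D|)%N ->
  (P [set w | (((m1 + t) * #|D|%:R)%R <= \sum_(i | D i) Y i w)%R] <= (m2 / (t ^+ 2 * #|D|%:R))%:E)%E.
Proof.
move=> t0 mY Y0 Y1 Y2 ind D0; set M := #|D|%:R : RR.
have M0 : 0 < M by rewrite ltr0n.
have /boolp.choice [e eP] : forall i, exists e : RR, D i ->
    [/\ 0 <= e, e <= m1 & (\int[P]_w (Y i w)%:E = e%:E)%E].
  move=> i; have [Di|nD] := boolP (D i); last by exists 0.
  by have [e ?] := integral_real (mY i Di) (Y0 i) (Y1 i Di); exists e.
pose S w := \sum_(i | D i) Y i w.
pose m := \sum_(i | D i) e i.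
have mS : measurable_fun [set: T] (S : T -> RM) by exact: measurable_sum_cond.
have S0 w : 0 <= S w by apply: sumr_ge0.
have IS : (\int[P]_w (S w)%:E = m%:E)%E.
  rewrite integral_sum_cond // /m -sumEFin; apply: eq_bigr => i Di.
  by case: (eP i Di).
have IS2 : (\int[P]_w (S w ^+ 2)%:E <= (m ^+ 2 + M * m2)%:E)%E.
  have -> : (\int[P]_w (S w ^+ 2)%:E =
      \sum_(i | D i) \sum_(j | D j) \int[P]_w (Y i w * Y j w)%:E)%E.
    under [RHS]eq_bigr => i Di.
      rewrite -integral_sum_cond; last 2 first.
      - by move=> j Dj; apply: measurable_funM; exact: mY.
      - by move=> j w; rewrite mulr_ge0.
      over.
    rewrite -integral_sum_cond.
    - apply: eq_integral => w _; rewrite /S expr2 mulr_suml; congr (_%:E).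
      by apply: eq_bigr => i _; rewrite mulr_sumr.
    - move=> i Di; apply: measurable_sum_cond => j Dj.
      by apply: measurable_funM; exact: mY.
    - by move=> i w; apply: sumr_ge0 => j _; rewrite mulr_ge0.
  apply: (@le_trans _ _ (\sum_(i | D i) \sum_(j | D j)
      (e i * e j + (if i == j then m2 else 0))%:E)%E).
    apply: lee_sum => i Di; apply: lee_sum => j Dj.
    have [ei0 _ ei] := eP i Di; have [_ _ ej] := eP j Dj.
    have [ij|ij] := eqVneq i j.
      rewrite -ij; apply: le_trans (Y2 i Di) _.
      by rewrite lee_fin lerDr mulr_ge0.
    by rewrite ind // ei ej addr0 EFinM.
  under eq_bigr do rewrite sumEFin.
  rewrite sumEFin lee_fin le_eqVlt; apply/orP; left; apply/eqP.
  under eq_bigr do rewrite big_split -mulr_sumr /=.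
  rewrite big_split -mulr_suml /= -/m expr2; congr (_ + _).
  rewrite /M mulr_natl -sumr_const; apply: eq_bigr => i Di.
  by rewrite (bigD1 i) //= eqxx big1 ?addr0 // => j /andP[_ /negPf]; rewrite eq_sym => ->.
have m_le : m <= m1 * M.
  rewrite /m /M mulr_natr -sumr_const; apply: ler_sum => i Di; by case: (eP i Di).
have m0 : 0 <= m by apply: sumr_ge0 => i Di; case: (eP i Di).
have mSm : measurable_fun [set: T] ((fun w => S w - m) : T -> RM).
  by apply: measurable_funB => //; exact: measurable_cst.
have V : (\int[P]_w ((S w - m) ^+ 2)%:E <= (M * m2)%:E)%E.
  (* The expansion of the square is arranged as [(S - m)^2 + 2mS = S^2 + m^2], with nonnegative
     terms only, so that integrals add without integrability conditions. *)
  have E : (\int[P]_w ((S w - m) ^+ 2)%:E + (2 * m * m)%:E = \int[P]_w (S w ^+ 2)%:E + (m ^+ 2)%:E)%E.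
    have -> : ((2 * m * m)%:E = \int[P]_w (2 * m * S w)%:E)%E.
      under eq_integral do rewrite EFinM; rewrite ge0_integralZl // ?IS //.
      - by apply/measurable_EFinP.
      - by move=> w _; rewrite lee_fin.
      - by rewrite lee_fin mulr_ge0.
    have -> : ((m ^+ 2)%:E = \int[P]_w (cst (m ^+ 2)%:E) w)%E.
      by rewrite integral_cst // -[LHS]mule1; congr (_ * _)%E; apply/esym; exact: probability_setT.
    rewrite -!ge0_integralD //.
    - by apply: eq_integral => w _; rewrite -!EFinD; congr (_%:E); ring.
    - by move=> w _; rewrite lee_fin sqr_ge0.
    - by apply/measurable_EFinP; exact: measurable_funX.
    - by move=> w _; rewrite lee_fin sqr_ge0.
    - by move=> w _; rewrite lee_fin sqr_ge0.
    - by apply/measurable_EFinP; exact: measurable_funX.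
    - by move=> w _; rewrite lee_fin !mulr_ge0.
    - by apply/measurable_EFinP; apply: measurable_funM => //; exact: measurable_cst.
  rewrite -(leeD2rE _ _ (x := (2 * m * m)%:E)) // E.
  apply: le_trans (leeD IS2 (lexx _)) _; rewrite -!EFinD lee_fin; lra.
have := markov_sqr mSm (mulr_gt0 t0 M0) V.
have -> : M * m2 / (t * M) ^+ 2 = m2 / (t ^+ 2 * M) by field; rewrite !gt_eqF.
apply: le_trans; apply: le_measure; rewrite ?inE.
- by apply: measurable_ler_set => //; exact: measurable_cst.
- by apply: measurable_ler_set; [exact: measurable_cst | exact: measurable_normr_comp].
- move=> w /= H; apply: le_trans (ler_norm _); rewrite -/(S w) in H; lra.
Qed.
End Moments.

Section Pairs.
Context {d : measure_display} {T : measurableType d}.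
Variable P : probability T RR.

(** The joint law agrees with the product measure on rectangles, hence everywhere; Tonelli does the
    rest. *)
Lemma integral_indep_pair (X Y : {RV P >-> RM}) (g h : RR -> RR) :
  (forall A B : set RM, measurable A -> measurable B ->
     P (X @^-1` A `&` Y @^-1` B) = (P (X @^-1` A) * P (Y @^-1` B))%E) ->
  measurable_fun [set: RM] (g : RM -> RM) -> measurable_fun [set: RM] (h : RM -> RM) ->
  (forall x, 0 <= g x) -> (forall x, 0 <= h x) ->
  (\int[P]_w (g (X w) * h (Y w))%:E = \int[P]_w (g (X w))%:E * \int[P]_w (h (Y w))%:E)%E.
Proof.
move=> ind mg mh g0 h0.
pose Z w := (X w, Y w).
have mZ : measurable_fun [set: T] (Z : T -> (RM * RM)%type).
  by apply/measurable_fun_pairP; split; exact: measurable_funP.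
pose f (z : RM * RM) : \bar RR := (g z.1 * h z.2)%:E.
have mf : measurable_fun [set: RM * RM] f.
  apply/measurable_EFinP; apply: measurable_funM.
    exact: (measurableT_comp mg measurable_fst).
  exact: (measurableT_comp mh measurable_snd).
have f0 z : (0 <= f z)%E by rewrite lee_fin mulr_ge0.
have -> : (\int[P]_w (g (X w) * h (Y w))%:E = \int[pushforward P Z]_z f z)%E.
  by rewrite ge0_integral_pushforward.
have E := @product_measure_unique _ _ _ _ _ (distribution P X) (distribution P Y)
   (pushforward P Z) ind.
rewrite (eq_measure_integral (distribution P X \x distribution P Y)%E); last first.
  by move=> A mA _; apply/esym; exact: E.
rewrite fubini_tonelli1 //.
have mgE : measurable_fun [set: RM] (fun x : RM => (g x)%:E) by apply/measurable_EFinP.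
have mhE : measurable_fun [set: RM] (fun x : RM => (h x)%:E) by apply/measurable_EFinP.
have gP : (\int[P]_w (g (X w))%:E = \int[distribution P X]_x (g x)%:E)%E.
  by rewrite ge0_integral_distribution // => y; rewrite lee_fin.
have hP : (\int[P]_w (h (Y w))%:E = \int[distribution P Y]_x (h x)%:E)%E.
  by rewrite ge0_integral_distribution // => y; rewrite lee_fin.
rewrite gP hP /fubini_F /f /=.
set H := (\int[distribution P Y]_x (h x)%:E)%E.
have H0 : (0 <= H)%E by apply: integral_ge0 => y _; rewrite lee_fin.
have inner x : (\int[distribution P Y]_y (g x * h y)%:E = (g x)%:E * H)%E.
  under eq_integral do rewrite EFinM.
  by rewrite ge0_integralZl // => [y _|]; rewrite lee_fin.
under eq_integral do rewrite inner.
by rewrite ge0_integralZr // => y _; rewrite lee_fin.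
Qed.
End Pairs.

Section NormalMoments.
Variable sig : RR.
Hypothesis sig_gt0 : 0 < sig.

(** Tilting doubles the variance: the left side is [sqrt 2] times the density of variance [2 sig^2],
    and 2 is a crude bound for [sqrt 2]. *)
Lemma expR_mul_normal_pdf (x : RR) :
  expR (x ^+ 2 / (4 * sig ^+ 2)) * normal_pdf 0 sig x <=
  2 * normal_pdf 0 (Num.sqrt 2 * sig) x.
Proof.
have s2 : (Num.sqrt 2 * sig) ^+ 2 = 2 * sig ^+ 2 by rewrite exprMn sqr_sqrtr.
have r2 : 0 < Num.sqrt 2 :> RR by rewrite sqrtr_gt0.
have n1 : sig != 0 by rewrite gt_eqF.
have n2 : Num.sqrt 2 * sig != 0 by rewrite gt_eqF // mulr_gt0.
rewrite /normal_pdf (negPf n1) (negPf n2) /normal_fun /normal_peak s2 !subr0.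
rewrite mulrCA -exp.expRD.
have -> : x ^+ 2 / (4 * sig ^+ 2) + - x ^+ 2 / (sig ^+ 2 *+ 2) = - x ^+ 2 / (2 * sig ^+ 2 *+ 2).
  by field.
rewrite [leRHS]mulrA; apply: ler_wpM2r; first exact: expR_ge0.
have A0 : 0 < sig ^+ 2 * trigo.pi *+ 2 by rewrite mulrn_wgt0 // mulr_gt0 ?exprn_gt0 ?pi_gt0.
have -> : 2 * sig ^+ 2 * trigo.pi *+ 2 = 2 * (sig ^+ 2 * trigo.pi *+ 2) by rewrite mulrnAr mulrA.
rewrite sqrtrM // invfM mulrA ler_peMl ?invr_ge0 ?sqrtr_ge0 //.
rewrite ler_pdivlMr // mul1r -(ler_pXn2r (n := 2)) ?nnegrE ?sqrtr_ge0 // sqr_sqrtr //.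
by lra.
Qed.

Lemma normal_exp_moment :
  (\int[normal_prob 0 sig]_x (expR (x ^+ 2 / (4 * sig ^+ 2)))%:E <= 2%:E)%E.
Proof.
have me : measurable_fun [set: RM] ((fun x : RR => expR (x ^+ 2 / (4 * sig ^+ 2))) : RM -> RM).
  apply: (measurableT_comp (@measurable_expR RR)).
  by apply: measurable_funM; [exact: measurable_funX | exact: measurable_cst].
rewrite ge0_integral_normal_prob; last 2 first.
- exact/measurable_EFinP.
- by move=> x; rewrite lee_fin expR_ge0.
apply: (@le_trans _ _ (\int[lebesgue_measure]_x (2%:E * (normal_pdf 0 (Num.sqrt 2 * sig) x)%:E))%E).
  apply: ge0_le_integral => //.
  - by move=> x _; rewrite -EFinM lee_fin mulr_ge0 ?expR_ge0 ?normal_pdf_ge0.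
  - apply/measurable_EFinP; apply: measurable_funM => //; exact: measurable_normal_pdf.
  - apply/measurable_EFinP; apply: measurable_funM; [exact: measurable_cst|exact: measurable_normal_pdf].
  - by move=> x _; rewrite -!EFinM lee_fin expR_mul_normal_pdf.
rewrite ge0_integralZl //; last 2 first.
- by apply/measurable_EFinP; exact: measurable_normal_pdf.
- by move=> x _; rewrite lee_fin normal_pdf_ge0.
by rewrite integral_normal_pdf mule1.
Qed.

(** Length [sig / 2] times the peak [1 / (sig sqrt(2 pi))], with [sqrt(2 pi) >= 2]. *)
Lemma normal_prob_small : (normal_prob 0 sig [set x | (`|x| <= sig / 4)%R] <= (4^-1)%:E)%E.
Proof.
have -> : [set x : RR | (`|x| <= sig / 4)%R] = `[- (sig / 4), sig / 4].
  by apply/seteqP; split => x /=; rewrite in_itv /= ler_norml.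
rewrite /normal_prob.
apply: (@le_trans _ _ (\int[lebesgue_measure]_(x in `[(- (sig / 4))%R, (sig / 4)%R]) (normal_peak sig)%:E)%E).
  apply: ge0_le_integral => //.
  - by move=> x _; rewrite lee_fin normal_pdf_ge0.
  - by apply/measurable_EFinP; apply: measurable_funTS; exact: measurable_normal_pdf.
  - by move=> x _; rewrite lee_fin normal_pdf_ub // gt_eqF.
rewrite integral_cst //= lebesgue_measure_itv /= lte_fin ifT; last first.
  by rewrite -subr_gt0 opprK addr_gt0 ?divr_gt0.
rewrite -EFinD -EFinM lee_fin /normal_peak.
have -> : sig / 4 - - (sig / 4) = sig / 2 by field.
rewrite -[leRHS]mul1r mulrC ler_pdivrMr; last first.
  by rewrite sqrtr_gt0 mulrn_wgt0 // mulr_gt0 ?exprn_gt0 ?pi_gt0.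
rewrite mul1r; have H : 2 * sig <= Num.sqrt (sig ^+ 2 * trigo.pi *+ 2).
  rewrite -[leLHS]ger0_norm; last by rewrite mulr_ge0 // ltW.
  rewrite -sqrtr_sqr ler_sqrt; last by rewrite mulrn_wge0 // mulr_ge0 ?sqr_ge0 ?pi_ge0.
  have p2 : 2 <= trigo.pi :> RR by exact: pi_ge2.
  have := ler_wpM2l (sqr_ge0 sig) p2; lra.
lra.
Qed.

End NormalMoments.

Section NormalRV.
Context {d : measure_display} {T : measurableType d}.
Variables (P : probability T RR) (sig : RR) (X : {RV P >-> RM}).
Hypotheses (sig_gt0 : 0 < sig)
  (normalX : forall A : set RM, measurable A -> distribution P X A = normal_prob 0 sig A).

Lemma integral_normal_RV (g : RR -> RR) : measurable_fun [set: RM] (g : RM -> RM) ->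
  (forall x, 0 <= g x) ->
  (\int[P]_w (g (X w))%:E = \int[normal_prob 0 sig]_x (g x)%:E)%E.
Proof.
move=> mg g0; have <- : (\int[distribution P X]_x (g x)%:E = \int[P]_w (g (X w))%:E)%E.
  rewrite ge0_integral_distribution //; exact/measurable_EFinP.
by rewrite (eq_measure_integral (normal_prob 0 sig)) // => A mA _; exact: normalX.
Qed.

Lemma integral_normal_RV_le (g : RR -> RR) (c : RR) : 0 <= c ->
  measurable_fun [set: RM] (g : RM -> RM) ->
  (forall x, 0 <= g x) -> (forall x, g x <= c * expR (x ^+ 2 / (4 * sig ^+ 2))) ->
  (\int[P]_w (g (X w))%:E <= (2 * c)%:E)%E.
Proof.
move=> c0 mg g0 gc; rewrite integral_normal_RV //.
have me : measurable_fun [set: RM] ((fun x : RR => expR (x ^+ 2 / (4 * sig ^+ 2))) : RM -> RM).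
  apply: (measurableT_comp (@measurable_expR RR)).
  by apply: measurable_funM; [exact: measurable_funX | exact: measurable_cst].
apply: (@le_trans _ _ (\int[normal_prob 0 sig]_x (c%:E * (expR (x ^+ 2 / (4 * sig ^+ 2)))%:E))%E).
  apply: ge0_le_integral => //.
  - by move=> x _; rewrite lee_fin.
  - exact/measurable_EFinP.
  - by apply/measurable_EFinP; apply: measurable_funM => //; exact: measurable_cst.
  - by move=> x _; rewrite -EFinM lee_fin.
have mE : measurable_fun [set: RM] (fun x : RM => (expR (x ^+ 2 / (4 * sig ^+ 2)))%:E).
  exact/measurable_EFinP.
rewrite ge0_integralZl //; try by [move=> x _; rewrite lee_fin expR_ge0].
apply: le_trans (lee_wpmul2l _ (normal_exp_moment sig_gt0)) _; first by rewrite lee_fin.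
by rewrite -EFinM lee_fin mulrC.
Qed.

Let scaled_sqr x : (x / sig) ^+ 2 = 4 * (x ^+ 2 / (4 * sig ^+ 2)).
Proof. by field; rewrite gt_eqF. Qed.

Let mg : measurable_fun [set: RM] ((fun x : RR => (x / sig) ^+ 2) : RM -> RM).
Proof. by apply: measurable_funX; apply: measurable_funM => //; exact: measurable_cst. Qed.

Lemma normal_RV_sqr : (\int[P]_w ((X w / sig) ^+ 2)%:E <= 8%:E)%E.
Proof.
have -> : 8 = 2 * 4 :> RR by ring.
apply: (integral_normal_RV_le (g := fun x => (x / sig) ^+ 2)) => // x.
  exact: sqr_ge0.
rewrite scaled_sqr; apply: ler_wpM2l => //.
by apply: le_trans (expR_ge1Dx _); rewrite lerDr.
Qed.

Lemma normal_RV_sqr_sqr : (\int[P]_w (((X w / sig) ^+ 2) ^+ 2)%:E <= 64%:E)%E.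
Proof.
have -> : 64 = 2 * 32 :> RR by ring.
apply: (integral_normal_RV_le (g := fun x => ((x / sig) ^+ 2) ^+ 2)) => // [|x|x].
- exact: measurable_funX.
- exact: sqr_ge0.
rewrite scaled_sqr; set y := _ / _.
have y0 : 0 <= y by apply: divr_ge0; [exact: sqr_ge0 | apply: mulr_ge0 => //; exact: sqr_ge0].
have := expR_ge1Dxn 1 y0.
have -> : (2`!%:R : RR) = 2 by [].
lra.
Qed.

Lemma normal_RV_small : (P [set w | (`|X w| <= sig / 4)%R] <= (4^-1)%:E)%E.
Proof.
apply: le_trans (normal_prob_small sig_gt0); rewrite -normalX //.
have -> : [set x : RR | (`|x| <= sig / 4)%R] = `[- (sig / 4), sig / 4].
  by apply/seteqP; split => x /=; rewrite in_itv /= ler_norml.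
exact: measurable_itv.
Qed.
End NormalRV.

(** * Joint laws of independent families *)

Section Law.
Context {d : measure_display} {T : measurableType d}.
Variables (P : probability T RR) (I : finType) (D : pred I).

(** The generated sigma-algebra sees only the coordinates in [D], on which independence and the
    marginal laws are assumed. *)
Definition boxes : set (set (I -> RR)) :=
  [set B | exists2 A : I -> set RM, (forall i, measurable (A i)) &
     B = \bigcap_(i in [set i | D i]) ((fun v : I -> RR => v i) @^-1` A i)].

Local Notation V := (g_sigma_algebraType boxes).

Lemma boxes_setI : setI_closed boxes.
Proof.
move=> _ _ [A mA ->] [B mB ->]; exists (fun i => A i `&` B i).
  by move=> i; exact: measurableI.
by rewrite -bigcapI.
Qed.

Lemma measurable_coord i : D i -> measurable_fun [set: V] ((fun v : V => v i) : V -> RM).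
Proof.
move=> Di _ A mA; rewrite setTI; apply: sub_sigma_algebra.
exists (fun j => if j == i then A else setT) => [j|].
  by case: ifP => // _.
apply/seteqP; split => [v vA j /= Dj|v /(_ i Di)] /=.
  by case: eqP => [->|].
by rewrite eqxx.
Qed.

Lemma measurable_family (X : I -> T -> RR) :
  (forall i, D i -> measurable_fun [set: T] (X i : T -> RM)) ->
  measurable_fun [set: T] ((fun w i => X i w) : T -> V).
Proof.
move=> mX; apply: (@measurability _ _ T V setT _ boxes) => //.
move=> _ [_ [A mA ->] <-]; rewrite setTI preimage_bigcap.
have -> : [set i | D i] = [set` [seq i <- enum I | D i]].
  by apply/seteqP; split => i /=; rewrite mem_filter mem_enum andbT.
rewrite bigcap_seq big_seq; apply: bigsetI_measurable => i.
rewrite mem_filter => /andP[Di _]; rewrite -[X in measurable X]setTI.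
exact: mX.
Qed.

(** Boxes are stable under intersection and independence fixes their probability, so the laws agree
    by Dynkin's theorem. *)
Lemma indep_law_eq (X Y : I -> T -> RR) :
  (forall i, D i -> measurable_fun [set: T] (X i : T -> RM)) ->
  (forall i, D i -> measurable_fun [set: T] (Y i : T -> RM)) ->
  mutual_indep P D X -> mutual_indep P D Y ->
  (forall i, D i -> forall A : set RM, measurable A -> P (X i @^-1` A) = P (Y i @^-1` A)) ->
  forall E : set V, measurable E ->
  P [set w | E (fun i => X i w)] = P [set w | E (fun i => Y i w)].
Proof.
move=> mX mY iX iY XY.
have mFX := measurable_family mX; have mFY := measurable_family mY.
have mpre (F : T -> V) (mF : measurable_fun [set: T] F) (E : set V) (mE : measurable E) :
    measurable (F @^-1` E) by rewrite -[X in measurable X]setTI; exact: mF.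
apply: (@dynkin_induction _ V boxes
  (fun E => P [set w | E (fun i => X i w)] = P [set w | E (fun i => Y i w)])) => //.
- exact: boxes_setI.
- move=> _ [A mA ->].
  transitivity (P (\bigcap_(i in [set i | D i]) (X i @^-1` A i))); first by congr (P _).
  rewrite iX // (eq_bigr (fun i => P (Y i @^-1` A i))) -?iY //.
  by move=> i Di; exact: XY.
- move=> E mE EE.
  have := probability_setC P (mpre _ mFX _ mE); have := probability_setC P (mpre _ mFY _ mE).
  rewrite /preimage /= => hY hX.
  by rewrite [LHS]hX [RHS]hY EE.
- move=> F mF tF FE.
  have tr (Z : T -> V) : trivIset [set: nat] (fun k => Z @^-1` F k).
    apply/trivIsetP => i j _ _ ij; move/trivIsetP: tF => /(_ i j Logic.I Logic.I ij) Fij.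
    by rewrite -preimage_setI Fij preimage_set0.
  have hX := measure_bigcup P setT (fun k => (fun w i => X i w) @^-1` F k)
    (fun k _ => mpre _ mFX _ (mF k)) (tr _).
  have hY := measure_bigcup P setT (fun k => (fun w i => Y i w) @^-1` F k)
    (fun k _ => mpre _ mFY _ (mF k)) (tr _).
  rewrite -preimage_bigcup in hX; rewrite -preimage_bigcup in hY.
  rewrite [LHS]hX [RHS]hY; apply: eq_eseriesr => k _; exact: FE.
Qed.
End Law.

Lemma lebesgue_measure_opp (A : set RM) : measurable A ->
  lebesgue_measure ((fun x : RR => - x) @^-1` A) = lebesgue_measure A.
Proof.
move=> mA; apply/esym.
have mo : measurable_fun [set: RM] ((fun x : RR => - x) : RM -> RM).
  by apply: measurable_funN; exact: measurable_id.
pose oppf : {mfun RM >-> RM} := HB.pack (fun x : RR => - x) (isMeasurableFun.Build _ _ _ _ _ mo).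
apply: (@lebesgue_measure_unique RR (pushforward lebesgue_measure oppf)) => // _ [[a b] _ <-].
have S : (`[- b, - a[%classic : set RR) = oppf @^-1` `]a, b].
  apply/seteqP.
  by split => x /=; rewrite !in_itv /= => /andP[H1 H2]; apply/andP; split; lra.
transitivity (lebesgue_measure (`[- b, - a[%classic : set RR)); last by rewrite S.
rewrite !lebesgue_measure_itv /= !lte_fin ltrN2; case: ifP => // _.
by rewrite -!EFinB opprK [(- a + b)%R]addrC.
Qed.

Section NormalSymmetric.
Variable sig : RR.
Hypothesis s0 : sig != 0.

Lemma normal_prob_opp (A : set RM) : measurable A ->
  normal_prob 0 sig ((fun x : RR => - x) @^-1` A) = normal_prob 0 sig A.
Proof.
move=> mA.
have mo : measurable_fun [set: RM] ((fun x : RR => - x) : RM -> RM).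
  by apply: measurable_funN; exact: measurable_id.
pose oppf : {mfun RM >-> RM} := HB.pack (fun x : RR => - x) (isMeasurableFun.Build _ _ _ _ _ mo).
rewrite /normal_prob.
transitivity (\int[pushforward lebesgue_measure oppf]_(x in A) (normal_pdf 0 sig x)%:E)%E.
  rewrite ge0_integral_pushforward //.
  - apply: eq_integral => x _ /=; congr (_%:E).
    by rewrite /normal_pdf (negPf s0) /normal_fun !subr0 sqrrN.
  - by apply/measurable_EFinP; apply: measurable_funTS; exact: measurable_normal_pdf.
  - by move=> x _; rewrite lee_fin normal_pdf_ge0.
rewrite (eq_measure_integral lebesgue_measure) // => B mB _.
exact: lebesgue_measure_opp.
Qed.
End NormalSymmetric.

(** * Binomial estimates *)

Lemma leq_ffact_exp n m : (n ^_ m <= n ^ m)%N.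
Proof.
elim: m => [|m IH]; first by rewrite ffactn0.
by rewrite ffactnSr expnSr leq_mul ?leq_subr.
Qed.

Lemma leq_exp_ffact n m : ((n - m) ^ m <= n ^_ m)%N.
Proof.
elim: m => [|m IH]; first by rewrite ffactn0.
rewrite ffactnSr expnSr leq_mul ?leq_sub2l //; apply: leq_trans IH.
by case: m => // m; rewrite leq_exp2r // leq_sub2l.
Qed.

Section Counting.
Variables (n q : nat).
Hypotheses (q_gt0 : (0 < q)%N) (qn : (2 * q <= n)%N).

Let n_gt0 : (0 < n)%N. Proof. lia. Qed.

Lemma SYK_sigma_sqr : SYK_sigma n q ^+ 2 = (q.-1)`!%:R / n%:R ^+ q.-1.
Proof. by rewrite sqr_sqrtr // divr_ge0 // exprn_ge0. Qed.

Lemma SYK_sigma_gt0 : 0 < SYK_sigma n q.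
Proof. by rewrite sqrtr_gt0 divr_gt0 ?exprn_gt0 ?ltr0n ?fact_gt0. Qed.

Lemma sigma_bin_le1 : SYK_sigma n q ^+ 2 * 'C(n, q.-1)%:R <= 1.
Proof.
rewrite SYK_sigma_sqr mulrAC ler_pdivrMr ?exprn_gt0 ?ltr0n // mul1r -natrM -natrX ler_nat.
by rewrite mulnC bin_ffact leq_ffact_exp.
Qed.

Lemma SYK_sigma_le1 : SYK_sigma n q <= 1.
Proof.
rewrite -(ler_pXn2r (n := 2)) ?nnegrE ?(ltW SYK_sigma_gt0) // expr1n.
apply: le_trans sigma_bin_le1; rewrite ler_peMr ?sqr_ge0 // ler1n bin_gt0; lia.
Qed.

Lemma bin_pred_ratio : q%:R * 'C(n, q)%:R = (n - q.-1)%:R * 'C(n, q.-1)%:R :> RR.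
Proof. by rewrite -!natrM -{1 2}(prednK q_gt0) mul_bin_left. Qed.

(** From [n >= 2q], every factor of the falling factorial is at least [n - q >= n / 2]. This lower
    bound is what sends the failure probability to 0. *)
Lemma sigma_bin_ge : n%:R / (q%:R * 2 ^+ q) <= SYK_sigma n q ^+ 2 * 'C(n, q)%:R.
Proof.
rewrite SYK_sigma_sqr.
have q0 : 0 < q%:R :> RR by rewrite ltr0n.
have n0 : 0 < n%:R :> RR by rewrite ltr0n.
have H : (n * n ^ q.-1 <= q * 2 ^ q * ((q.-1)`! * 'C(n, q)))%N.
  rewrite -expnS prednK //.
  have -> : (q * 2 ^ q * ((q.-1)`! * 'C(n, q)) = 2 ^ q * ('C(n, q) * (q * (q.-1)`!)))%N by ring.
  have -> : (q * (q.-1)`! = q`!)%N by rewrite -{1 3}(prednK q_gt0) factS.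
  rewrite bin_ffact; apply: (@leq_trans (2 ^ q * (n - q) ^ q)).
    by rewrite -expnMn leq_exp2r //; lia.
  by rewrite leq_mul2l leq_exp_ffact orbT.
rewrite ler_pdivrMr ?mulr_gt0 ?exprn_gt0 // (mulrAC _ (_ ^- _)) (mulrAC _ (_ ^- _)) ler_pdivlMr ?exprn_gt0 //.
by rewrite -!natrX -!natrM ler_nat; apply: leq_trans H _; rewrite mulnC.
Qed.

Lemma card_qsets : #|[pred I : {set 'I_n} | #|I| == q]| = 'C(n, q).
Proof. by rewrite -[n in RHS]card_ord -card_draws cardsE. Qed.

(** An odd intersection is nonempty, so [I] consists of a point of [K] and [q - 1] further
    points. *)
Lemma card_meeting (K : {set 'I_n}) : #|K| == q ->
  (#|[pred I : {set 'I_n} | (#|I| == q) && odd #|I :&: K|]| <= q * 'C(n, q.-1))%N.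
Proof.
move=> cK.
pose f (p : 'I_n * {set 'I_n}) : {set 'I_n} := (p.1 |: p.2)%SET.
pose A := [set p : 'I_n * {set 'I_n} | (p.1 \in K) && (#|p.2| == q.-1)]%SET.
have cA : #|A| = (q * 'C(n, q.-1))%N.
  have -> : A = finset.setX K [set J : {set 'I_n} | #|J| == q.-1]%SET.
    by apply/finset.setP => -[i J]; rewrite !inE.
  by rewrite cardsX (eqP cK) card_draws card_ord.
rewrite -cA; apply: leq_trans (leq_imset_card f A).
apply: subset_leq_card; apply/fintype.subsetP => I; rewrite inE => /andP[cI oI].
have nI : (I :&: K)%SET != finset.set0 by apply: contraL oI => /eqP ->; rewrite cards0.
case: (finset.set0Pn _ nI) => i; rewrite finset.in_setI => /andP[iI iK]; apply/imsetP; exists (i, (I :\ i)%SET).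
  by rewrite inE iK /=; move: cI; rewrite (cardsD1 i I) iI => /eqP <-.
by rewrite /f /= finset.setD1K.
Qed.
End Counting.

(** * Deviations under random signs *)

Lemma normr_Re_le_normc (z : CC) : `|cRe z| <= ComplexField.Normc.normc z.
Proof.
case: z => x y /=; rewrite -sqrtr_sqr ler_wsqrtr // lerDl sqr_ge0 //.
Qed.

Section Deviation.
Variables (n q : nat) (psi : 'I_n -> 'M[CC]_(2 ^ n./2)) (beta : RR).

Definition deviation (v v' : {set 'I_n} -> RR) : RR :=
  max_dev q psi (gibbs beta (SYK_H q psi v)) (gibbs beta (SYK_H q psi v')).

Lemma corr_le_deviation (I : {set 'I_n}) (v v' : {set 'I_n} -> RR) : #|I| == q ->
  `|corr q psi beta I v - corr q psi beta I v'| <= deviation v v'.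
Proof.
move=> cI; rewrite /deviation /max_dev.
apply: (@le_trans _ _ (ComplexField.Normc.normc
  (\tr (psiI psi I *m gibbs beta (SYK_H q psi v))
   - \tr (psiI psi I *m gibbs beta (SYK_H q psi v'))))).
  apply: le_trans (normr_Re_le_normc _).
  by rewrite raddfB /corr.
by rewrite (bigD1 I) //= le_max lexx.
Qed.

Hypotheses (q_gt0 : (0 < q)%N) (qeven : ~~ odd q) (beta_gt0 : 0 < beta)
  (mpsi : is_majorana psi) (qn : (2 * q <= n)%N).

Let sig := SYK_sigma n q.
Let M : RR := 'C(n, q)%:R.
Let c0 := rate beta (kap q) q%:R 4^-1 9.

Let card_D : #|(fun I : {set 'I_n} => #|I| == q)| = 'C(n, q).
Proof. by rewrite -card_qsets; apply: eq_card => I. Qed.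

Lemma flip_deviation_SYK (x b : {set 'I_n} -> RR) :
  (n - q.-1)%:R^-1 <= expR (- slope beta (kap q) q%:R 9) / 16 ->
  \sum_(I : {set 'I_n} | #|I| == q) (x I / sig) ^+ 2 < 9 * M ->
  \sum_(I : {set 'I_n} | #|I| == q) (`|x I| <= sig / 4)%R%:R < (4^-1 + 4^-1) * M ->
  pr RR (fun s => deviation (act s x) b < c0 / 4 * sig) <=
    (64 * 9 / 4^-1 ^+ 2 + 16) / c0 ^+ 2 / (sig ^+ 2 * M).
Proof.
move=> hdelta hsqr hsmall.
have s0 : 0 < sig by exact: SYK_sigma_gt0.
have M0 : 0 < M by rewrite ltr0n bin_gt0; lia.
have kap1 : kap q <= 1 by rewrite exprn_ile1 // invf_le1 ?ler1n.
pose theta (I : {set 'I_n}) : RR := if 0 <= x I then 1 else -1.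
pose G : pred {set 'I_n} := fun I => (#|I| == q) && ~~ (`|x I| <= sig / 4).
have := @flip_deviation _ (fun I : {set 'I_n} => #|I| == q)
  (fun I K => odd #|I :&: K|%SET) (freeF q psi beta) (corr q psi beta)
  beta (kap q) (n - q.-1)%:R^-1 q%:R sig beta_gt0 (kap_gt0 q) kap1 s0
  (SYK_sigma_le1 q_gt0 qn) (ler0n _ _)
  (freeF_ge beta qeven mpsi)
  (fun I v => corr_bound beta qeven mpsi v)
  (fun I v v' cI f => corr_flip_mono qeven beta_gt0 mpsi cI f.1 f.2)
  (fun I v v' cI f => corr_flip_le qeven beta_gt0 mpsi cI f.1 f.2)
  (fun I v v' L cI f => corr_flip_ge qeven beta_gt0 mpsi cI f.1 f.2 L).
rewrite card_D -/M.
(* Here [delta] is [1 / (n - q + 1)], the ratio of ['C(n, q.-1)] to [q * 'C(n, q)]. *)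
have h1 (v : {set 'I_n} -> RR) : \sum_(I : {set 'I_n} | #|I| == q) corr q psi beta I v ^+ 2 <=
    (n - q.-1)%:R^-1 * M * kap q.
  have q0 : 0 < q%:R :> RR by rewrite ltr0n.
  have nq0 : 0 < (n - q.-1)%:R :> RR by rewrite ltr0n; lia.
  rewrite -(ler_pM2l q0); apply: le_trans (sum_corr_sqr beta q_gt0 qeven mpsi v) _.
  have -> : q%:R * ((n - q.-1)%:R^-1 * M * kap q) = (n - q.-1)%:R^-1 * (q%:R * M) * kap q.
    by ring.
  by rewrite /M bin_pred_ratio // mulKf // gt_eqF.
have h2 (K : {set 'I_n}) : #|K| == q ->
    #|[pred I : {set 'I_n} | #|I| == q & odd #|(I :&: K)%SET|]|%:R * sig ^+ 2 <= q%:R.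
  move=> cK; apply: (@le_trans _ _ ((q * 'C(n, q.-1))%:R * sig ^+ 2)).
    by rewrite ler_wpM2r ?sqr_ge0 // ler_nat card_meeting.
  rewrite natrM -mulrA ler_piMr ?ler0n // mulrC; exact: sigma_bin_le1.
have GD I : G I -> #|I| == q by case/andP.
have th1 I : G I -> theta I ^+ 2 = 1 by rewrite /theta; case: ifP; rewrite ?sqrrN expr1n.
have th2 I : G I -> theta I * `|x I| = x I.
  rewrite /theta; case: (lerP 0 (x I)) => h _; first by rewrite mul1r ger0_norm.
  by rewrite mulN1r ltr0_norm // opprK.
have th3 I : G I -> 4^-1 * sig <= `|x I|.
  by case/andP => _; rewrite -ltNge mulrC => /ltW.
(* Fewer than [(1/4 + 1/4) M] couplings are small: 1/4 bounds the probability and 1/4 is the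
   Chebyshev slack. *)
have cG : M / 2 <= #|G|%:R.
  have -> : #|G|%:R = \sum_(I : {set 'I_n} | #|I| == q) (1 - (`|x I| <= sig / 4)%R%:R) :> RR.
    rewrite -sum1_card natr_sum big_mkcondr [LHS]big_mkcond [RHS]big_mkcond /=.
    by apply: eq_bigr => I _; rewrite /in_mem /= /G; case: (#|I| == q); case: (`|x I| <= sig / 4); rewrite /= ?subr0 ?subrr.
  rewrite big_split /= sumrN sumr_const.
  have -> : #|[pred I : {set 'I_n} | #|I| == q]| = 'C(n, q) by exact: card_qsets.
  rewrite -/M; lra.
have hx : \sum_(I : {set 'I_n} | #|I| == q) x I ^+ 2 <= 9 * sig ^+ 2 * M.
  have -> : \sum_(I : {set 'I_n} | #|I| == q) x I ^+ 2 =
      sig ^+ 2 * \sum_(I : {set 'I_n} | #|I| == q) (x I / sig) ^+ 2.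
    by rewrite mulr_sumr; apply: eq_bigr => I _; rewrite expr_div_n mulrC divfK // gt_eqF // exprn_gt0.
  by rewrite (_ : 9 * _ * M = sig ^+ 2 * (9 * M)) ?ler_pM2l ?exprn_gt0 ?ltW //; ring.
have bb (I : {set 'I_n}) : #|I| == q -> corr q psi beta I b ^+ 2 <= 1.
  by move=> cI; apply: le_trans kap1; exact: corr_bound.
move=> /(_ h1 h2 G x theta 4^-1 9 GD _ _ th1 th2 th3 cG M0 hx hdelta _ bb) H.
apply: le_trans (H _ _); [|by []|by []].
rewrite /pr /avg ler_wpM2l ?invr_ge0 ?ler0n //; apply: ler_sum => s _.
rewrite ler_nat; have [hd|//] := boolP (deviation (act s x) b < c0 / 4 * sig).
(* The sum has [M] terms, each at most the maximum. *)
rewrite (_ : (_ < _) = true) //; apply: le_lt_trans (_ : M * deviation (act s x) b < _).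
  apply: le_trans (ler_sum _ (fun I cI => corr_le_deviation (act s x) b cI)) _.
  rewrite sumr_const -mulr_natl (_ : #|_| = 'C(n, q)) //; exact: card_qsets.
by rewrite (_ : _ / 4 = M * (c0 / 4 * sig)) ?ltr_pM2l // -/c0; ring.
Qed.
End Deviation.

(** * Symmetrization *)

Section Independence.
Context d (T : measurableType d).
Variables (P : probability T RR) (I : finType) (D : pred I).

Lemma mutual_indep_pair (X : I -> T -> RR) (i j : I) (A B : set RM) :
  mutual_indep P D X -> D i -> D j -> i != j -> measurable A -> measurable B ->
  P (X i @^-1` A `&` X j @^-1` B) = (P (X i @^-1` A) * P (X j @^-1` B))%E.
Proof.
move=> ind Di Dj ij mA mB.
pose C k : set RM := if k == i then A else if k == j then B else setT.
have mC k : measurable (C k) by rewrite /C; do 2?case: ifP => // _.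
have Ci : C i = A by rewrite /C eqxx.
have Cj : C j = B by rewrite /C eq_sym (negbTE ij) eqxx.
have := ind C mC; rewrite (bigD1 i) //= (bigD1 j) /=; last by rewrite Dj eq_sym.
rewrite Ci Cj big1 ?mule1 => [<-|k /andP[/andP[_ ki] kj]].
  congr (P _); apply/seteqP; split => w.
    move=> [wA wB] k /= _; rewrite /C.
    by case: eqP => [->//|_]; case: eqP => [->//|_].
  by move=> h; split; [rewrite -Ci; apply: h|rewrite -Cj; apply: h].
by rewrite /C (negbTE ki) (negbTE kj) preimage_setT probability_setT.
Qed.

Definition signed (f : I -> bool) (v : I -> RR) : I -> RR := fun i => (-1) ^+ f i * v i.

Lemma signed_preimage (b : bool) (x : T -> RR) (B : set RM) :
  (fun w => (-1) ^+ b * x w) @^-1` B = x @^-1` (if b then -%R @^-1` B else B).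
Proof. by case: b; apply/seteqP; split => w /=; rewrite ?mulN1r ?mul1r. Qed.

Lemma measurable_signed (b : bool) (B : set RM) : measurable B ->
  measurable (if b then (-%R : RM -> RM) @^-1` B else B).
Proof.
move=> mB; case: b => //; rewrite -[X in measurable X]setTI.
by apply: oppr_measurable.
Qed.

Lemma mutual_indep_signed (f : I -> bool) (X : I -> T -> RR) :
  mutual_indep P D X -> mutual_indep P D (fun i w => signed f (X ^~ w) i).
Proof.
move=> ind B mB.
have := ind (fun i => if f i then (-%R : RM -> RM) @^-1` B i else B i)
  (fun i => measurable_signed _ (mB i)).
under eq_bigcapr do rewrite -signed_preimage.
by under [in RHS]eq_bigr do rewrite -signed_preimage.
Qed.

(* A symmetric law does not see the signs, so the event may be averaged over any
   family of sign patterns before integrating. *)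
Lemma prob_le_of_sign_average (X : I -> T -> RR) (S : finType) (f : S -> I -> bool)
    (E : set (g_sigma_algebraType (boxes D))) (e : RR) :
  (forall i, D i -> measurable_fun [set: T] (X i : T -> RM)) ->
  mutual_indep P D X ->
  (forall i, D i -> forall B : set RM, measurable B ->
     P (X i @^-1` ((-%R : RM -> RM) @^-1` B)) = P (X i @^-1` B)) ->
  measurable E -> (0 < #|S|)%N ->
  (forall v, \sum_s (`[< E (signed (f s) v) >])%:R <= e * #|S|%:R) ->
  (P [set w | E (X ^~ w)] <= e%:E)%E.
Proof.
move=> mX ind sym mE S0 avg.
pose Es s := [set w | E (signed (f s) (X ^~ w))].
have mY s i : D i -> measurable_fun [set: T] ((fun w => signed (f s) (X ^~ w) i) : T -> RM).
  by move=> Di; apply: measurable_funM => //; exact: mX.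
have PE s : P [set w | E (X ^~ w)] = P (Es s).
  apply: (@indep_law_eq _ _ P _ D X (fun i w => signed (f s) (X ^~ w) i)) => //.
  - exact: mY.
  - exact: mutual_indep_signed.
  - move=> i Di A mA; rewrite /signed signed_preimage; case: (f s i) => //.
    by rewrite sym.
have mEs s : measurable (Es s).
  have := measurable_family (mY s).
  by move=> /(_ measurableT _ mE); rewrite setTI.
have S0' : 0 < #|S|%:R :> RR by rewrite ltr0n.
rewrite -(@lee_pmul2r _ (#|S|%:R)%:E) //.
have -> : (P [set w | E (X ^~ w)] * (#|S|%:R)%:E = \sum_(s : S) P (Es s))%E.
  under eq_bigr do rewrite -PE.
  by rewrite sumr_const muleC; exact: mule_natl.
under eq_bigr => s _ do rewrite -[X in P X]setIT -integral_indic //.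
rewrite -ge0_integral_sum //; last first.
  by move=> s; apply/measurable_EFinP; exact: measurable_indic.
apply: (@le_trans _ _ (\int[P]_(w in setT) (e * #|S|%:R)%:E)%E).
  apply: ge0_le_integral => //.
  - by move=> w _; rewrite sumEFin lee_fin; apply: sumr_ge0 => s _; rewrite indicE ler0n.
  - apply: emeasurable_sum => s; apply/measurable_EFinP; exact: measurable_indic.
  - move=> w _; rewrite sumEFin lee_fin; apply: le_trans (avg (X ^~ w)).
    apply: ler_sum => s _; rewrite indicE ler_nat; case: (boolP (w \in _)) => //.
    by rewrite inE => h; rewrite asboolT.
by rewrite integral_cst // -EFinM [X in (_ * X)%E](probability_setT P) mule1.
Qed.
End Independence.

Lemma measurable_ltr_set d (T : measurableType d) (f g : T -> RR) :
  measurable_fun [set: T] (f : T -> RM) -> measurable_fun [set: T] (g : T -> RM) ->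
  measurable [set w | f w < g w].
Proof.
move=> mf mg; rewrite (_ : [set w | _] = ~` [set w | g w <= f w]).
  by apply: measurableC; exact: measurable_ler_set.
by apply/seteqP; split => w /=; rewrite ltNge => /negP.
Qed.

(** * Probability of a small deviation *)

Section Probability.
Variables (n q : nat) (beta : RR).
Hypotheses (q_gt0 : (0 < q)%N) (qeven : ~~ odd q) (beta_gt0 : 0 < beta)
  (qn : (2 * q <= n)%N).
Context d (T : measurableType d).
Variables (P : probability T RR) (J : bool -> {set 'I_n} -> {RV P >-> RM}).

Let sig := SYK_sigma n q.
Let M : RR := 'C(n, q)%:R.
Let c0 := rate beta (kap q) q%:R 4^-1 9.
Let D (I : {set 'I_n}) := #|I| == q.
Let Dp (p : bool * {set 'I_n}) := #|p.2| == q.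

Hypotheses (indJ : mutual_indep P Dp (fun p => J p.1 p.2))
  (lawJ : forall (b : bool) (I : {set 'I_n}), #|I| == q ->
       forall A : set RM, measurable A -> distribution P (J b I) A = normal_prob 0 sig A).

Let sig_gt0 : 0 < sig. Proof. exact: SYK_sigma_gt0. Qed.
Let cD : #|D| = 'C(n, q).
Proof. by rewrite -card_qsets; apply: eq_card => I. Qed.
Let cD_gt0 : (0 < #|D|)%N. Proof. by rewrite cD bin_gt0; lia. Qed.

Let pair_indep (I K : {set 'I_n}) : D I -> D K -> I != K ->
  forall A B : set RM, measurable A -> measurable B ->
  P (J true I @^-1` A `&` J true K @^-1` B) =
  (P (J true I @^-1` A) * P (J true K @^-1` B))%E.
Proof.
move=> DI DK IK A B mA mB.
exact: (mutual_indep_pair (i := (true, I)) (j := (true, K)) indJ).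
Qed.

Lemma coupling_sqr_sum_large :
  (P [set w | (9 * M <= \sum_(I : {set 'I_n} | #|I| == q) (J true I w / sig) ^+ 2)%R] <=
   (64 / M)%:E)%E.
Proof.
have mg : measurable_fun [set: RM] ((fun x => (x / sig) ^+ 2) : RM -> RM).
  by apply: measurable_funX; apply: measurable_funM.
have := @pairwise_chebyshev _ _ P _ D (fun I w => (J true I w / sig) ^+ 2) 8 64 1 ltr01.
rewrite cD expr1n mul1r (_ : 8 + 1 = 9 :> RR); last by ring.
apply => //.
- by move=> I _; exact: (measurableT_comp mg).
- by move=> I w; exact: sqr_ge0.
- by move=> I DI; apply: normal_RV_sqr => //; exact: lawJ.
- by move=> I DI; apply: normal_RV_sqr_sqr => //; exact: lawJ.
- move=> I K DI DK IK.
  apply: (@integral_indep_pair _ _ P (J true I) (J true K)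
    (fun x => (x / sig) ^+ 2) (fun x => (x / sig) ^+ 2)) => //.
  + exact: pair_indep.
  + by move=> x; exact: sqr_ge0.
  + by move=> x; exact: sqr_ge0.
- by rewrite -cD.
Qed.

Lemma coupling_small_count :
  (P [set w | ((4^-1 + 4^-1) * M <=
     \sum_(I : {set 'I_n} | #|I| == q) (`|J true I w| <= sig / 4)%R%:R)%R] <= (4 / M)%:E)%E.
Proof.
pose g (x : RR) : RR := (`|x| <= sig / 4)%R%:R.
have gg x : g x ^+ 2 = g x by rewrite /g; case: (_ <= _); rewrite ?expr1n ?expr0n.
have gE : g = \1_[set x | `|x| <= sig / 4].
  by apply/funext => x; rewrite indicE /g; congr (nat_of_bool _)%:R; apply/idP/idP => [h|]; rewrite inE.
have mset : measurable [set x : RM | `|x| <= sig / 4].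
  by apply: measurable_ler_set; [apply: measurable_normr_comp; exact: measurable_id|exact: measurable_cst].
have mg : measurable_fun [set: RM] (g : RM -> RM).
  by rewrite gE; exact: measurable_indic.
have intg I : D I -> (\int[P]_w (g (J true I w))%:E <= (4^-1)%:E)%E.
  move=> DI; rewrite (_ : (fun w => _) = (fun w => (\1_[set w | `|J true I w| <= sig / 4] w)%:E)).
    rewrite integral_indic // ?setIT; last first.
      by apply: measurable_ler_set; [exact: measurable_normr_comp|exact: measurable_cst].
    by apply: normal_RV_small => //; exact: lawJ.
  by apply/funext => w; rewrite gE !indicE; congr (nat_of_bool _)%:R%:E; apply/idP/idP; rewrite !inE.
have := @pairwise_chebyshev _ _ P _ D (fun I w => g (J true I w)) 4^-1 4^-1 4^-1.
rewrite cD (_ : 4^-1 / (4^-1 ^+ 2 * 'C(n, q)%:R) = 4 / M); last first.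
  by rewrite /M; have : 'C(n, q)%:R != 0 :> RR by [rewrite pnatr_eq0 -lt0n -cD]; move=> h; field.
apply => //.
- by move=> I _; exact: (measurableT_comp mg).
- by move=> I DI; under eq_integral do rewrite gg; exact: intg.
- move=> I K DI DK IK.
  apply: (@integral_indep_pair _ _ P (J true I) (J true K) g g) => //.
  exact: pair_indep.
- by rewrite -cD.
Qed.

Variable psi : 'I_n -> 'M[CC]_(2 ^ n./2).
Hypothesis mpsi : is_majorana psi.
Hypothesis small_delta : (n - q.-1)%:R^-1 <= expR (- slope beta (kap q) q%:R 9) / 16.

Let V := g_sigma_algebraType (boxes Dp).
Let sqr_sum (v : V) : RR := \sum_(I | D I) (v (true, I) / sig) ^+ 2.
Let small_count (v : V) : RR := \sum_(I | D I) (`|v (true, I)| <= sig / 4)%R%:R.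
Let dev (v : V) : RR :=
  deviation q psi beta (fun I => v (true, I)) (fun I => v (false, I)).
(** Typicality is part of the event because the bound on sign averages must hold for every [v]. Both
    typicality conditions depend on absolute values only, hence are invariant under the flips. *)
Let bad : set V := [set v | sqr_sum v < 9 * M] `&`
  ([set v | small_count v < (4^-1 + 4^-1) * M] `&` [set v | dev v < c0 / 4 * sig]).
Let K := (64 * 9 / 4^-1 ^+ 2 + 16) / c0 ^+ 2 / (sig ^+ 2 * M).

Let measurable_v (b : bool) (I : {set 'I_n}) : D I ->
  measurable_fun [set: V] ((fun v : V => v (b, I)) : V -> RM).
Proof. by move=> DI; apply: (measurable_coord (i := (b, I))). Qed.

Let measurable_bad : measurable bad.
Proof.
apply: measurableI; last apply: measurableI; apply: measurable_ltr_set;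
  try exact: measurable_cst.
- apply: measurable_sum_cond => I DI; apply: measurable_funX; apply: measurable_funM => //.
  exact: measurable_v.
- apply: measurable_sum_cond => I DI.
  have mA : measurable [set v : V | `|v (true, I)| <= sig / 4].
    by apply: measurable_ler_set; [apply: measurable_normr_comp; exact: measurable_v|exact: measurable_cst].
  rewrite (_ : (fun v : V => _) = \1_[set v : V | `|v (true, I)| <= sig / 4]).
    exact: measurable_indic.
  by apply/funext => v; rewrite indicE; congr (nat_of_bool _)%:R; apply/idP/idP => [h|]; rewrite inE.
- by apply: measurable_max_dev => // I DI; exact: measurable_v.
Qed.

Let S := {ffun {set 'I_n} -> bool}.
(** Only the couplings of the first instance change sign; the second stays fixed and plays the role
    of [b]. *)
Let flips (s : S) (p : bool * {set 'I_n}) := p.1 && s p.2.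

(** For atypical [v] all signed versions are atypical and the sum vanishes; otherwise
    [flip_deviation_SYK] applies. *)
Let flip_average (v : V) :
  \sum_(s : S) (`[< bad (signed (flips s) v) >])%:R <= K * #|S|%:R.
Proof.
pose x I := v (true, I); pose b I := v (false, I).
have fx (s : S) : (fun I => signed (flips s) v (true, I)) = act s x by [].
have fb (s : S) : (fun I => signed (flips s) v (false, I)) = b.
  by apply/funext => I; rewrite /signed mul1r.
have nx (s : S) I : `|signed (flips s) v (true, I)| = `|x I|.
  by rewrite /signed normrM normrX normrN1 expr1n mul1r.
have qx (s : S) I : (signed (flips s) v (true, I) / sig) ^+ 2 = (x I / sig) ^+ 2.
  by rewrite /signed -mulrA exprMn sqrr_sign mul1r.
have S0 : 0 < #|S|%:R :> RR by rewrite ltr0n; apply/card_gt0P; exists [ffun=> false].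
have K0 : 0 <= K.
  have a0 : 0 <= 64 * 9 / 4^-1 ^+ 2 + 16 :> RR by lra.
  have c2 : 0 <= c0 ^- 2 by rewrite invr_ge0 exprn_even_ge0.
  have s2 : 0 <= (sig ^+ 2 * M)^-1 by rewrite invr_ge0 mulr_ge0 ?ler0n ?exprn_even_ge0.
  exact: mulr_ge0 (mulr_ge0 a0 c2) s2.
have [h1|h1] := ltP (\sum_(I | D I) (x I / sig) ^+ 2) (9 * M); last first.
  rewrite big1 ?(mulr_ge0 K0 (ltW S0)) // => s _; rewrite asboolF // => -[+ _].
  rewrite /sqr_sum /=; under eq_bigr do rewrite qx; by rewrite ltNge h1.
have [h2|h2] := ltP (\sum_(I | D I) (`|x I| <= sig / 4)%R%:R) ((4^-1 + 4^-1) * M); last first.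
  rewrite big1 ?(mulr_ge0 K0 (ltW S0)) // => s _; rewrite asboolF // => -[_ [+ _]].
  rewrite /small_count /=; under eq_bigr do rewrite nx; by rewrite ltNge h2.
have := flip_deviation_SYK q_gt0 qeven beta_gt0 mpsi qn b small_delta h1 h2.
rewrite -/K /pr /avg ler_pdivrMl // => H; rewrite [leRHS]mulrC; apply: le_trans H.
apply: ler_sum => s _; rewrite ler_nat; case: asboolP => // -[_ [_]].
by rewrite /dev /= fx fb => ->.
Qed.

Lemma deviation_small_prob :
  (P [set w | (deviation q psi beta (fun I => J true I w) (fun I => J false I w) < c0 / 4 * sig)%R]
   <= (K + 64 / M + 4 / M)%:E)%E.
Proof.
have Pbad : (P [set w | bad (fun p => J p.1 p.2 w)] <= K%:E)%E.
  apply: (prob_le_of_sign_average (D := Dp) (X := fun p w => J p.1 p.2 w) (f := flips)) => //.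
  - move=> [b I] /= DI B mB.
    have mB' : measurable ((-%R : RM -> RM) @^-1` B) by exact: (measurable_signed true).
    have e1 := lawJ b DI mB; have := lawJ b DI mB'.
    by rewrite normal_prob_opp ?gt_eqF // => e2; exact: etrans e2 (esym e1).
  - by apply/card_gt0P; exists [ffun=> false].
have mJ b I : measurable_fun [set: T] (J b I : T -> RM) by [].
have mbad : measurable [set w | bad (fun p => J p.1 p.2 w)].
  have := measurable_family (D := Dp) (X := fun p w => J p.1 p.2 w) (fun p _ => mJ p.1 p.2).
  by move=> /(_ measurableT _ measurable_bad); rewrite setTI.
have mlarge : measurable [set w | 9 * M <= \sum_(I | D I) (J true I w / sig) ^+ 2].
  apply: measurable_ler_set; first exact: measurable_cst.
  apply: measurable_sum_cond => I DI; apply: measurable_funX; apply: measurable_funM.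
    exact: mJ.
  exact: measurable_cst.
have mcount : measurable [set w | (4^-1 + 4^-1) * M <=
    \sum_(I | D I) (`|J true I w| <= sig / 4)%R%:R].
  apply: measurable_ler_set; first exact: measurable_cst.
  apply: measurable_sum_cond => I DI.
  have mA : measurable [set w | `|J true I w| <= sig / 4].
    by apply: measurable_ler_set; [exact: measurable_normr_comp|exact: measurable_cst].
  rewrite (_ : (fun w => _) = \1_[set w | `|J true I w| <= sig / 4]).
    exact: measurable_indic.
  by apply/funext => w; rewrite indicE; congr (nat_of_bool _)%:R; apply/idP/idP => [h|]; rewrite inE.
have mdev : measurable [set w |
    deviation q psi beta (fun I => J true I w) (fun I => J false I w) < c0 / 4 * sig].
  by apply: measurable_ltr_set; [exact: measurable_max_dev|exact: measurable_cst].
rewrite !EFinD; apply: le_trans _ (leeD (leeD Pbad coupling_sqr_sum_large) coupling_small_count).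
apply: le_trans _ (leeD (measureU2 P mbad mlarge) (lexx _)).
apply: le_trans _ (measureU2 P (measurableU _ _ mbad mlarge) mcount).
apply: le_measure; rewrite ?inE //; first by do 2?apply: measurableU.
move=> w /= hw.
have [h1|h1] := ltP (\sum_(I | D I) (J true I w / sig) ^+ 2) (9 * M); last by left; right.
have [h2|h2] := ltP (\sum_(I | D I) (`|J true I w| <= sig / 4)%R%:R) ((4^-1 + 4^-1) * M); last by right.
by left; left.
Qed.
End Probability.

Lemma SYK_sigma_powR (n q : nat) : (0 < q)%N ->
  SYK_sigma n q = Num.sqrt (q.-1)`!%:R * (n%:R `^ (- ((q%:R - 1) / 2))).
Proof.
move=> q0; rewrite /SYK_sigma sqrtrM ?ler0n // sqrtrV ?exprn_ge0 // powRN powRrM.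
rewrite (_ : q%:R - 1 = q.-1%:R :> RR); last by rewrite -{1}(prednK q0) -natr1 addrK.
by rewrite powR_mulrn ?powR12_sqrt ?exprn_ge0.
Qed.

Lemma exists_nat_ge (x : RR) : exists N : nat, forall n : nat, (N <= n)%N -> x <= n%:R.
Proof.
exists (Num.truncn x).+1 => n Nn; apply: ltW; apply: lt_le_trans (truncnS_gt x) _.
by rewrite ler_nat.
Qed.

Theorem mainTheorem12 (q : nat) (beta : RR) :
  (4 <= q)%N -> ~~ odd q -> 0 < beta ->
  exists c : RR, 0 < c /\
  forall eps : RR, 0 < eps ->
  exists N : nat, forall n : nat, (N <= n)%N -> ~~ odd n ->
  forall (d : measure_display) (T : measurableType d) (P : probability T RR)
    (J : bool -> {set 'I_n} -> {RV P >-> RM}),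
    (* the 2 * binom(n,q) couplings of H (b = true) and H' (b = false)
       are mutually independent ... *)
    mutual_indep P (fun p : bool * {set 'I_n} => #|p.2| == q)
                   (fun p => J p.1 p.2) ->
    (* ... and each is N(0, sigma^2) with sigma^2 = (q-1)!/n^(q-1) *)
    (forall (b : bool) (I : {set 'I_n}), #|I| == q ->
       forall A : set RM, measurable A ->
         distribution P (J b I) A = normal_prob 0 (SYK_sigma n q) A) ->
  forall psi : 'I_n -> 'M[CC]_(2 ^ n./2), is_majorana psi ->
  ((1 - eps)%:E <=
   P [set w | (c * (n%:R `^ (- ((q%:R - 1) / 2))) <=
              max_dev q psi
                (gibbs beta (SYK_H q psi (fun I => J true I w)))
                (gibbs beta (SYK_H q psi (fun I => J false I w))))%R])%E.
Proof.
move=> q4 qeven beta_gt0.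
have q_gt0 : (0 < q)%N by apply: leq_trans q4.
pose c0 := rate beta (kap q) q%:R 4^-1 9.
have c0_gt0 : 0 < c0 by apply: rate_gt0 => //; exact: kap_gt0.
(* The square root converts [sigma] into [n^(-(q-1)/2)]. *)
pose c := c0 / 4 * Num.sqrt (q.-1)`!%:R.
exists c; split; first by apply: mulr_gt0; [exact: divr_gt0|rewrite sqrtr_gt0 ltr0n fact_gt0].
move=> eps eps_gt0.
pose delta0 := expR (- slope beta (kap q) q%:R 9) / 16.
have delta0_gt0 : 0 < delta0 by rewrite divr_gt0 // expR_gt0.
pose K := (64 * 9 / 4^-1 ^+ 2 + 16) / c0 ^+ 2.
have K0 : 0 <= K.
  have a0 : 0 <= 64 * 9 / 4^-1 ^+ 2 + 16 :> RR by lra.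
  by apply: mulr_ge0 a0 _; rewrite invr_ge0 exprn_even_ge0.
have [N1 hN1] := exists_nat_ge delta0^-1.
have [N2 hN2] := exists_nat_ge ((K + 68) * (q%:R * 2 ^+ q) / eps).
(* [N1] makes [1 / (n - q + 1)] small enough for [small_delta], the summand [2 * q] paying for the
   shift; [N2] brings the failure probability below [eps]. *)
exists (2 * q + N1 + N2)%N => n Nn neven d T P J indJ lawJ psi mpsi.
have qn : (2 * q <= n)%N by lia.
have small : (n - q.-1)%:R^-1 <= delta0.
  have h : delta0^-1 <= (n - q.-1)%:R by apply: hN1; lia.
  by rewrite -[leRHS]invrK lef_pV2 // posrE ?invr_gt0 // (lt_le_trans _ h) ?invr_gt0.
have nE : (K + 68) * (q%:R * 2 ^+ q) / eps <= n%:R by apply: hN2; lia.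
set sig := SYK_sigma n q.
have sig_gt0 : 0 < sig by exact: SYK_sigma_gt0.
have -> : c * (n%:R `^ (- ((q%:R - 1) / 2))) = c0 / 4 * sig.
  by rewrite /sig SYK_sigma_powR // /c !mulrA.
pose M : RR := 'C(n, q)%:R.
have M0 : 0 < M by rewrite ltr0n bin_gt0; lia.
have := deviation_small_prob q_gt0 qeven beta_gt0 qn indJ lawJ mpsi small.
rewrite -/c0 -/K -/sig -/M => bad.
have mdev : measurable_fun [set: T] ((fun w => deviation q psi beta
    (fun I => J true I w) (fun I => J false I w)) : T -> RM).
  by apply: measurable_max_dev.
set A := (X in P X).
have mB : measurable [set w | deviation q psi beta (fun I => J true I w) (fun I => J false I w) < c0 / 4 * sig].
  by apply: measurable_ltr_set => //; exact: measurable_cst.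
have -> : A = ~` [set w | deviation q psi beta (fun I => J true I w) (fun I => J false I w) < c0 / 4 * sig].
  by apply/seteqP; split => w; rewrite /A /= leNgt => /negP.
rewrite probability_setC // EFinB leeB //; apply: le_trans bad _; rewrite lee_fin.
have sM : n%:R / (q%:R * 2 ^+ q) <= sig ^+ 2 * M by exact: sigma_bin_ge.
have qq : 0 < q%:R * 2 ^+ q :> RR by rewrite mulr_gt0 ?ltr0n ?exprn_gt0.
(* The two Chebyshev terms are put over the common denominator using [sig <= 1]. *)
have h68 : K / (sig ^+ 2 * M) + 64 / M + 4 / M <= (K + 68) / (sig ^+ 2 * M).
  have : 68 / M <= 68 / (sig ^+ 2 * M).
    rewrite ler_pM2l // lef_pV2 ?posrE ?mulr_gt0 ?exprn_gt0 // ler_piMl ?(ltW M0) //.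
    by rewrite exprn_ile1 ?(ltW sig_gt0) //; exact: SYK_sigma_le1.
  rewrite (mulrDl K 68) -addrA lerD2l -(mulrDl 64 4) (_ : 64 + 4 = 68 :> RR) //; ring.
apply: le_trans h68 _.
rewrite ler_pdivrMr ?mulr_gt0 ?exprn_gt0 // -ler_pdivrMl //; apply: le_trans _ sM.
by rewrite ler_pdivlMr // -mulrA [leLHS]mulrC.
Qed.
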